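(* Let $P$ and $H^{(f_1)},\dots,H^{(f_k)}$ (for some $k\ge 0$) be packaged arrow presentations with pairwise disjoint edge sets, let $f_1,\dots,f_k$ be distinct edges of $P$, let $e^{(i)}$ be an edge of $H^{(f_i)}$, and let $\varphi_i$ be a coupling of $f_i$ and $e^{(i)}$ for $i=1,\dots,k$. Let \[P[k]=P\oplus_{\varphi_1}H^{(f_1)}\oplus_{\varphi_2}\cdots\oplus_{\varphi_k}H^{(f_k)}.\] Let $\mathbf{w}=\{(a_f,b_f,c_f,x_f,y_f): f\in E(P[k])\}$ be a family of indeterminate 5-tuples indexed by the edges of $P[k]$ (these are the edges of $P$ other than $f_1,\dots,f_k$ together with the edges of the $H^{(f_i)}$ other than the $e^{(i)}$). For each $i$, let $\phi^{(f_i)}_{(=,2)},\phi^{(f_i)}_{(\parallel,2)},\phi^{(f_i)}_{\times},\phi^{(f_i)}_{(=,1)},\phi^{(f_i)}_{(\parallel,1)}$ be the unique solution of \[\alpha\beta\gamma\begin{bmatrix}\alpha\beta&1&1&\alpha&1\\1&\alpha\gamma&1&1&\alpha\\1&1&\alpha&1&1\\\alpha&1&1&\alpha&1\\1&\alpha&1&1&\alpha\end{bmatrix}\begin{bmatrix}\phi^{(f_i)}_{(=,2)}\\\phi^{(f_i)}_{(\parallel,2)}\\\phi^{(f_i)}_{\times}\\\phi^{(f_i)}_{(=,1)}\\\phi^{(f_i)}_{(\parallel,1)}\end{bmatrix}=\begin{bmatrix}\mathbf{Q}(H^{(f_i)}\setminus e^{(i)};\mathbf{w},\alpha,\beta,\gamma)\\\mathbf{Q}(H^{(f_i)}/e^{(i)};\mathbf{w},\alpha,\beta,\gamma)\\\mathbf{Q}(H^{(f_i)}\dagger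 e^{(i)};\mathbf{w},\alpha,\beta,\gamma)\\\mathbf{Q}(H^{(f_i)}\setminus_m e^{(i)};\mathbf{w},\alpha,\beta,\gamma)\\\mathbf{Q}(H^{(f_i)}/_m e^{(i)};\mathbf{w},\alpha,\beta,\gamma)\end{bmatrix},\] where in each $\mathbf{Q}(H^{(f_i)}\,\cdot\, e^{(i)};\mathbf{w},\ldots)$ the edges are weighted by their tuples from $\mathbf{w}$. Let \[\mathbf{w}'=\{(\phi^{(f_i)}_{(=,2)},\phi^{(f_i)}_{(\parallel,2)},\phi^{(f_i)}_{\times},\phi^{(f_i)}_{(=,1)},\phi^{(f_i)}_{(\parallel,1)})\text{ assigned to } f_i: i=1,\dots,k\}\cup\{(a_f,b_f,c_f,x_f,y_f)\text{ assigned to } f: f\in E(P)\setminus\{f_1,\dots,f_k\}\}.\] Then $\mathbf{Q}(P[k];\mathbf{w},\alpha,\beta,\gamma)=\mathbf{Q}(P;\mathbf{w}',\alpha,\beta,\gamma)$.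
   Context: An arrow presentation $A$ consists of a finite set $V(A)$ of disjoint circles (the vertices), a finite set of pairwise disjoint arrows (directed arcs) lying on the circles, and a finite set $E(A)$ of labels (the edges), such that every arrow carries one label and every label is carried by exactly two arrows (which constitute that edge). An arrow running along a circle from point $p$ to point $q$ is written $\overrightarrow{pq}$. Two arrow presentations are equivalent if one is obtained from the other by a diffeomorphism of the circles sending arrows to arrows, reversing the directions of both arrows of some (possibly empty) set of edges, and a bijection of edge sets respecting labels; arrow presentations are considered up to equivalence. Boundary components: for every edge $e$ with arrows $\overrightarrow{p_1p_2},\overrightarrow{q_1q_2}$, remove both arrows together with the interiors of the arcs they lie on and add one curve joining $q_2$ to $p_1$ and another joining $p_2$ to $q_1$; the resulting closed curves are the boundary components, forming the set $B(A)$. For an edge $e$ with arrows $\overrightarrow{p_1p_2},\overrightarrow{q_1q_2}$: the deletion $A\setminus e$ removes the two arrows (not the arcs they lie on) and removes $e$ from the edge set; the contraction $A/e$ removes the two arrows together with the interiors of their arcs, identifies $p_1$ with $q_2$ and $p_2$ with $q_1$, and removes $e$; the Penrose-contraction $A\dagger e$ does the same but identifies $p_1$ with $q_1$ and $p_2$ with $q_2$. A packaged arrow presentation is a triple $P=(A,\mathcal V,\mathcal B)$ with $A$ an arrow presentation, $\mathcal V$ a partition of $V(A)$ and $\mathcal B$ a partition of $B(A)$; $[v]$ denotes the block containing $v$. Edges, vertices, etc. of $P$ are those of $A$. For an edge $e$ let $u,v$ be its incident vertices and $a,b$ its incident boundary components (possibly $u=v$, $a=b$). Vertices of $A$ and $A\setminus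 e$ are naturally identified; vertices of $A$ other than $u,v$ are identified with vertices of $A/e$ (resp. $A\dagger e$), and the remaining vertices of $A/e$ (resp. $A\dagger e$) form the set $T$ of vertices created. Boundary components of $A$ and $A/e$ are naturally identified; boundary components of $A$ other than $a,b$ are identified with boundary components of $A\setminus e$ (resp. $A\dagger e$), the remaining ones forming the set $S$ of boundary components created. Define $\mathcal V'=(\mathcal V-\{[u],[v]\})\cup\{[u]\cup[v]\}$, $\mathcal B'=(\mathcal B-\{[a],[b]\})\cup\{[a]\cup[b]\cup S-\{a,b\}\}$ (with $S$ from the deletion), $\mathcal V''=(\mathcal V-\{[u],[v]\})\cup\{[u]\cup[v]\cup T-\{u,v\}\}$ (with $T$ from the contraction), $\mathcal B''=(\mathcal B-\{[a],[b]\})\cup\{[a]\cup[b]\}$, and $\mathcal V''',\mathcal B'''$ as $\mathcal V'',\mathcal B'$ but with $T,S$ the sets created by the Penrose-contraction. Then: deletion $P\setminus e=(A\setminus e,\mathcal V,\mathcal B')$; merge-deletion $P\setminus_m e=(A\setminus e,\mathcal V',\mathcal B')$; contraction $P/e=(A/e,\mathcal V'',\mathcal B)$; merge-contraction $P/_m e=(A/e,\mathcal V'',\mathcal B'')$; Penrose-contraction $P\dagger e=(A\dagger e,\mathcal V''',\mathcal B''')$. A coupling of an edge $f$ of $P$ and an edge $e$ of $H$ is a bijection $\varphi$ from the two arrows constituting $f$ to the two arrows constituting $e$. 2-sum: let $P=(A,\mathcal V,\mathcal B)$, $H=(A',\mathcal V',\mathcal B')$, and suppose $\varphi$ sends $\overrightarrow{p_1p_2}$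 to $\overrightarrow{q_1q_2}$ and $\overrightarrow{p_3p_4}$ to $\overrightarrow{q_3q_4}$. The arrow presentation $A\oplus_\varphi A'$ is obtained from the disjoint union by deleting these four arrows together with the interiors of the arcs they lie on and identifying $p_i$ with $q_i$ for $i=1,\dots,4$. In $A$ let $u$ (resp. $v$) be the vertex containing $\overrightarrow{p_1p_2}$ (resp. $\overrightarrow{p_3p_4}$), $a$ the boundary component containing $p_1,p_4$, $b$ the one containing $p_2,p_3$; define $u',v',a',b'$ likewise in $A'$ using the $q_i$. In $A\oplus_\varphi A'$ let $\alpha_0,\beta_0,\gamma_0,\delta_0$ be the vertices and $h,i,j,k$ the boundary components containing $p_1=q_1$, $p_2=q_2$, $p_3=q_3$, $p_4=q_4$ respectively. Then $P\oplus_\varphi H=(A\oplus_\varphi A',\mathcal V^*,\mathcal B^* )$ where $\mathcal V^*=(\mathcal V\cup\mathcal V'-\{[u],[v],[u'],[v']\})\cup\{[u]\cup[u']\cup\{\alpha_0,\beta_0\}-\{u,u'\}\}\cup\{[v]\cup[v']\cup\{\gamma_0,\delta_0\}-\{v,v'\}\}$ and $\mathcal B^*=(\mathcal B\cup\mathcal B'-\{[a],[b],[a'],[b']\})\cup\{[a]\cup[a']\cup\{h,k\}-\{a,a'\}\}\cup\{[b]\cup[b']\cup\{i,j\}-\{b,b'\}\}$. Iterated 2-sums along couplings of distinct edges are independent of order and bracketing. Polynomial $\mathbf{Q}$: given a packaged arrow presentation $P=(A,\mathcal V,\mathcal B)$ and a 5-tuple $(a_e,b_e,c_e,x_e,y_e)$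 of weights for each edge $e$ (collectively $\mathbf{w}$), $\mathbf{Q}(P;\mathbf{w},\alpha,\beta,\gamma)$ is the unique map satisfying $\mathbf{Q}(P)=a_e\mathbf{Q}(P\setminus e)+b_e\mathbf{Q}(P/e)+c_e\mathbf{Q}(P\dagger e)+x_e\mathbf{Q}(P\setminus_m e)+y_e\mathbf{Q}(P/_m e)$ for any edge $e$, and $\mathbf{Q}(P)=\alpha^{|V(A)|}\beta^{|\mathcal V|}\gamma^{|\mathcal B|}$ if $A$ has no edges.
   Formalization: In the 2-sum, when [u]=[v] or [u']=[v'] the two displayed new blocks of 𝒱* overlap or keep vanished vertices, so 𝒱* is no partition; here they are fused into one block with u,v,u',v' removed, and likewise for ℬ* with a,b,a',b'. *)

(* Defs.v *)
From HB Require Import structures.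
From mathcomp Require Import all_boot all_order perm all_algebra.
From mathcomp Require Import finmap ring.
From Stdlib Require Import FunctionalExtensionality.
Set Implicit Arguments.
Unset Strict Implicit.
Unset Printing Implicit Defensive.
Import GRing.Theory.
Local Open Scope fmap_scope.
Local Open Scope ring_scope.

(* An arrow [pq> is the pair (p, q) of its tail and its head; an edge is the  *)
(* pair of its two arrows, listed in an arbitrary order.                      *)
Notation arrow T := (T * T)%type.
Notation edge T := (arrow T * arrow T)%type.

Definition nth_arrow (T : Type) (x : edge T) (i : bool) : arrow T :=
  if i then x.2 else x.1.

Definition ends (T : Type) (x : edge T) : seq T :=
  [:: x.1.1; x.1.2; x.2.1; x.2.2].

Definition map_edge (T T' : Type) (h : T -> T') (x : edge T) : edge T' :=
  ((h x.1.1, h x.1.2), (h x.2.1, h x.2.2)).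

(* The circles are cut by finitely many points into arcs of two alternating   *)
(* kinds, each point being the end of one arc of each kind: [gap x] and       *)
(* [seg x] are the other ends of the two arcs at x. Arrows run along arcs of  *)
(* the second kind, but such an arc need not carry an arrow, so that circles  *)
(* without arrows are allowed. Replacing an arc from x to y by arcs of the    *)
(* second kind, or identifying two points after removal of the arcs of the    *)
(* second kind at them, then amounts to redefining [seg] there.               *)
Record arrow_pres (L : choiceType) := ArrowPres {
  pt : finType;
  gap : pt -> pt;
  seg : pt -> pt;
  edges : {fmap L -> edge pt}
}.

Notation "'E(' A ')'" := (domf (edges A)) (format "'E(' A ')'").

Record arrow_pres_wf (L : choiceType) (A : arrow_pres L) : Prop := {
  gapK : involutive (@gap L A);
  gap_neq : forall x : pt A, gap x != x;
  segK : involutive (@seg L A);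
  seg_neq : forall x : pt A, seg x != x;
  arrow_seg : forall (e : E(A)) (i : bool),
    seg (nth_arrow (edges A e) i).1 = (nth_arrow (edges A e) i).2;
  ends_uniq : forall e : E(A), uniq (ends (edges A e));
  ends_disj : forall (e e' : E(A)) (x : pt A),
    x \in ends (edges A e) -> x \in ends (edges A e') -> e = e'
}.

Section Circles.
Variables (L : choiceType) (A : arrow_pres L).

Definition vrel : rel (pt A) := fun x y => (y == gap x) || (y == seg x).

Definition vertex_at (x : pt A) : {set pt A} := [set y | connect vrel x y].

Definition vertices : {set {set pt A}} := [set vertex_at x | x : pt A].

(* The curves added for an edge with arrows [p1p2>, [q1q2> join q2 to p1 and  *)
(* p2 to q1.                                                                  *)
Definition bcurves (T : Type) (x : edge T) : seq (T * T) :=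
  let: ((p1, p2), (q1, q2)) := x in
  [:: (q2, p1); (p1, q2); (p2, q1); (q1, p2)].

Definition brel : rel (pt A) := fun x y =>
  (y == gap x) ||
  (if [exists e : E(A), x \in ends (edges A e)]
   then [exists e : E(A), (x, y) \in bcurves (edges A e)]
   else y == seg x).

Definition bdry_at (x : pt A) : {set pt A} := [set y | connect brel x y].

Definition bdries : {set {set pt A}} := [set bdry_at x | x : pt A].

End Circles.

Definition relink (T : eqType) (f : T -> T) (x y : T) : T -> T :=
  fun z => if z == x then y else if z == y then x else f z.

Section ArrowPresOps.
Variables (L : choiceType) (e : L) (A : arrow_pres L).

Definition adel : arrow_pres L := ArrowPres (@gap L A) (@seg L A) (edges A).[~ e].

Definition acontr : arrow_pres L :=
  ArrowPres (@gap L A)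
    (if (edges A).[? e] is Some ((p1, p2), (q1, q2))
     then relink (relink (@seg L A) p1 q2) p2 q1 else @seg L A)
    (edges A).[~ e].

Definition apenrose : arrow_pres L :=
  ArrowPres (@gap L A)
    (if (edges A).[? e] is Some ((p1, p2), (q1, q2))
     then relink (relink (@seg L A) p1 q1) p2 q2 else @seg L A)
    (edges A).[~ e].

End ArrowPresOps.

Record packaged (L : choiceType) := Packaged {
  pres :> arrow_pres L;
  vpart : {set {set {set pt pres}}};
  bpart : {set {set {set pt pres}}}
}.

Record packaged_wf (L : choiceType) (P : packaged L) : Prop := {
  pres_wf : arrow_pres_wf P;
  vpart_wf : partition (vpart P) (vertices P);
  bpart_wf : partition (bpart P) (bdries P)
}.

Section PartitionOps.
Variable T : finType.
Implicit Types (PP : {set {set T}}) (C : {set T}) (x y : T).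

Definition join_blocks PP x y : {set {set T}} :=
  (PP :\: [set pblock PP x; pblock PP y])
  :|: [set pblock PP x :|: pblock PP y].

(* x and y are removed before C is added: circles being sets of points, an    *)
(* element of C may coincide, as a set, with the old circle x or y.           *)
Definition replace_blocks PP x y C : {set {set T}} :=
  (PP :\: [set pblock PP x; pblock PP y])
  :|: [set ((pblock PP x :|: pblock PP y) :\: [set x; y]) :|: C].

(* The circles in [new] that are not identified with a circle in [old] other  *)
(* than x and y.                                                              *)
Definition created (old new : {set T}) x y : {set T} :=
  new :\: (old :\: [set x; y]).

End PartitionOps.

Section PackagedOps.
Variables (L : choiceType) (e : L) (P : packaged L).

(* The values for a label that is not an edge of P are irrelevant.            *)
Definition vjoin : {set {set {set pt P}}} :=
  if (edges P).[? e] is Some ((p1, _), (q1, _))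
  then join_blocks (vpart P) (vertex_at p1) (vertex_at q1) else vpart P.

Definition bjoin : {set {set {set pt P}}} :=
  if (edges P).[? e] is Some ((p1, p2), _)
  then join_blocks (bpart P) (bdry_at p1) (bdry_at p2) else bpart P.

Definition vreplace (new : {set {set pt P}}) : {set {set {set pt P}}} :=
  if (edges P).[? e] is Some ((p1, _), (q1, _)) then
    let: (u, v) := (vertex_at p1, vertex_at q1) in
    replace_blocks (vpart P) u v (created (vertices P) new u v)
  else vpart P.

Definition breplace (new : {set {set pt P}}) : {set {set {set pt P}}} :=
  if (edges P).[? e] is Some ((p1, p2), _) then
    let: (a, b) := (bdry_at p1, bdry_at p2) in
    replace_blocks (bpart P) a b (created (bdries P) new a b)
  else bpart P.

Definition del : packaged L :=
  @Packaged L (adel e P) (vpart P) (breplace (bdries (adel e P))).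

Definition merge_del : packaged L :=
  @Packaged L (adel e P) vjoin (breplace (bdries (adel e P))).

Definition contr : packaged L :=
  @Packaged L (acontr e P) (vreplace (vertices (acontr e P))) (bpart P).

Definition merge_contr : packaged L :=
  @Packaged L (acontr e P) (vreplace (vertices (acontr e P))) bjoin.

Definition penrose : packaged L :=
  @Packaged L (apenrose e P) (vreplace (vertices (apenrose e P)))
    (breplace (bdries (apenrose e P))).

(* In the order of the components of a weight (a, b, c, x, y).                *)
Definition minor (i : 'I_5) : packaged L :=
  match val i with
  | 0 => del
  | 1 => contr
  | 2 => penrose
  | 3 => merge_del
  | _ => merge_contr
  end%N.

End PackagedOps.

Section TwoSum.
Variables (L : choiceType).

Definition lift_set (T T' : finType) (h : T -> T') (X : {set T}) : {set T'} :=
  [set h x | x in X].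

Definition map_edges (T T' : Type) (h : T -> T') (m : {fmap L -> edge T}) :
    {fmap L -> edge T'} :=
  [fmap l : domf m => map_edge h (m l)].

(* A coupling of f and e is a permutation phi of bool: the i-th arrow of f is *)
(* sent to the (phi i)-th arrow of e.                                         *)
Definition asum2 (A A' : arrow_pres L) (f e : L) (phi : {perm bool}) :
    arrow_pres L :=
  let T := (pt A + pt A')%type in
  let seg0 (z : T) : T :=
    match z with inl x => inl (seg x) | inr y => inr (seg y) end in
  @ArrowPres L T
    (fun z : T => match z with inl x => inl (gap x) | inr y => inr (gap y) end)
    (match (edges A).[? f], (edges A').[? e] with
     | Some x, Some y =>
         let: ((p1, p2), (p3, p4)) := x in
         let: (q1, q2) := nth_arrow y (phi false) in
         let: (q3, q4) := nth_arrow y (phi true) in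
         relink (relink (relink (relink seg0
           (inl p1) (inr q1)) (inl p2) (inr q2))
           (inl p3) (inr q3)) (inl p4) (inr q4)
     | _, _ => seg0
     end)
    (catf (map_edges inl (edges A).[~ f]) (map_edges inr (edges A').[~ e])).

(* PP is the union of the partitions of the two summands. The two new blocks  *)
(* are fused when they come from overlapping unions of blocks, which happens  *)
(* exactly when [u] = [v] or [u'] = [v'].                                     *)
Definition sum_blocks (T : finType) (PP : {set {set T}}) (u v u' v' : T)
    (C D : {set T}) : {set {set T}} :=
  let X := pblock PP u :|: pblock PP u' in
  let Y := pblock PP v :|: pblock PP v' in
  (PP :\: [set pblock PP u; pblock PP v; pblock PP u'; pblock PP v'])
  :|: (if [disjoint X & Y]
       then [set (X :\: [set u; u']) :|: C; (Y :\: [set v; v']) :|: D]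
       else [set ((X :|: Y) :\: [set u; v; u'; v']) :|: (C :|: D)]).

Definition sum2 (P H : packaged L) (f e : L) (phi : {perm bool}) : packaged L :=
  let S := asum2 P H f e phi in
  let injl : pt P -> pt S := inl in
  let injr : pt H -> pt S := inr in
  let VV := [set lift_set (lift_set injl) B | B in vpart P]
            :|: [set lift_set (lift_set injr) B | B in vpart H] in
  let BB := [set lift_set (lift_set injl) B | B in bpart P]
            :|: [set lift_set (lift_set injr) B | B in bpart H] in
  match (edges P).[? f], (edges H).[? e] with
  | Some x, Some y =>
      let: ((p1, p2), (p3, p4)) := x in
      let: (q1, q2) := nth_arrow y (phi false) in
      let: (q3, q4) := nth_arrow y (phi true) in
      @Packaged L S
        (sum_blocks VV
           (lift_set injl (vertex_at p1)) (lift_set injl (vertex_at p3))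
           (lift_set injr (vertex_at q1)) (lift_set injr (vertex_at q3))
           [set vertex_at (injl p1); vertex_at (injl p2)]
           [set vertex_at (injl p3); vertex_at (injl p4)])
        (sum_blocks BB
           (lift_set injl (bdry_at p1)) (lift_set injl (bdry_at p2))
           (lift_set injr (bdry_at q1)) (lift_set injr (bdry_at q2))
           [set bdry_at (injl p1); bdry_at (injl p4)]
           [set bdry_at (injl p2); bdry_at (injl p3)])
  | _, _ => @Packaged L S VV BB
  end.

(* ((P +_(phi 0) H 0) +_(phi 1) H 1) ... +_(phi (k-1)) H (k-1)                *)
Definition iter_sum2 (P : packaged L) (k : nat) (H : 'I_k -> packaged L)
    (f e : 'I_k -> L) (phi : 'I_k -> {perm bool}) : packaged L :=
  foldl (fun S i => sum2 S (H i) (f i) (e i) (phi i)) P (enum 'I_k).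

End TwoSum.

Section Polynomial.
Variables (L : choiceType) (R : comNzRingType).
Variables (w : L -> 'cV[R]_5) (alpha beta gamma : R).

Definition Q_edgeless (P : packaged L) : R :=
  alpha ^+ #|vertices P| * beta ^+ #|vpart P| * gamma ^+ #|bpart P|.

Fixpoint Q_along (s : seq L) (P : packaged L) : R :=
  if s is e :: s' then \sum_(i < 5) w e i 0 * Q_along s' (minor e P i)
  else Q_edgeless P.

(* The edges are processed in some order; Q_edge and Q_unique below show that *)
(* this is the unique map given by the recursion at an arbitrary edge.        *)
Definition Q (P : packaged L) : R := Q_along (enum_fset E(P)) P.

Definition Q_minors (e : L) (P : packaged L) : 'cV[R]_5 :=
  \col_i Q (minor e P i).

End Polynomial.

Section PartitionFacts.
Variable T : finType.
Implicit Types (PP : {set {set T}}) (C D : {set T}) (x y : T).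

Lemma partition_drop2 PP D x y : partition PP D -> x \in D -> y \in D ->
  partition (PP :\: [set pblock PP x; pblock PP y])
            (D :\: (pblock PP x :|: pblock PP y)).
Proof.
move=> pD xD yD; have covP := cover_partition pD.
have bx : pblock PP x \in PP by rewrite pblock_mem ?covP.
have by_ : pblock PP y \in PP by rewrite pblock_mem ?covP.
have p1 := partitionD1 pD bx.
have [eqb|neb] := eqVneq (pblock PP y) (pblock PP x).
  by rewrite eqb !setUid.
have := @partitionD1 _ _ _ (pblock PP y) p1.
by rewrite !setDDl; apply; rewrite !inE neb.
Qed.

Lemma join_blocksE PP D x y : partition PP D -> x \in D -> y \in D ->
  join_blocks PP x y = replace_blocks PP x y (created D D x y).
Proof.
move=> pD xD yD; have covP := cover_partition pD.
rewrite /join_blocks /replace_blocks /created; congr (_ :|: [set _]).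
apply/setP=> z; rewrite !inE.
have [->|_] := eqVneq z x; first by rewrite mem_pblock covP xD.
have [->|_] := eqVneq z y; first by rewrite [in RHS]mem_pblock mem_pblock covP yD !orbT.
by rewrite /=; case: (z \in D); rewrite ?orbF.
Qed.

End PartitionFacts.

Section Classes.
Variable T : finType.
Implicit Types (r : rel T) (PP : {set {set {set T}}}) (x y p q : T).

Definition cls r x : {set T} := [set y | connect r x y].
Definition circ r : {set {set T}} := [set cls r x | x : T].
Definition Rof r PP : rel T := fun x y => cls r y \in pblock PP (cls r x).
Definition Rjoin (R : rel T) p q : rel T := fun x y =>
  R x y || (R p x || R q x) && (R p y || R q y).

Lemma mem_cls r x : x \in cls r x. Proof. by rewrite inE connect0. Qed.

Lemma cls_circ r x : cls r x \in circ r. Proof. exact: imset_f. Qed.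

Lemma cls_eq r x y : connect_sym r -> y \in cls r x -> cls r y = cls r x.
Proof.
by move=> cs; rewrite inE => xy; apply/setP=> z; rewrite !inE (same_connect cs xy).
Qed.

Lemma circ_eq r X x : connect_sym r -> X \in circ r -> x \in X -> X = cls r x.
Proof. by move=> cs /imsetP[y _ ->] /(cls_eq cs). Qed.

Lemma Rof_inj r PP PP' : partition PP (circ r) -> partition PP' (circ r) ->
  Rof r PP =2 Rof r PP' -> PP = PP'.
Proof.
move=> pP pP' eqR.
rewrite -(equivalence_partition_pblock pP) -(equivalence_partition_pblock pP').
apply: eq_in_imset => _ /imsetP[x _ ->]; apply/setP=> Y; rewrite !inE.
by have [/imsetP[y _ ->]|//] := boolP (Y \in circ r); apply: eqR.
Qed.

Section RofTheory.
Variables (r : rel T) (PP : {set {set {set T}}}).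
Hypothesis pP : partition PP (circ r).

Lemma Rof_refl x : Rof r PP x x.
Proof. by rewrite /Rof mem_pblock (cover_partition pP) cls_circ. Qed.

Lemma RofE x y : Rof r PP x y = (pblock PP (cls r x) == pblock PP (cls r y)).
Proof.
by rewrite eq_pblock ?(partition_trivIset pP) // (cover_partition pP) cls_circ.
Qed.

Lemma Rof_sym x y : Rof r PP x y = Rof r PP y x.
Proof. by rewrite !RofE eq_sym. Qed.

Lemma Rof_trans x y z : Rof r PP x y -> Rof r PP y z -> Rof r PP x z.
Proof. by rewrite !RofE => /eqP-> /eqP->. Qed.

End RofTheory.

Lemma replaceP r r' PP p q :
    connect_sym r -> connect_sym r' -> partition PP (circ r) ->
    (forall x, x \notin cls r p -> x \notin cls r q -> cls r' x = cls r x) ->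
    let PP' := replace_blocks PP (cls r p) (cls r q)
                 (created (circ r) (circ r') (cls r p) (cls r q)) in
  partition PP' (circ r') /\ Rof r' PP' =2 Rjoin (Rof r PP) p q.
Proof.
move=> cs cs' pP loc; set u := cls r p; set v := cls r q.
set C := created _ _ u v => PP'.
have covP := cover_partition pP; have trP := partition_trivIset pP.
have ucr : u \in circ r := cls_circ r p.
have vcr : v \in circ r := cls_circ r q.
have inC x : (cls r' x \in C) = (x \in u) || (x \in v).
  rewrite /C /created in_setD cls_circ andbT in_setD in_setU !in_set1.
  have [xu|xu] := boolP (x \in u); last have [xv|xv] := boolP (x \in v).
  - rewrite orTb; apply/negP=> /andP[neq cr].
    by move: neq; rewrite (circ_eq cs cr (mem_cls _ _)) (cls_eq cs xu) eqxx.
  - rewrite orFb; apply/negP=> /andP[neq cr].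
    by move: neq; rewrite (circ_eq cs cr (mem_cls _ _)) (cls_eq cs xv) eqxx orbT.
  rewrite (loc _ xu xv) cls_circ andbT negbK; apply/negP=> /orP[]/eqP eqx.
    by rewrite -eqx mem_cls in xu.
  by rewrite -eqx mem_cls in xv.
pose Z := ((pblock PP u :|: pblock PP v) :\: [set u; v]) :|: C.
have inZ x : (cls r' x \in Z) = Rof r PP p x || Rof r PP q x.
  rewrite /Z in_setU inC in_setD !in_setU !in_set1 /Rof.
  have [xu|xu] := boolP (x \in u).
    by rewrite orbT (cls_eq cs xu) -/u -/v [in RHS]mem_pblock covP ucr.
  have [xv|xv] := boolP (x \in v).
    have vv : v \in pblock PP v by rewrite mem_pblock covP vcr.
    by rewrite !orbT (cls_eq cs xv) -/v vv orbT.
  rewrite orbF (loc _ xu xv).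
  have nu : cls r x != u by apply: contra xu => /eqP <-; exact: mem_cls.
  have nv : cls r x != v by apply: contra xv => /eqP <-; exact: mem_cls.
  by rewrite (negbTE nu) (negbTE nv) ?orbF.
pose W := pblock PP u :|: pblock PP v.
have pD := partition_drop2 pP ucr vcr.
have nZ : Z != set0 by apply/set0Pn; exists (cls r' p); rewrite inZ Rof_refl.
have inD x : (cls r' x \in circ r :\: W) = ~~ (Rof r PP p x || Rof r PP q x).
  rewrite in_setD.
  have [xu|xu] := boolP (x \in u); last have [xv|xv] := boolP (x \in v).
  - have -> : Rof r PP p x.
      by rewrite /Rof -/u (cls_eq cs xu) mem_pblock covP.
    apply/negP=> /andP[+ cr]; rewrite (circ_eq cs cr (mem_cls _ _)).
    by rewrite (cls_eq cs xu) inE mem_pblock covP ucr.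
  - have -> : Rof r PP q x.
      by rewrite /Rof -/v (cls_eq cs xv) mem_pblock covP.
    rewrite orbT; apply/negP=> /andP[+ cr]; rewrite (circ_eq cs cr (mem_cls _ _)).
    by rewrite (cls_eq cs xv) inE [X in _ || X]mem_pblock covP vcr orbT.
  by rewrite (loc _ xu xv) cls_circ andbT inE.
have DE : Z :|: (circ r :\: W) = circ r'.
  apply/setP=> X; apply/setUP/idP => [|/imsetP[x _ ->]]; last first.
    by rewrite inZ inD; case: (_ || _); [left|right].
  have outW Y : Y \in circ r -> Y != u -> Y != v -> Y \in circ r'.
    move=> /imsetP[y _ ->] nu nv; rewrite -loc ?cls_circ //.
      by apply: contra nu => /(cls_eq cs)/eqP.
    by apply: contra nv => /(cls_eq cs)/eqP.
  have subcr B Y : B \in PP -> Y \in B -> Y \in circ r.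
    by move=> BP; apply/subsetP/(partitionS pP).
  case; last first.
    rewrite !inE negb_or => /andP[/andP[Xu Xv] Xcr]; apply: outW => //.
      by apply: contra Xu => /eqP->; rewrite mem_pblock covP.
    by apply: contra Xv => /eqP->; rewrite mem_pblock covP.
  rewrite /Z in_setU => /orP[|]; last by rewrite !inE => /andP[].
  rewrite in_setD !in_setU !in_set1 negb_or => /andP[/andP[nu nv] XW].
  by apply: outW => //; case/orP: XW => /subcr; apply; rewrite pblock_mem ?covP.
have dZ : [disjoint Z & circ r :\: W].
  rewrite -setI_eq0; apply/eqP/setP=> X; rewrite in_set0; apply/negP.
  move=> /setIP[XZ XD]; have : X \in circ r' by rewrite -DE in_setU XZ.
  by case/imsetP=> x _ eX; move: XZ XD; rewrite eX inZ inD => ->.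
have PE : PP' = Z |: (PP :\: [set pblock PP u; pblock PP v]).
  by rewrite /PP' /replace_blocks setUC.
have pP' : partition PP' (circ r') by rewrite PE -DE; exact: partitionU1.
split=> // x y; have trP' := partition_trivIset pP'; rewrite {1}/Rof /Rjoin.
have ZP : Z \in PP' by rewrite PE !inE eqxx.
have [xZ|xZ] := boolP (Rof r PP p x || Rof r PP q x).
  have -> : pblock PP' (cls r' x) = Z by apply: def_pblock; rewrite ?inZ.
  rewrite inZ; apply/idP/idP => [->|/orP[xy|//]]; first by rewrite orbT.
  by case/orP: xZ => /Rof_trans/(_ xy) -> //; rewrite ?orbT.
rewrite orbF; move: (xZ); rewrite -inD in_setD => /andP[xW xcr].
have ex : cls r' x = cls r x by apply: circ_eq xcr (mem_cls _ _).
have xP : pblock PP (cls r x) \in PP by rewrite pblock_mem ?covP ?cls_circ.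
have BP : pblock PP (cls r x) \in PP'.
  rewrite PE in_setU1 in_setD xP andbT; apply/orP; right.
  by rewrite in_set2 ![pblock PP (cls r x) == _]eq_sym -!RofE.
have -> : pblock PP' (cls r' x) = pblock PP (cls r x).
  by apply: def_pblock => //; rewrite ex mem_pblock covP cls_circ.
have [yZ|yZ] := boolP (Rof r PP p y || Rof r PP q y).
  have -> : Rof r PP x y = false.
    apply/negP; rewrite Rof_sym // => yx; case/negP: xZ.
    by case/orP: yZ => /Rof_trans/(_ yx) -> //; rewrite ?orbT.
  apply/negP=> yB; case/negP: xZ; rewrite -inZ.
  have <- : pblock PP (cls r x) = Z.
    by rewrite -(def_pblock trP' BP yB) (def_pblock trP' ZP) // inZ.
  by rewrite ex mem_pblock covP cls_circ.
move: (yZ); rewrite -inD in_setD => /andP[_ ycr].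
by rewrite (circ_eq cs ycr (mem_cls _ _)).
Qed.

Lemma Rjoin_eq R R' p q : R =2 R' -> Rjoin R p q =2 Rjoin R' p q.
Proof. by move=> e x y; rewrite /Rjoin !e. Qed.

Lemma cls_local r r' p q : connect_sym r ->
    (forall x, x \notin cls r p -> x \notin cls r q -> r' x =1 r x) ->
  forall x, x \notin cls r p -> x \notin cls r q -> cls r' x = cls r x.
Proof.
move=> cs loc; pose out := [pred x | (x \notin cls r p) && (x \notin cls r q)].
have outS x y : out x -> r x y -> out y.
  move=> /andP[xp xq] /connect1 xy; rewrite /out /=.
  by rewrite !inE -!(same_connect_r cs xy); move: xp xq; rewrite !inE => -> ->.
have sub s s' : {in out, forall x, s x =1 s' x} -> {in out, forall x, s x =1 r x} ->
    forall x y, out x -> connect s x y -> connect s' x y.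
  move=> ss' sr x y ox /connectP[c pc ->] {y}.
  elim: c x ox pc => //= z c IH x ox /andP[xz pc].
  apply: connect_trans (IH z _ pc); first by apply: connect1; rewrite -ss'.
  by apply: (outS x) => //; rewrite -sr.
have loc' : {in out, forall x, r' x =1 r x}.
  by move=> x /andP[xp xq]; apply: loc.
have loc2 : {in out, forall x, r x =1 r' x} by move=> x ox y; rewrite loc'.
move=> x xp xq; have ox : out x by rewrite /out /= xp.
by apply/setP=> y; rewrite !inE; apply/idP/idP; apply: sub.
Qed.

End Classes.

Section RjoinTheory.
Variable T : finType.
Definition equivb (R : rel T) : Prop :=
  [/\ reflexive R, symmetric R & transitive R].
Implicit Types (R S : rel T) (p q : T).

Lemma Rjoin_equiv R p q : equivb R -> equivb (Rjoin R p q).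
Proof.
move=> [rR sR tR]; rewrite /Rjoin; split.
- by move=> x; rewrite rR.
- by move=> x y; rewrite sR andbC.
have cl x y : R x y -> R p x || R q x -> R p y || R q y.
  by move=> xy /orP[] h; rewrite (tR _ _ _ h xy) ?orbT.
move=> y x z /orP[xy|/andP[X Y]] /orP[yz|/andP[Y' Z]].
- by rewrite (tR _ _ _ xy yz).
- by rewrite Z (cl y x) ?orbT // sR.
- by rewrite X (cl y z) ?orbT.
- by rewrite X Z orbT.
Qed.

Lemma Rjoin_min R S p q : equivb S -> subrel R S -> S p q ->
  subrel (Rjoin R p q) S.
Proof.
move=> [rS sS tS] RS pq x y /orP[/RS//|/andP[X Y]].
have Spx z : R p z || R q z -> S p z.
  by case/orP=> /RS // qz; apply: tS pq qz.
by apply: (tS p); [rewrite sS; apply: Spx | apply: Spx].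
Qed.

Lemma sub_Rjoin R p q : subrel R (Rjoin R p q).
Proof. by move=> x y h; rewrite /Rjoin h. Qed.

Lemma Rjoin_pq R p q : equivb R -> Rjoin R p q p q.
Proof. by move=> [rR _ _]; rewrite /Rjoin !rR !orbT. Qed.

Definition Ropt (b : bool) R p q := if b then R else Rjoin R p q.

Lemma Ropt_eq b R S p q : R =2 S -> Ropt b R p q =2 Ropt b S p q.
Proof. by case: b => // e x y; rewrite /= /Rjoin !e. Qed.

Lemma Ropt_comm b c R p q p' q' : equivb R ->
  Ropt b (Ropt c R p q) p' q' =2 Ropt c (Ropt b R p' q') p q.
Proof.
move=> eR; case: b c => [] [] //= x y.
suff sub a d a' d' : subrel (Rjoin (Rjoin R a d) a' d') (Rjoin (Rjoin R a' d') a d).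
  by apply/idP/idP; apply: sub.
have e1 := Rjoin_equiv a' d' eR; have e2 := Rjoin_equiv a d e1.
apply: Rjoin_min => //; last exact/sub_Rjoin/Rjoin_pq.
apply: Rjoin_min => //; last exact: Rjoin_pq.
by move=> ? ? h; do 2!apply: sub_Rjoin.
Qed.

End RjoinTheory.

Lemma Rof_equiv (T : finType) (r : rel T) PP :
  partition PP (circ r) -> equivb (Rof r PP).
Proof.
by move=> pP; split; [exact: Rof_refl | exact: Rof_sym |
  move=> y x z; exact: Rof_trans].
Qed.

Section Marc.
Variable T : eqType.
Implicit Types (x y : edge T) (a : T -> T) (z : T).

Definition marc (k : nat) x a : T -> T :=
  match k with
  | 0 => a
  | 1 => relink (relink a x.1.1 x.2.2) x.1.2 x.2.1
  | _ => relink (relink a x.1.1 x.2.1) x.1.2 x.2.2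
  end%N.

Lemma marc_out k x a z : z \notin ends x -> marc k x a z = a z.
Proof.
rewrite /ends !inE !negb_or => /and4P[h1 h2 h3 h4].
by case: k => [|[|k]] //=; rewrite /relink (negbTE h1) (negbTE h2) (negbTE h3)
  (negbTE h4).
Qed.

Lemma marc_dep k x a a' z :
  (0 < k)%N -> z \in ends x -> marc k x a z = marc k x a' z.
Proof.
case: k => // k _; rewrite /ends !inE.
by case: k => [|k] /or4P[]/eqP-> /=; rewrite /relink !eqxx;
   do ?[case: ifP => // _].
Qed.

Lemma marc_swap k l x y a :
  {in ends x, forall z, z \notin ends y} ->
  marc k x (marc l y a) = marc l y (marc k x a).
Proof.
move=> dis; apply: functional_extensionality => z.
case: k l => [|k] [|l] //.
have [zx|zx] := boolP (z \in ends x).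
  by rewrite (marc_out _ _ (dis _ zx)); apply: marc_dep.
rewrite (marc_out _ _ zx); have [zy|zy] := boolP (z \in ends y).
  exact: marc_dep.
by rewrite !marc_out.
Qed.

Lemma marc_wf k x a : uniq (ends x) ->
    (forall i, a (nth_arrow x i).1 = (nth_arrow x i).2) ->
    involutive a -> (forall z, a z != z) ->
  involutive (marc k x a) /\ (forall z, marc k x a z != z).
Proof.
case: x => [[p1 p2] [q1 q2]]; rewrite /ends /= !inE !negb_or.
move=> /and4P[/and3P[n1 n2 n3] /andP[n4 n5] n6 _] ha aK an.
have /= a1 := ha false; have /= a2 := ha true.
have a1' : a p2 = p1 by rewrite -a1 aK.
have a2' : a q2 = q1 by rewrite -a2 aK.
have out z : z \notin [:: p1; p2; q1; q2] -> a z \notin [:: p1; p2; q1; q2].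
  apply: contra; rewrite !inE => /or4P[]/eqP h; rewrite -(aK z) h.
  - by rewrite a1 eqxx orbT.
  - by rewrite a1' eqxx.
  - by rewrite a2 eqxx !orbT.
  - by rewrite a2' eqxx !orbT.
have nE := (negbTE n1, negbTE n2, negbTE n3, negbTE n4, negbTE n5, negbTE n6).
have ns (S : eqType) (s t : S) : s != t -> (t == s) = false by rewrite eq_sym => /negbTE.
have nE' := (ns _ _ _ n1, ns _ _ _ n2, ns _ _ _ n3, ns _ _ _ n4, ns _ _ _ n5, ns _ _ _ n6).
suff H z : marc k (p1, p2, (q1, q2)) a (marc k (p1, p2, (q1, q2)) a z) = z
        /\ marc k (p1, p2, (q1, q2)) a z != z.
  by split=> z; case: (H z).
have [zx|zx] := boolP (z \in [:: p1; p2; q1; q2]); last first.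
  have mo t : t \notin [:: p1; p2; q1; q2] ->
      marc k (p1, p2, (q1, q2)) a t = a t by move=> h; apply: marc_out.
  by rewrite (mo _ zx) (mo _ (out _ zx)) aK.
case: k => [|[|k]]; first by rewrite /= aK.
  by move: zx; rewrite /= /relink !inE => /or4P[]/eqP->; do 6?[rewrite ?eqxx ?nE ?nE' /=].
by move: zx; rewrite /= /relink !inE => /or4P[]/eqP->; do 6?[rewrite ?eqxx ?nE ?nE' /=].
Qed.

End Marc.

Section NewPres.
Variable L : choiceType.
Implicit Types (A : arrow_pres L) (P : packaged L).

Section Wf.
Variables (A : arrow_pres L) (wA : arrow_pres_wf A).

Lemma fnd_edge l x : (edges A).[? l]%fmap = Some x ->
  exists2 e : E(A), l = val e & edges A e = x.
Proof.
case: fndP => // kf [<-]; exists [` kf]%fset => //.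
Qed.

Lemma wf_arc l x i : (edges A).[? l]%fmap = Some x ->
  seg (nth_arrow x i).1 = (nth_arrow x i).2.
Proof. by case/fnd_edge => e _ <-; exact: arrow_seg. Qed.

Lemma wf_uniq l x : (edges A).[? l]%fmap = Some x -> uniq (ends x).
Proof. by case/fnd_edge => e _ <-; exact: ends_uniq. Qed.

Lemma wf_disj l l' x x' z : (edges A).[? l]%fmap = Some x ->
  (edges A).[? l']%fmap = Some x' -> z \in ends x -> z \in ends x' -> l = l'.
Proof.
case/fnd_edge => e -> <-; case/fnd_edge => e' -> <- h h'.
by rewrite (ends_disj wA h h').
Qed.

Definition free_pt (z : pt A) :=
  forall l x, (edges A).[? l]%fmap = Some x -> z \notin ends x.

Lemma freeVedge z : free_pt z \/
  exists l x, (edges A).[? l]%fmap = Some x /\ z \in ends x.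
Proof.
have [/existsP[e ze]|ne] := boolP [exists e : E(A), z \in ends (edges A e)].
  by right; exists (val e), (edges A e); rewrite Some_fnd.
left=> l x /fnd_edge[e _ <-]; apply: contra ne => h.
by apply/existsP; exists e.
Qed.

Lemma brel_free z y : free_pt z -> brel z y = (y == gap z) || (y == seg z).
Proof.
move=> fz; rewrite /brel ifF //; apply/existsP=> -[e].
by apply/negP; apply: (fz (val e)); rewrite Some_fnd.
Qed.

Lemma bcurves_ends (T : eqType) (x : edge T) z y :
  (z, y) \in bcurves x -> z \in ends x.
Proof.
case: x => [[p1 p2] [q1 q2]]; rewrite /ends !inE !xpair_eqE /=.
by case/or4P=> /andP[/eqP-> _]; rewrite eqxx ?orbT.
Qed.

Lemma bcurves_sym (T : eqType) (x : edge T) z y :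
  ((z, y) \in bcurves x) = ((y, z) \in bcurves x).
Proof.
case: x => [[p1 p2] [q1 q2]]; rewrite !inE !xpair_eqE /=.
do 8![case: (_ == _) => //=].
Qed.

Lemma brel_edge l x z y : (edges A).[? l]%fmap = Some x -> z \in ends x ->
  brel z y = (y == gap z) || ((z, y) \in bcurves x).
Proof.
move=> lx zx; have [e le ex] := fnd_edge lx; rewrite /brel ifT; last first.
  by apply/existsP; exists e; rewrite ex.
congr (_ || _); apply/existsP/idP => [[e' h]|h]; last by exists e; rewrite ex.
have e'e : e' = e by apply: (ends_disj wA) (bcurves_ends h) _; rewrite ex.
by move: h; rewrite e'e ex.
Qed.

Lemma ends_arc l x z : (edges A).[? l]%fmap = Some x -> z \in ends x ->
  seg z \in ends x.
Proof.
move=> lx; have /= a1 := wf_arc false lx; have /= a2 := wf_arc true lx.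
rewrite /ends !inE => /or4P[]/eqP->.
- by rewrite a1 eqxx orbT.
- by rewrite -a1 (segK wA) eqxx.
- by rewrite a2 eqxx !orbT.
- by rewrite -a2 (segK wA) eqxx !orbT.
Qed.

Lemma vrel_csym : connect_sym (@vrel L A).
Proof.
apply: sym_connect_sym => z y; rewrite /vrel.
have i h : involutive h -> (y == h z) = (z == h y).
  by move=> hK; apply/eqP/eqP=> ->; rewrite hK.
by rewrite (i _ (gapK wA)) (i _ (segK wA)).
Qed.

Lemma brel_csym : connect_sym (@brel L A).
Proof.
apply: sym_connect_sym => z y.
suff sub z' y' : @brel L A z' y' -> @brel L A y' z' by apply/idP/idP; apply: sub.
have [fz|[l [x [lx zx]]]] := freeVedge z'.
  rewrite brel_free // => /orP[/eqP->|/eqP->].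
    by rewrite /brel (gapK wA) eqxx.
  rewrite brel_free ?(segK wA) ?eqxx ?orbT // => l x lx.
  apply/negP=> /(ends_arc lx); rewrite (segK wA); exact/negP/(fz l).
rewrite (brel_edge _ lx) // => /orP[/eqP->|]; first by rewrite /brel (gapK wA) eqxx.
rewrite bcurves_sym => h; rewrite (brel_edge _ lx) ?h ?orbT //.
exact: bcurves_ends h.
Qed.

End Wf.

Definition newp k (e : L) A (x : edge (pt A)) : arrow_pres L :=
  ArrowPres (@gap L A) (marc k x (@seg L A)) (edges A).[~ e]%fmap.

Section New.
Variables (A : arrow_pres L) (wA : arrow_pres_wf A).
Variables (e : L) (x : edge (pt A)) (k : nat).
Hypothesis ex : (edges A).[? e]%fmap = Some x.
Let A' := newp k e x.

Lemma fnd_new l y : (edges A').[? l]%fmap = Some y ->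
  l != e /\ (edges A).[? l]%fmap = Some y.
Proof. by rewrite /A' /= fnd_rem1; case: ifP. Qed.

Lemma new_disj l y z : (edges A').[? l]%fmap = Some y ->
  z \in ends y -> z \notin ends x.
Proof.
case/fnd_new => le ly zy; apply/negP=> zx.
by move: le; rewrite (wf_disj wA ly ex zy zx) eqxx.
Qed.

Lemma val_fnd (l : E(A')) : (edges A').[? val l]%fmap = Some (edges A' l).
Proof. by rewrite Some_fnd. Qed.

Lemma newp_wf : arrow_pres_wf A'.
Proof.
have [aK an] :=
  marc_wf k (wf_uniq wA ex) (fun i => wf_arc wA i ex) (segK wA) (seg_neq wA).
split.
- exact: gapK wA.
- exact: gap_neq wA.
- exact: aK.
- exact: an.
- move=> l i; have ly := val_fnd l; have [_ ly'] := fnd_new ly.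
  move: (edges A' l) ly ly' => y ly ly'.
  have iy : (nth_arrow y i).1 \in ends y.
    by case: (i); rewrite /ends !inE eqxx ?orbT.
  by apply: etrans (wf_arc wA i ly'); exact: marc_out (new_disj ly iy).
- by move=> l; have [_ /(wf_uniq wA)] := fnd_new (val_fnd l).
- move=> l l' z h h'; apply: val_inj.
  have [_ ly] := fnd_new (val_fnd l); have [_ ly'] := fnd_new (val_fnd l').
  exact: (wf_disj wA) ly ly' h h'.
Qed.

Lemma new_vlocal z : z \notin cls (@vrel L A) x.1.1 ->
  z \notin cls (@vrel L A) x.2.1 -> @vrel L A' z =1 @vrel L A z.
Proof.
move=> z1 z2 y; rewrite /vrel /= marc_out //.
have /= a1 := wf_arc wA false ex; have /= a2 := wf_arc wA true ex.
rewrite /ends !inE; apply/or4P=> -[]/eqP zE; rewrite zE in z1 z2.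
- by rewrite mem_cls in z1.
- by case/negP: z1; rewrite inE connect1 // /vrel a1 eqxx orbT.
- by rewrite mem_cls in z2.
- by case/negP: z2; rewrite inE connect1 // /vrel a2 eqxx orbT.
Qed.

Lemma new_free z : z \notin ends x -> @brel L A' z =1 @brel L A z.
Proof.
move=> zx y; have [fz|[l [x' [lx zx']]]] := @freeVedge A z.
  rewrite (@brel_free A z y fz) (@brel_free A' z y) /= ?marc_out //.
  by move=> l x' /fnd_new[_]; exact: fz.
have le : l != e.
  by apply: contra zx => /eqP le; move: lx; rewrite le ex => -[->].
rewrite (brel_edge wA _ lx) // (@brel_edge _ newp_wf l x') //=.
by rewrite fnd_rem1 le.
Qed.

Lemma new_blocal z : z \notin cls (@brel L A) x.1.1 ->
  z \notin cls (@brel L A) x.1.2 -> @brel L A' z =1 @brel L A z.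
Proof.
move=> z1 z2; apply: new_free; apply/negP=> zx.
have i1 : x.1.1 \in ends x by rewrite !inE eqxx.
have i2 : x.1.2 \in ends x by rewrite !inE eqxx orbT.
move: (zx); rewrite /ends !inE => /or4P[]/eqP zE; rewrite zE in z1 z2.
- by rewrite mem_cls in z1.
- by rewrite mem_cls in z2.
- case/negP: z2; rewrite inE connect1 // (brel_edge wA _ ex) //.
  by case: (x) => [[? ?] [? ?]]; rewrite !inE eqxx !orbT.
- case/negP: z1; rewrite inE connect1 // (brel_edge wA _ ex) //.
  by case: (x) => [[? ?] [? ?]]; rewrite !inE eqxx !orbT.
Qed.

Lemma new_bcontr : k = 1%N -> @brel L A' =2 @brel L A.
Proof.
move=> k1 z y; have [zx|/new_free->//] := boolP (z \in ends x).
rewrite (brel_edge wA _ ex zx) (@brel_free A') /=; last first.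
  by move=> l x' h; apply/negP=> /(new_disj h); rewrite zx.
congr (_ || _); rewrite k1 /=; move: (wf_uniq wA ex) zx.
case: (x) => [[p1 p2] [q1 q2]]; rewrite /ends /bcurves !inE !xpair_eqE /= !negb_or ?andbT.
move=> /and3P[/and3P[n1 n2 n3] /andP[n4 n5] n6].
have nE := (negbTE n1, negbTE n2, negbTE n3, negbTE n4, negbTE n5, negbTE n6).
have ns (S : eqType) (s t : S) : s != t -> (t == s) = false by rewrite eq_sym => /negbTE.
have nE' := (ns _ _ _ n1, ns _ _ _ n2, ns _ _ _ n3, ns _ _ _ n4, ns _ _ _ n5, ns _ _ _ n6).
rewrite /relink => /or4P[]/eqP->.
all: by rewrite ?eqxx ?nE ?nE' ?orbF.
Qed.

End New.
End NewPres.

Section Minors.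
Variable L : choiceType.
Implicit Types (A : arrow_pres L) (P : packaged L).

Definition kof (i : 'I_5) : nat :=
  match val i with 1 | 4 => 1 | 2 => 2 | _ => 0 end%N.

Definition RV P := Rof (@vrel L P) (vpart P).
Definition RB P := Rof (@brel L P) (bpart P).
Arguments RV : clear implicits.
Arguments RB : clear implicits.

Lemma circ_vertices A : vertices A = circ (@vrel L A). Proof. by []. Qed.
Lemma circ_bdries A : bdries A = circ (@brel L A). Proof. by []. Qed.

Lemma RV_equiv P : packaged_wf P -> equivb (RV P).
Proof. by case=> _ + _; apply: Rof_equiv. Qed.

Lemma RB_equiv P : packaged_wf P -> equivb (RB P).
Proof. by case=> _ _; apply: Rof_equiv. Qed.

Lemma eq_cls (T : finType) (r r' : rel T) x : r =2 r' -> cls r x = cls r' x.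
Proof. by move=> e; apply/setP=> y; rewrite !inE (eq_connect e). Qed.

Lemma Rof_eqr (T : finType) (r r' : rel T) PP : r =2 r' -> Rof r PP =2 Rof r' PP.
Proof. by move=> e x y; rewrite /Rof !(eq_cls _ e). Qed.

Lemma circ_eqr (T : finType) (r r' : rel T) : r =2 r' -> circ r = circ r'.
Proof. by move=> e; apply: eq_imset => x; apply: eq_cls. Qed.

Definition is_minor P (e : L) (x : edge (pt P)) (i : 'I_5) (Q : packaged L) :=
  exists V B, [/\ Q = @Packaged L (newp (kof i) e x) V B,
    packaged_wf (@Packaged L (newp (kof i) e x) V B),
    Rof (@vrel L (newp (kof i) e x)) V
      =2 Ropt (val i == 0)%N (RV P) x.1.1 x.2.1 &
    Rof (@brel L (newp (kof i) e x)) B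
      =2 Ropt (val i == 1)%N (RB P) x.1.1 x.1.2].

Lemma minorP P e x i : packaged_wf P -> (edges P).[? e]%fmap = Some x ->
  is_minor e x i (minor e P i).
Proof.
move=> [wA wV wB] ex.
have wN k := newp_wf wA k ex.
have csV := vrel_csym wA; have csB := brel_csym wA.
have vrep k : vreplace e (vertices (newp k e x)) =
  replace_blocks (vpart P) (vertex_at x.1.1) (vertex_at x.2.1)
    (created (vertices P) (vertices (newp k e x))
       (vertex_at x.1.1) (vertex_at x.2.1)).
  by rewrite /vreplace ex; case: (x) => [[? ?] [? ?]].
have brep k : breplace e (bdries (newp k e x)) =
  replace_blocks (bpart P) (bdry_at x.1.1) (bdry_at x.1.2)
    (created (bdries P) (bdries (newp k e x))
       (bdry_at x.1.1) (bdry_at x.1.2)).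
  by rewrite /breplace ex; case: (x) => [[? ?] [? ?]].
have HV k := replaceP csV (vrel_csym (wN k)) wV
  (cls_local csV (new_vlocal wA (k := k) ex)).
have HB k := replaceP csB (brel_csym (wN k)) wB
  (cls_local csB (new_blocal wA (k := k) ex)).
have vjn : vjoin e P = replace_blocks (vpart P) (vertex_at x.1.1)
    (vertex_at x.2.1) (created (vertices P) (vertices (newp 0 e x))
       (vertex_at x.1.1) (vertex_at x.2.1)).
  rewrite -(join_blocksE wV) ?cls_circ //.
  by rewrite /vjoin ex; case: (x) => [[? ?] [? ?]].
have eqB : @brel L (newp 1 e x) =2 @brel L P by move=> z y; apply: (new_bcontr wA ex (erefl 1%N)).
have HB1 := replaceP csB csB wB (fun x _ _ => erefl (cls (@brel L P) x)).
have bjn : bjoin e P = replace_blocks (bpart P) (bdry_at x.1.1)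
    (bdry_at x.1.2) (created (bdries P) (bdries P)
       (bdry_at x.1.1) (bdry_at x.1.2)).
  rewrite -(join_blocksE wB) ?cls_circ //.
  by rewrite /bjoin ex; case: (x) => [[? ?] [? ?]].
case: i => [[|[|[|[|[|//]]]]] i5]; rewrite /is_minor /minor /kof /=.
- have [pB rB] := HB 0%N.
  exists (vpart P), (breplace e (bdries (newp 0 e x))); split=> //.
  + by rewrite brep; split; [exact: wN | exact: wV | exact: pB].
  + by rewrite brep; exact: rB.
- have [pV rV] := HV 1%N.
  exists (vreplace e (vertices (newp 1 e x))), (bpart P); split.
  + by rewrite /contr /acontr ex; case: (x) => [[? ?] [? ?]].
  + rewrite vrep; split; [exact: wN | exact: pV |].
    by rewrite circ_bdries (circ_eqr eqB).
  + by rewrite vrep; exact: rV.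
  + exact: Rof_eqr eqB.
- have [pV rV] := HV 2%N; have [pB rB] := HB 2%N.
  exists (vreplace e (vertices (newp 2 e x))), (breplace e (bdries (newp 2 e x))).
  split.
  + by rewrite /penrose /apenrose ex; case: (x) => [[? ?] [? ?]].
  + by rewrite vrep brep; split; [exact: wN | exact: pV | exact: pB].
  + by rewrite vrep; exact: rV.
  + by rewrite brep; exact: rB.
- have [pV rV] := HV 0%N; have [pB rB] := HB 0%N.
  exists (vjoin e P), (breplace e (bdries (newp 0 e x))); split=> //.
  + by rewrite vjn brep; split; [exact: wN | exact: pV | exact: pB].
  + by rewrite vjn; exact: rV.
  + by rewrite brep; exact: rB.
- have [pV rV] := HV 1%N; have [pB rB] := HB1 x.1.1 x.1.2.
  exists (vreplace e (vertices (newp 1 e x))), (bjoin e P); split.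
  + by rewrite /merge_contr /acontr ex; case: (x) => [[? ?] [? ?]].
  + rewrite vrep bjn; split; [exact: wN | exact: pV |].
    by rewrite [X in partition _ X](_ : _ = circ (@brel L P)) //; exact: circ_eqr.
  + by rewrite vrep; exact: rV.
  + by rewrite bjn => s t; rewrite (Rof_eqr _ eqB) rB.
Qed.

Lemma packaged_ext (T : finType) (g a a' : T -> T) (m m' : {fmap L -> edge T})
    V B V' B' : a = a' -> m = m' ->
  let P := @Packaged L (ArrowPres g a m) V B in
  let P' := @Packaged L (ArrowPres g a' m') V' B' in
  packaged_wf P -> packaged_wf P' -> RV P =2 RV P' -> RB P =2 RB P' -> P = P'.
Proof.
move=> ea em; case: _ / ea; case: _ / em => /= -[_ /= v b] [_ /= v' b'] rV rB.
congr Packaged; [exact: Rof_inj v v' rV | exact: Rof_inj b b' rB].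
Qed.

Lemma minor_wf P e i : packaged_wf P -> e \in E(P) -> packaged_wf (minor e P i).
Proof.
move=> wP eP; have [V [B [-> //]]] := minorP i wP (in_fnd eP).
Qed.

Lemma minor_edges P e i : packaged_wf P -> e \in E(P) ->
  E(minor e P i) = (E(P) `\ e)%fset.
Proof.
move=> wP eP; have [V [B [-> _ _ _]]] := minorP i wP (in_fnd eP) => /=.
by apply/fsetP=> l; rewrite mem_remf1 !inE.
Qed.

Lemma minor_swap P e f i j : packaged_wf P -> e \in E(P) -> f \in E(P) ->
  e != f -> minor f (minor e P i) j = minor e (minor f P j) i.
Proof.
move=> wP eP fP nef; have ex := in_fnd eP; have fy := in_fnd fP.
move: ((edges P).[eP])%fmap ((edges P).[fP])%fmap ex fy => x y ex fy.
have wA := pres_wf wP.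
have [V1 [B1 [-> w1 v1 b1]]] := minorP i wP ex.
have [V2 [B2 [-> w2 v2 b2]]] := minorP j wP fy.
have fy1 : (edges (@newp L (kof i) e P x)).[? f]%fmap = Some y.
  by rewrite /= fnd_rem1 eq_sym nef.
have ex2 : (edges (@newp L (kof j) f P y)).[? e]%fmap = Some x.
  by rewrite /= fnd_rem1 nef.
have [V3 [B3 [-> w3 v3 b3]]] := minorP j w1 fy1.
have [V4 [B4 [-> w4 v4 b4]]] := minorP i w2 ex2.
apply: packaged_ext w3 w4 _ _.
- apply: marc_swap => z zy; apply/negP=> zx.
  by move: nef; rewrite (wf_disj wA ex fy zx zy) eqxx.
- by apply/fmapP=> l; rewrite !fnd_rem1; case: (l == e); case: (l == f).
- move=> s t; rewrite /RV v3 v4.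
  rewrite (Ropt_eq _ _ _ v1) (Ropt_eq _ _ _ v2).
  exact: Ropt_comm (RV_equiv wP) _ _.
- move=> s t; rewrite /RB b3 b4.
  rewrite (Ropt_eq _ _ _ b1) (Ropt_eq _ _ _ b2).
  exact: Ropt_comm (RB_equiv wP) _ _.
Qed.

Section Poly.
Variables (R : comNzRingType) (w : L -> 'cV[R]_5) (alpha beta gamma : R).
Notation Qal := (Q_along w alpha beta gamma).
Notation QQ := (Q w alpha beta gamma).

Lemma Q_along_swap e f s P : packaged_wf P -> e \in E(P) -> f \in E(P) ->
  e != f -> Qal [:: e, f & s] P = Qal [:: f, e & s] P.
Proof.
move=> wP eP fP nef /=.
under eq_bigr do rewrite mulr_sumr.
rewrite exchange_big /=; apply: eq_bigr => j _; rewrite mulr_sumr.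
by apply: eq_bigr => i _; rewrite (minor_swap _ _ wP) // mulrCA.
Qed.

Lemma Q_along_front s e P : packaged_wf P -> uniq s -> {subset s <= E(P)} ->
  e \in s -> Qal s P = Qal (e :: rem e s) P.
Proof.
elim: s P => // f s IH P wP /= /andP[fs us] sub; rewrite inE.
have [->|nef /= es] := eqVneq e f; first by rewrite /= ?eqxx.
have fP : f \in E(P) by apply: sub; rewrite inE eqxx.
have eP : e \in E(P) by apply: sub; rewrite inE es orbT.
have := Q_along_swap (rem e s) wP eP fP nef.
move=> /= ->.
apply: eq_bigr => i _; congr (_ * _); apply: IH => //.
  exact: minor_wf.
move=> l ls; rewrite minor_edges // !inE sub ?inE ?ls ?orbT ?andbT //.
by apply: contra fs => /eqP <-.
Qed.

Lemma Q_along_perm s s' P : packaged_wf P -> uniq s -> {subset s <= E(P)} ->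
  perm_eq s s' -> Qal s P = Qal s' P.
Proof.
elim: s s' P => [|e s IH] s' P wP us sub pe.
  by move: pe; rewrite perm_sym => /perm_nilP ->.
have es' : e \in s' by rewrite -(perm_mem pe) inE eqxx.
have us' : uniq s' by rewrite -(perm_uniq pe).
have sub' : {subset s' <= E(P)} by move=> l; rewrite -(perm_mem pe); apply: sub.
rewrite (Q_along_front wP us' sub' es') /=; apply: eq_bigr => i _.
have eP : e \in E(P) by apply: sub; rewrite inE eqxx.
move: us => /= /andP[nes us]; congr (_ * _); apply: IH => //.
- exact: minor_wf.
- move=> l ls; rewrite minor_edges // !inE sub ?inE ?ls ?orbT ?andbT //.
  by apply: contra nes => /eqP <-.
- by rewrite -(perm_cons e); apply: perm_trans pe _; exact: perm_to_rem.
Qed.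

Lemma Q_edge P e : packaged_wf P -> e \in E(P) ->
  QQ P = \sum_(i < 5) w e i 0 * QQ (minor e P i).
Proof.
move=> wP eP; rewrite /Q (@Q_along_perm _ (e :: enum_fset (E(P) `\ e)%fset)) //.
- by apply: eq_bigr => i _; rewrite minor_edges.
- apply: uniq_perm => //=; rewrite ?inE ?eqxx ?fset_uniq //.
  by move=> l; rewrite !inE; case: eqVneq => // ->.
Qed.

Lemma Q_base P : E(P) = fset0 -> QQ P = Q_edgeless alpha beta gamma P.
Proof. by rewrite /Q => ->. Qed.

Lemma Q_unique (F : packaged L -> R) :
    (forall P, packaged_wf P -> E(P) = fset0 ->
       F P = Q_edgeless alpha beta gamma P) ->
    (forall P e, packaged_wf P -> e \in E(P) ->
       F P = \sum_(i < 5) w e i 0 * F (minor e P i)) ->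
  forall P, packaged_wf P -> F P = QQ P.
Proof.
move=> F0 Fe P; move eN : #|` E(P)|%fset => n; elim: n P eN => [|n IH] P eN wP.
  by have E0 := cardfs0_eq eN; rewrite F0 // Q_base.
have /fset0Pn[e eP] : E(P) != fset0 by rewrite -cardfs_gt0 eN.
rewrite (Fe _ _ wP eP) (Q_edge wP eP); apply: eq_bigr => i _; congr (_ * _).
apply: IH; last exact: minor_wf.
by move: (cardfsD1 e E(P)); rewrite minor_edges // eP eN => -[].
Qed.

End Poly.
End Minors.

Definition coupling_mx (R : comNzRingType) (alpha beta gamma : R) : 'M[R]_5 :=
  (alpha * beta * gamma) *:
  \matrix_(i < 5, j < 5)
    nth 0 (nth [::]
      [:: [:: alpha * beta; 1; 1; alpha; 1];
          [:: 1; alpha * gamma; 1; 1; alpha];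
          [:: 1; 1; alpha; 1; 1];
          [:: alpha; 1; 1; alpha; 1];
          [:: 1; alpha; 1; 1; alpha]] i) j.

Definition sum_weights (L : choiceType) (R : comNzRingType) (k : nat)
    (f : 'I_k -> L) (phi : 'I_k -> 'cV[R]_5) (w : L -> 'cV[R]_5) :
    L -> 'cV[R]_5 :=
  fun l => if [pick i | f i == l] is Some i then phi i else w l.

(* Over a domain, and in particular for indeterminates alpha, beta and gamma, *)
(* the system has at most one solution (and exactly one over a field).        *)
Lemma coupling_mx_inj (R : idomainType) (alpha beta gamma : R) :
  alpha != 0 -> beta != 0 -> gamma != 0 ->
  alpha != 1 -> beta != 1 -> gamma != 1 -> alpha + 2 != 0 ->
  injective (fun z : 'cV[R]_5 => coupling_mx alpha beta gamma *m z).
Proof.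
move=> a0 b0 g0 a1 b1 g1 a2 z z' /eqP; rewrite -subr_eq0 -mulmxBr => /eqP.
move: (z - z') (subr0_eq (x := z) (y := z')) => d + Mz; apply.
have abg : alpha * beta * gamma != 0 by rewrite !mulf_neq0.
have Md i : \sum_j nth 0 (nth [::]
      [:: [:: alpha * beta; 1; 1; alpha; 1];
          [:: 1; alpha * gamma; 1; 1; alpha];
          [:: 1; 1; alpha; 1; 1];
          [:: alpha; 1; 1; alpha; 1];
          [:: 1; alpha; 1; 1; alpha]] (i : 'I_5)) (j : 'I_5) * d j 0 = 0.
  apply: (mulfI abg); rewrite mulr0 mulr_sumr.
  transitivity ((coupling_mx alpha beta gamma *m d) i 0).
    by rewrite !mxE; apply: eq_bigr => j _; rewrite !mxE mulrA.
  by rewrite Mz mxE.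
pose o k (k5 : (k < 5)%N) : 'I_5 := Ordinal k5.
have E0 := Md (o 0%N isT); have E1 := Md (o 1%N isT); have E2 := Md (o 2%N isT).
have E3 := Md (o 3%N isT); have E4 := Md (o 4%N isT).
rewrite !big_ord_recl big_ord0 /= !mul1r ?addr0 in E0 E1 E2 E3 E4.
set x0 := d ord0 0 in E0 E1 E2 E3 E4.
set x1 := d (lift ord0 ord0) 0 in E0 E1 E2 E3 E4.
set x2 := d (lift ord0 (lift ord0 ord0)) 0 in E0 E1 E2 E3 E4.
set x3 := d (lift ord0 (lift ord0 (lift ord0 ord0))) 0 in E0 E1 E2 E3 E4.
set x4 := d (lift ord0 (lift ord0 (lift ord0 (lift ord0 ord0)))) 0 in E0 E1 E2 E3 E4.
have z0 : x0 = 0.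
  apply: (mulfI (x := alpha * (beta - 1))); first by rewrite mulf_neq0 ?subr_eq0.
  by rewrite mulr0 -[RHS](subrr 0) -{1}E0 -E3; ring.
have z1 : x1 = 0.
  apply: (mulfI (x := alpha * (gamma - 1))); first by rewrite mulf_neq0 ?subr_eq0.
  by rewrite mulr0 -[RHS](subrr 0) -{1}E1 -E4; ring.
rewrite z0 z1 ?mulr0 ?add0r in E2 E3 E4.
have sm : x2 + x3 + x4 = 0.
  apply: (mulfI a2); rewrite mulr0 -[RHS](addr0 0) -[X in _ = _ + X](addr0 0).
  by rewrite -{1}E2 -{1}E3 -E4; ring.
have eqa y : alpha * y + (x2 + x3 + x4 - y) = 0 -> y = 0.
  move=> h; apply: (mulfI (x := alpha - 1)); first by rewrite subr_eq0.
  by rewrite mulr0 -h sm; ring.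
have z2 : x2 = 0 by apply: eqa; rewrite -[RHS]E2; ring.
have z3 : x3 = 0 by apply: eqa; rewrite -[RHS]E3; ring.
have z4 : x4 = 0 by apply: eqa; rewrite -[RHS]E4; ring.
apply/matrixP=> i j; rewrite ord1 mxE.
case: i => [[|[|[|[|[|//]]]]] i5].
- by rewrite -[RHS]z0; congr (d _ _); apply: val_inj.
- by rewrite -[RHS]z1; congr (d _ _); apply: val_inj.
- by rewrite -[RHS]z2; congr (d _ _); apply: val_inj.
- by rewrite -[RHS]z3; congr (d _ _); apply: val_inj.
- by rewrite -[RHS]z4; congr (d _ _); apply: val_inj.
Qed.

(* Main.v *)
(* Expanding both sides along all edges other than the f_i and the e_i (2-sums
   commute with the five minors) reduces the case k = 1 to P and H having one edge
   each, f and e. Cut the circles of H at the four ends of e: the pieces pair these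
   ends in one of three ways, which says how H relinks P in the 2-sum (as P \ f,
   P / f or the Penrose-contraction). With the blocks of V and B met by e this gives
   five types of H, one for each minor of f, and Q of the 2-sum is c times Q of the
   minor of P for that type, where c is the monomial counting the remaining circles
   and blocks of H. The minors of H at e have Q-values c times the corresponding
   column of the coupling matrix, so by linearity the coefficients of Q(P (+) H) solve
   the linear system and uniqueness identifies them with phi.

   A partition of the circles is handled as the induced equivalence relation on
   points: minors and 2-sums then act by joining classes of pairs of points, and
   such joins commute. *)
Require Import Defs.
From mathcomp Require Import all_boot all_order perm all_algebra finmap zify ring.
From Stdlib Require Import FunctionalExtensionality.
Set Implicit Arguments.
Unset Strict Implicit.
Unset Printing Implicit Defensive.

(** * Joining classes of an equivalence relation *)

(** The coefficient vector of [H] must not depend on [P] or [f], because the induction on the edges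
    of [H] adds up such vectors. In [sum2_coeff], [P] and [f] are therefore quantified inside the
    existential. Solving the system and expanding [Q] are both linear in the vector, so existence
    alone carries the induction; uniqueness enters once, to recognise [phi].

    New circles are sets of points that may overlap several old ones, so counts cannot be compared
    through a bijection of circles. Instead each presentation in play is compared with the strands
    left when the arcs at the ends of an edge are removed: it is obtained from these by joining a
    few pairs of points. Joining a pair lowers the number of classes by one exactly when the pair
    was not yet related, and the exponents of [alpha], [beta] and [gamma] all result from counting
    such effective joins. *)

Section Joins.
Variable T : finType.
Implicit Types (r R S : rel T) (p q x y : T) (s : seq (T * T)).

Lemma connect_equiv r : connect_sym r -> equivb (connect r).
Proof. by move=> cs; split; [exact: connect0 | exact: cs | exact: connect_trans]. Qed.

Lemma connect_min r S : equivb S -> subrel r S -> subrel (connect r) S.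
Proof.
move=> [rS _ tS] rsub x y /connectP[c pc ->] {y}.
elim: c x pc => //= z c IH x /andP[xz pc].
exact: tS (rsub _ _ xz) (IH _ pc).
Qed.

Definition Rjoins R s : rel T := foldl (fun R pq => Rjoin R pq.1 pq.2) R s.

Lemma Rjoins_equiv R s : equivb R -> equivb (Rjoins R s).
Proof. by elim: s R => //= pq s IH R eR; apply/IH/Rjoin_equiv. Qed.

Lemma sub_Rjoins R s : subrel R (Rjoins R s).
Proof.
by elim: s R => [|pq s IH] R x y //= xy; apply: IH; apply: sub_Rjoin.
Qed.

Lemma Rjoins_mem R s p q : equivb R -> (p, q) \in s -> Rjoins R s p q.
Proof.
elim: s R => //= pq s IH R eR; rewrite inE => /predU1P[<-|pqs].
  exact/sub_Rjoins/Rjoin_pq.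
by apply: IH => //; apply: Rjoin_equiv.
Qed.

Lemma Rjoins_min R S s : equivb S -> subrel R S ->
  {in s, forall pq, S pq.1 pq.2} -> subrel (Rjoins R s) S.
Proof.
elim: s R => //= pq s IH R eS RS sS; apply: IH => //.
  by apply: Rjoin_min => //; apply: sS; rewrite inE eqxx.
by move=> pq' pqs; apply: sS; rewrite inE pqs orbT.
Qed.

Lemma Rjoins_eq R S s : R =2 S -> Rjoins R s =2 Rjoins S s.
Proof. by elim: s R S => //= pq s IH R S e; apply/IH/Rjoin_eq. Qed.

Lemma Rjoins_out R s x :
  {in s, forall pq, ~~ R pq.1 x /\ ~~ R pq.2 x} -> Rjoins R s x =1 R x.
Proof.
elim: s R => //= pq s IH R out y.
have [/negbTE o1 /negbTE o2] : ~~ R pq.1 x /\ ~~ R pq.2 x.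
  by apply: out; rewrite inE eqxx.
rewrite IH /Rjoin ?o1 ?o2 ?orbF // => pq' pqs.
by rewrite !andbF !orbF; apply: (out pq'); rewrite inE pqs orbT.
Qed.

(** The common form of the results on circles below: [r0] keeps the strands left after the arcs at
    certain points are removed, and [s] lists the arcs put in their place. *)
Lemma connect_Rjoins r r0 s : connect_sym r -> connect_sym r0 ->
    subrel r0 (connect r) -> {in s, forall pq, connect r pq.1 pq.2} ->
    subrel r (Rjoins (connect r0) s) ->
  connect r =2 Rjoins (connect r0) s.
Proof.
move=> cs cs0 sub0 sub_s subr x y; apply/idP/idP.
  by apply: connect_min subr _ _; apply/Rjoins_equiv/connect_equiv.
apply: Rjoins_min => //; first exact: connect_equiv.
by apply: connect_min => //; apply: connect_equiv.
Qed.

(** For [connect vrel] this is, by conversion, the number of circles; for the relation induced by a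
    partition of circles it is the number of blocks. *)
Definition ncls R := #|[set [set y | R x y] | x : T]|.

Lemma ncls_eq R S : R =2 S -> ncls R = ncls S.
Proof.
move=> e; congr #|pred_of_set _|; apply: eq_imset => x.
by apply/setP=> y; rewrite !inE e.
Qed.

Lemma ncls_gt0 R x : 0 < ncls R.
Proof. by apply/card_gt0P; exists [set y | R x y]; apply: imset_f. Qed.

(** The classes of [p] and [q] become one, and all others ([rest]) are untouched. *)
Lemma ncls_Rjoin R p q : equivb R -> ncls R = (ncls (Rjoin R p q) + ~~ R p q)%N.
Proof.
move=> eR; have [rR sR tR] := eR.
have [pq|npq] := boolP (R p q); rewrite ?addn0 ?addn1.
  apply: ncls_eq => x y; apply/idP/idP; first exact: sub_Rjoin.
  by apply: Rjoin_min.
have [rR' sR' tR'] := Rjoin_equiv p q eR.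
pose c (S : rel T) x := [set y | S x y].
have cE S x y : equivb S -> (c S x == c S y) = S x y.
  case=> rS sS tS; apply/eqP/idP => [e|xy].
    by have := rS y; rewrite -[S y y]in_set -/(c S y) -e inE.
  apply/setP=> z; rewrite !inE; apply/idP/idP; last exact: tS.
  by apply: tS; rewrite sS.
pose rest := [set c R x | x in [pred x | ~~ R p x && ~~ R q x]].
have restE S x : equivb S -> c S x \in rest -> ~~ R p x && ~~ R q x.
  move=> [rS _ _] /imsetP[y /andP[py qy] e].
  have : x \in c R y by rewrite -e inE.
  rewrite inE sR => xy; apply/andP; split.
    by apply: contra py => px; apply: tR xy.
  by apply: contra qy => px; apply: tR xy.
have e' x : ~~ R p x -> ~~ R q x -> c (Rjoin R p q) x = c R x.
  by move=> px qx; apply/setP=> y; rewrite !inE /Rjoin (negbTE px) (negbTE qx) /= orbF.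
have -> : ncls (Rjoin R p q) = #|c (Rjoin R p q) p |: rest|.
  congr #|pred_of_set _|; apply/setP=> X; apply/imsetP/setU1P.
    move=> [x _ ->]; have [px|px] := boolP (R p x || R q x).
      left; apply/eqP; rewrite cE; last exact: Rjoin_equiv.
      by rewrite /Rjoin px rR !orbT.
    right; move: px; rewrite negb_or => /andP[px qx].
    by rewrite -/(c _ x) e' //; apply/imsetP; exists x => //; rewrite inE px.
  case=> [->|/imsetP[x /andP[px qx] ->]]; first by exists p.
  by exists x => //; rewrite -/(c _ x) e'.
have -> : ncls R = #|c R p |: (c R q |: rest)|.
  congr #|pred_of_set _|; apply/setP=> X; apply/imsetP/idP; rewrite !inE.
    move=> [x _ ->]; rewrite -/(c R x).
    rewrite (sR p, cE _ x) // (cE _ x) // [R x p]sR [R x q]sR.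
    case: (boolP (R p x)) => //= px; case: (boolP (R q x)) => //= qx.
    by apply/imsetP; exists x => //; rewrite inE px.
  case/or3P => [/eqP->|/eqP->|/imsetP[x _ ->]]; [by exists p|by exists q|by exists x].
rewrite !cardsU1 !inE cE // (negbTE npq) /=.
have n1 : c R p \notin rest.
  by apply/negP=> /(restE _ _ eR); rewrite rR.
have n2 : c R q \notin rest.
  by apply/negP=> /(restE _ _ eR); rewrite rR andbF.
have n3 : c (Rjoin R p q) p \notin rest.
  by apply/negP=> /(restE _ _ (Rjoin_equiv p q eR)); rewrite rR.
by rewrite n1 n2 n3; lia.
Qed.

End Joins.

(** * Relations on a disjoint union of point sets *)

Section Rsum.
Variables T T' : finType.

Definition rsum (R : rel T) (R' : rel T') : rel (T + T') := fun z z' =>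
  match z, z' with
  | inl x, inl y => R x y
  | inr x, inr y => R' x y
  | _, _ => false
  end.

Lemma rsum_eq R S R' S' : R =2 S -> R' =2 S' -> rsum R R' =2 rsum S S'.
Proof. by move=> e e' [x|x] [y|y] /=. Qed.

Lemma rsum_equiv R R' : equivb R -> equivb R' -> equivb (rsum R R').
Proof.
move=> [r s t] [r' s' t']; split; first by move=> [x|x] /=.
  by move=> [x|x] [y|y] /=.
by move=> [x|x] [y|y] [z|z] //=; [exact: t|exact: t'].
Qed.

Lemma connect_rsum r r' : connect (rsum r r') =2 rsum (connect r) (connect r').
Proof.
move=> z z'; apply/idP/idP.
  move=> /connectP[c pc ->] {z'}; elim: c z pc => [[x|x] _ /=|]; rewrite ?connect0 //.
  move=> y c IH x /andP[xy /IH] /=.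
  case: x y xy => [x|x] [y|y] //=; case: last => //= z h; apply: connect_trans; exact: connect1.
case: z z' => [x|x] [y|y] //= /connectP[c pc ->] {y}.
  elim: c x pc => //= y c IH x /andP[xy /IH]; apply: connect_trans; exact: connect1.
elim: c x pc => //= y c IH x /andP[xy /IH]; apply: connect_trans; exact: connect1.
Qed.

Lemma ncls_rsum R R' : reflexive R -> reflexive R' ->
  ncls (rsum R R') = (ncls R + ncls R')%N.
Proof.
move=> rR rR'.
have il : injective (@inl T T') by move=> x y [].
have ir : injective (@inr T T') by move=> x y [].
pose A := [set lift_set (@inl T T') X | X in [set [set y | R x y] | x : T]].
pose B := [set lift_set (@inr T T') X | X in [set [set y | R' x y] | x : T']].
have el x : [set z | rsum R R' (inl x) z] = lift_set inl [set y | R x y].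
  apply/setP=> -[y|y]; rewrite inE /= ?(mem_imset _ _ il) ?inE //.
  by apply/esym/imsetP=> -[].
have er x : [set z | rsum R R' (inr x) z] = lift_set inr [set y | R' x y].
  apply/setP=> -[y|y]; rewrite inE /= ?(mem_imset _ _ ir) ?inE //.
  by apply/esym/imsetP=> -[].
rewrite /ncls -(card_imset _ (imset_inj il)) -(card_imset _ (imset_inj ir)).
rewrite -/A -/B -cardsUI.
have -> : A :&: B = set0.
  apply/setP=> X; rewrite !inE; apply/negP=> /andP[/imsetP[_ /imsetP[x _ ->] ->]].
  move=> /imsetP[_ /imsetP[y _ ->]] /setP/(_ (inl x)).
  by rewrite -el inE /= rR => /esym/imsetP[].
rewrite cards0 addn0; congr #|pred_of_set _|; apply/setP=> X; rewrite inE.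
apply/imsetP/orP => [[[x|x] _ ->]|[]]; rewrite ?el ?er.
- by left; do 2!apply: imset_f.
- by right; do 2!apply: imset_f.
- by case/imsetP=> _ /imsetP[x _ ->] ->; exists (inl x); rewrite ?el.
- by case/imsetP=> _ /imsetP[x _ ->] ->; exists (inr x); rewrite ?er.
Qed.

End Rsum.

(** * Partitions of circles as relations on points *)

Section Blocks.
Variable T : finType.
Implicit Types (r R S : rel T) (p q x y : T) (PP : {set {set {set T}}}).

Definition block r S x : {set {set T}} := [set cls r y | y in S x].

(** The way back from relations to partitions: as [S] contains [connect r], its classes are unions
    of circles, and the circles inside one class form one block. *)
Lemma blockP r S PP : connect_sym r -> equivb S -> subrel (connect r) S ->
    PP = [set block r S x | x : T] ->
  partition PP (circ r) /\ Rof r PP =2 S.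
Proof.
move=> cs [rS sS tS] rsub ->.
have in_block x y : (cls r y \in block r S x) = S x y.
  apply/imsetP/idP => [[z xz e]|xy]; last by exists y.
  apply: tS xz _; apply: rsub.
  by have := mem_cls r y; rewrite e inE.
have part : partition [set block r S x | x : T] (circ r).
  apply/and3P; split.
  - rewrite eqEsubset; apply/andP; split; apply/subsetP=> X.
      by case/bigcupP=> _ /imsetP[x _ ->] /imsetP[y _ ->]; apply: cls_circ.
    case/imsetP=> x _ ->; apply/bigcupP; exists (block r S x).
      exact: imset_f.
    by rewrite in_block.
  - apply/trivIsetP=> _ _ /imsetP[x _ ->] /imsetP[y _ ->]; apply: contraR.
    case/pred0Pn=> X /andP[/= /imsetP[z xz ->]]; rewrite in_block => yz.
    have sub a b : S a z -> S b z -> block r S a \subset block r S b.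
      move=> az bz; apply/subsetP=> _ /imsetP[t at_ ->]; rewrite in_block.
      by apply: (tS _ _ _ bz); apply: (tS a) at_; rewrite sS.
    by rewrite eqEsubset !sub.
  - by apply/imsetP=> -[x _ /setP/(_ (cls r x))]; rewrite in_block rS inE.
split=> // x y; rewrite /Rof (@def_pblock _ _ (block r S x)) ?in_block //.
- exact: partition_trivIset part.
- exact: imset_f.
Qed.

Lemma partition_block r PP : partition PP (circ r) ->
  PP = [set block r (Rof r PP) x | x : T].
Proof.
move=> pP; have covP := cover_partition pP; have trP := partition_trivIset pP.
have e x : block r (Rof r PP) x = pblock PP (cls r x).
  apply/setP=> X; apply/imsetP/idP => [[y xy ->] //|Xx].
  have : X \in circ r.
    rewrite -covP; apply/bigcupP; exists (pblock PP (cls r x)) => //.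
    by rewrite pblock_mem // covP cls_circ.
  by case/imsetP=> y _ e; exists y => //; rewrite unfold_in /Rof -e.
apply/setP=> B; apply/idP/imsetP => [BP|[x _ ->]].
  have /set0Pn[X XB] : B != set0.
    by apply: contraTneq BP => ->; case/and3P: pP.
  have : X \in circ r by rewrite -covP; apply/bigcupP; exists B.
  case/imsetP=> x _ eX; exists x => //; rewrite e.
  by rewrite (def_pblock trP BP) // -/(cls r x) -eX.
by rewrite e pblock_mem // covP cls_circ.
Qed.

(** [X] is a union of old blocks, [U] contains the circles cut open and [C] the new ones. A circle
    outside [U] survives as the same set of points, so only points on circles of [U] change
    circle. *)
Lemma block_swap r rs S x0 (X U C : {set {set T}}) :
    (forall y, (cls r y \in X) = S x0 y) -> X \subset circ r ->
    (forall y, S x0 y -> cls r y \in U -> cls rs y \in C) ->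
    (forall y, S x0 y -> cls r y \notin U -> cls rs y = cls r y) ->
    (forall Y, Y \in C -> exists2 y, S x0 y & Y = cls rs y) ->
  (X :\: U) :|: C = block rs S x0.
Proof.
move=> XE Xsub inU outU CS; apply/setP=> Y; apply/setUP/imsetP.
  case=> [/setDP[YX YU]|/CS[y xy ->]]; last by exists y.
  have /imsetP[y _ eY] := subsetP Xsub _ YX; rewrite eY in YX YU.
  by rewrite XE in YX; exists y => //; rewrite eY outU.
case=> y xy ->; have [yU|yU] := boolP (cls r y \in U); first by right; apply: inU.
by left; rewrite outU // inE yU XE.
Qed.

Lemma Rof_connect r PP : connect_sym r -> partition PP (circ r) ->
  subrel (connect r) (Rof r PP).
Proof.
move=> cs pP x y xy; rewrite /Rof (@cls_eq _ r x y) ?inE //.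
exact: Rof_refl.
Qed.

(** The disjoint union [r] and the 2-sum [rs] are joins of the same strand relation [K]: in [r] the
    ends are paired within each summand, in [rs] across. A circle through none of the eight ends is
    a class of [K] and is the same in both. The points are kept abstract because vertices and
    boundary components pair the four ends of an edge differently. *)
Lemma sum_blocksP r rs K PP p1 p2 p3 p4 q1 q2 q3 q4 :
    connect_sym r -> connect_sym rs -> equivb K ->
    connect r =2 Rjoins K [:: (p1, p2); (p3, p4); (q1, q2); (q3, q4)] ->
    connect rs =2 Rjoins K [:: (p1, q1); (p2, q2); (p3, q3); (p4, q4)] ->
    partition PP (circ r) ->
  let PP' := sum_blocks PP (cls r p1) (cls r p3) (cls r q1) (cls r q3)
    [set cls rs p1; cls rs p2] [set cls rs p3; cls rs p4] in
  partition PP' (circ rs) /\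
  Rof rs PP' =2 Rjoins (Rof r PP) [:: (p1, q1); (p3, q3)].
Proof.
move=> cs css eK er ers pP PP'.
have covP := cover_partition pP; have trP := partition_trivIset pP.
have eR := Rof_equiv pP; set R := Rof r PP in eR *.
have [rR sR tR] := eR.
have eS := Rjoins_equiv [:: (p1, q1); (p3, q3)] eR; set S := Rjoins R _ in eS *.
have [rS sS tS] := eS.
have rsubR : subrel (connect r) R := Rof_connect cs pP.
have RsubS : subrel R S := @sub_Rjoins _ _ _.
have Ksub s : subrel K (Rjoins K s) := @sub_Rjoins _ _ _.
have mr p q : (p, q) \in [:: (p1, p2); (p3, p4); (q1, q2); (q3, q4)] -> connect r p q.
  by rewrite er; apply: Rjoins_mem.
have ms p q : (p, q) \in [:: (p1, q1); (p2, q2); (p3, q3); (p4, q4)] -> connect rs p q.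
  by rewrite ers; apply: Rjoins_mem.
have r12 : connect r p1 p2 by apply: mr; rewrite !inE eqxx ?orbT.
have r34 : connect r p3 p4 by apply: mr; rewrite !inE eqxx ?orbT.
have rq12 : connect r q1 q2 by apply: mr; rewrite !inE eqxx ?orbT.
have rq34 : connect r q3 q4 by apply: mr; rewrite !inE eqxx ?orbT.
have s1 : connect rs p1 q1 by apply: ms; rewrite !inE eqxx ?orbT.
have s2 : connect rs p2 q2 by apply: ms; rewrite !inE eqxx ?orbT.
have s3 : connect rs p3 q3 by apply: ms; rewrite !inE eqxx ?orbT.
have s4 : connect rs p4 q4 by apply: ms; rewrite !inE eqxx ?orbT.
have S1 : S p1 q1 by apply: Rjoins_mem; rewrite ?inE ?eqxx.
have S3 : S p3 q3 by apply: Rjoins_mem; rewrite ?inE ?eqxx ?orbT.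
have S2 : S p2 q2.
  apply: (tS q1); last exact/RsubS/rsubR.
  by apply: tS S1; rewrite sS; apply/RsubS/rsubR.
have S4 : S p4 q4.
  apply: (tS q3); last exact/RsubS/rsubR.
  by apply: tS S3; rewrite sS; apply/RsubS/rsubR.
have rssub : subrel (connect rs) S.
  move=> x y; rewrite ers; apply: Rjoins_min => //.
    by move=> a b ab; apply/RsubS/rsubR; rewrite er Ksub.
  by move=> pq; rewrite !inE => /or4P[]/eqP->.
pose ends8 := [:: p1; p2; p3; p4; q1; q2; q3; q4].
have far y : {in ends8, forall t, ~~ K t y} ->
    connect rs y =1 K y /\ connect r y =1 K y.
  move=> fy; split=> z; rewrite ?er ?ers Rjoins_out // => pq; rewrite !inE.
    by case/or4P=> /eqP->; split; apply: fy; rewrite !inE eqxx ?orbT.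
  by case/or4P=> /eqP->; split; apply: fy; rewrite !inE eqxx ?orbT.
pose U := [set cls r p1; cls r p3; cls r q1; cls r q3].
pose C := [set cls rs p1; cls rs p2]; pose D := [set cls rs p3; cls rs p4].
have UE y : (cls r y \in U) =
    [|| connect r p1 y, connect r p3 y, connect r q1 y | connect r q3 y].
  have e t : (cls r y == cls r t) = connect r t y.
    apply/eqP/idP => [e|ty]; last by apply: cls_eq; rewrite ?inE.
    by have := mem_cls r y; rewrite e inE.
  by rewrite !inE !e !orbA.
(* A circle of [rs] meeting a circle of [U] passes through one of the eight ends: otherwise its
   points would have the same class in [K] and in [r], away from [U]. *)
have nearU y : cls r y \in U -> cls rs y \in C :|: D.
  move=> yU; have /hasP[t t8 ty] : has (fun t => K t y) ends8.
    apply: contraLR yU => /hasPn fy; rewrite UE.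
    have [_ e] := far y fy.
    have [_ sK _] := eK.
    rewrite !(cs _ y) !e !(sK y).
    by do !rewrite (negbTE (fy _ _)) ?inE ?eqxx ?orbT.
  have {}ty : cls rs y = cls rs t by apply: cls_eq; rewrite // inE ers Ksub.
  rewrite ty; have eqs a b : connect rs a b -> cls rs b = cls rs a.
    by move=> ab; apply: cls_eq; rewrite ?inE.
  have := (eqs _ _ s1, eqs _ _ s2, eqs _ _ s3, eqs _ _ s4) => e4.
  move: t8; rewrite !inE => /or4P[/eqP->|/eqP->|/eqP->|].
  - by rewrite eqxx.
  - by rewrite eqxx orbT.
  - by rewrite eqxx !orbT.
  case/or4P=> [/eqP->|/eqP->|/eqP->|/orP[]/eqP->]; rewrite ?e4 eqxx ?orbT //.
have outU y : cls r y \notin U -> cls rs y = cls r y.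
  rewrite UE => yU; have fy : {in ends8, forall t, ~~ K t y}.
    move=> t t8; apply: contra yU => ty.
    have {}ty : connect r t y by rewrite er Ksub.
    have tr a b : connect r a b -> connect r b y -> connect r a y.
      exact: connect_trans.
    move: t8; rewrite !inE => /or4P[/eqP e|/eqP e|/eqP e|]; rewrite ?e in ty.
    - by rewrite ty.
    - by rewrite (tr _ _ r12 ty).
    - by rewrite ty orbT.
    case/or4P=> [/eqP e|/eqP e|/eqP e|/orP[]/eqP e]; rewrite ?e in ty.
    - by rewrite (tr _ _ r34 ty) !orbT.
    - by rewrite ty !orbT.
    - by rewrite (tr _ _ rq12 ty) !orbT.
    - by rewrite ty !orbT.
    - by rewrite (tr _ _ rq34 ty) !orbT.
  by have [e e'] := far y fy; apply/setP=> z; rewrite !inE e e'.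
apply: blockP => //.
set u := cls r p1; set v := cls r p3; set u' := cls r q1; set v' := cls r q3.
have inR p y : (cls r y \in pblock PP (cls r p)) = R p y by [].
have RE p y : (pblock PP (cls r y) == pblock PP (cls r p)) = R p y.
  by rewrite eq_sym -RofE.
pose near y := [|| R p1 y, R p3 y, R q1 y | R q3 y].
have block_eq a b : S a b -> block rs S a = block rs S b.
  move=> ab; apply/setP=> X; apply/imsetP/imsetP => -[y yS ->]; exists y => //.
    by apply: (tS a) => //; rewrite sS.
  exact: (tS b).
have SE y : S p1 y || S p3 y = near y.
  apply/orP/or4P => [[]|].
  - rewrite /S /Rjoins /= /Rjoin.
    by case: (R p1 y) (R q1 y) (R p3 y) (R q3 y) => [] [] [] []; do ?[by constructor];
      rewrite ?orbF ?andbF.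
  - rewrite /S /Rjoins /= /Rjoin.
    by case: (R p1 y) (R q1 y) (R p3 y) (R q3 y) => [] [] [] []; do ?[by constructor];
      rewrite ?orbF ?andbF.
  - by case=> /RsubS h; [left|right|left; apply: tS h|right; apply: tS h].
have Unear x y : R x y -> cls r y \in U -> near x.
  rewrite UE sR => xy; rewrite /near => /or4P[]/rsubR h;
    by rewrite (tR _ _ _ h xy) ?orbT.
have pblockE x : ~~ near x -> block rs S x = pblock PP (cls r x).
  move=> nx; have SR y : S x y = R x y.
    apply: Rjoins_out => pq; move: nx; rewrite !negb_or !inE => /and4P[? ? ? ?].
    by case/orP=> /eqP->.
  apply/setP=> X; apply/imsetP/idP => [[y + ->]|Xx].
    rewrite -[_ \in _]/(S x y) SR => xy; rewrite outU ?inR //.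
    by apply: contra nx; apply: Unear.
  have /imsetP[y _ eX] : X \in circ r.
    by apply: subsetP Xx; apply: (partitionS pP); rewrite pblock_mem ?covP ?cls_circ.
  rewrite eX in Xx *; exists y; first by rewrite -[_ \in _]/(S x y) SR.
  by apply/esym/outU; apply: contra nx; apply: Unear.
have subcr p : pblock PP (cls r p) \subset circ r.
  by apply: (partitionS pP); rewrite pblock_mem ?covP ?cls_circ.
have PE : PP :\: [set pblock PP u; pblock PP v; pblock PP u'; pblock PP v'] =
    [set block rs S x | x in [pred x | ~~ near x]].
  apply/setP=> B; rewrite !inE; apply/andP/imsetP => [[+ BP]|[x nx ->]].
    have /set0Pn[X XB] : B != set0.
      by apply: contraTneq BP => ->; case/and3P: pP.
    have /imsetP[x _ eX] := subsetP (partitionS pP BP) _ XB.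
    have <- : pblock PP (cls r x) = B by apply: (def_pblock trP); rewrite // -/(cls r x) -eX.
    rewrite !RE => nx; have nx' : ~~ near x by rewrite /near !orbA.
    by exists x => //; rewrite pblockE.
  rewrite pblockE // !RE; split; first by move: nx; rewrite inE /near !orbA.
  by rewrite pblock_mem ?covP ?cls_circ.
have CE Y : Y \in C -> exists2 y, connect r p1 y & Y = cls rs y.
  by case/set2P=> ->; [exists p1 | exists p2].
have DE Y : Y \in D -> exists2 y, connect r p3 y & Y = cls rs y.
  by case/set2P=> ->; [exists p3 | exists p4].
have CS Y : Y \in C -> exists2 y, S p1 y & Y = cls rs y.
  by case/CE=> y /rsubR/RsubS; exists y.
have DS Y : Y \in D -> exists2 y, S p3 y & Y = cls rs y.
  by case/DE=> y /rsubR/RsubS; exists y.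
have clsS y z : cls rs y = cls rs z -> S y z.
  by move=> e; apply: rssub; have := mem_cls rs z; rewrite -e inE.
have newE : (if [disjoint pblock PP u :|: pblock PP u' & pblock PP v :|: pblock PP v']
    then [set ((pblock PP u :|: pblock PP u') :\: [set u; u']) :|: C;
      ((pblock PP v :|: pblock PP v') :\: [set v; v']) :|: D]
    else [set ((pblock PP u :|: pblock PP u' :|: (pblock PP v :|: pblock PP v'))
      :\: [set u; v; u'; v']) :|: (C :|: D)]) =
    [set block rs S p1; block rs S p3].
  (* If the unions are disjoint, [R] relates neither [p1] nor [q1] to [p3] or [q3]. The two joins
     then do not interact, and the class in [S] tells whether a new circle belongs to [C] or to
     [D]. *)
  have [dis|] := boolP [disjoint _ & _].
    have nd a b : a \in [:: p1; q1] -> b \in [:: p3; q3] -> R a b = false.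
      move=> a1 b3; apply/negP=> ab.
      have /(disjointFr dis) : cls r b \in pblock PP u :|: pblock PP u'.
        by move: a1 ab; rewrite in_setU !inR !inE => /orP[]/eqP-> ->; rewrite ?orbT.
      by rewrite in_setU !inR; move: b3; rewrite !inE => /orP[]/eqP->; rewrite rR ?orbT.
    have nd' a b : a \in [:: p1; q1] -> b \in [:: p3; q3] -> R b a = false.
      by rewrite sR; apply: nd.
    have nE : (R p1 p3, R p1 q3, R q1 p3, R q1 q3) = (false, false, false, false).
      by rewrite !nd ?inE ?eqxx ?orbT.
    have nE' : (R p3 p1, R p3 q1, R q3 p1, R q3 q1) = (false, false, false, false).
      by rewrite !nd' ?inE ?eqxx ?orbT.
    case: nE nE' => n1 n2 n3 n4 [m1 m2 m3 m4].
    have S1E y : S p1 y = R p1 y || R q1 y.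
      rewrite /S /Rjoins /= /Rjoin ?(rR, n1, n2, n3, n4, m1, m2, m3, m4) /=.
      by rewrite ?(andbF, orbF, orbA, orbb).
    have S3E y : S p3 y = R p3 y || R q3 y.
      rewrite /S /Rjoins /= /Rjoin ?(rR, n1, n2, n3, n4, m1, m2, m3, m4) /=.
      by rewrite ?(andbF, orbF, orbA, orbb).
    have S13 : S p1 p3 = false by rewrite S1E !nd ?inE ?eqxx ?orbT.
    have UEp y : (cls r y \in U) = (cls r y \in [set u; u']) || (cls r y \in [set v; v']).
      by rewrite !inE -!orbA; congr (_ || _); rewrite orbCA.
    have uS y : cls r y \in [set u; u'] -> S p1 y.
      rewrite !inE S1E => /orP[]/eqP e; apply/orP; [left|right]; apply/rsubR.
        by have := mem_cls r y; rewrite e inE.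
      by have := mem_cls r y; rewrite e inE.
    have vS y : cls r y \in [set v; v'] -> S p3 y.
      rewrite !inE S3E => /orP[]/eqP e; apply/orP; [left|right]; apply/rsubR.
        by have := mem_cls r y; rewrite e inE.
      by have := mem_cls r y; rewrite e inE.
    have no y : S p1 y -> S p3 y -> false.
      by move=> h h'; rewrite -S13; apply: (tS y) => //; rewrite sS.
    congr [set _; _]; apply: (@block_swap r) => //.
    - by move=> y; rewrite S1E in_setU.
    - by rewrite subUset !subcr.
    - move=> y y1 yu; have : cls rs y \in C :|: D by apply: nearU; rewrite UEp yu.
      case/setUP=> // /DS[z z3 /clsS yz].
      by have := no z (tS _ _ _ y1 yz) z3.
    - move=> y y1 yu; apply: outU; rewrite UEp (negbTE yu) /=.
      by apply/negP=> /vS h; have := no y y1 h.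
    - by move=> y; rewrite S3E in_setU.
    - by rewrite subUset !subcr.
    - move=> y y1 yu; have : cls rs y \in C :|: D by apply: nearU; rewrite UEp yu orbT.
      case/setUP=> // /CS[z z3 /clsS yz].
      by have := no z z3 (tS _ _ _ y1 yz).
    - move=> y y1 yu; apply: outU; rewrite UEp (negbTE yu) orbF /=.
      by apply/negP=> /uS h; have := no y h y1.
  (* A circle common to both unions puts [p1] and [p3] in one class of [S], so the two blocks on the
     right coincide, in agreement with the fused block. *)
  case/pred0Pn=> X /andP[/= X1 X3].
  have S13 : S p1 p3.
    have /imsetP[x _ eX] : X \in circ r.
      have sub : pblock PP u :|: pblock PP u' \subset circ r by rewrite subUset !subcr.
      exact: subsetP sub _ X1.
    move: X1 X3; rewrite eX !in_setU !inR => x1 x3.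
    have {}x1 : S p1 x.
      by case/orP: x1 => /RsubS h //; apply: tS h.
    rewrite sS; apply: (tS x); last by rewrite sS.
    by case/orP: x3 => /RsubS h //; apply: tS h.
  have S1E y : S p1 y = near y.
    rewrite -SE; apply/idP/orP => [->|[|]]; [by left|by []|exact: tS].
  rewrite -(block_eq _ _ S13) setUid; congr [set _]; apply: (@block_swap r) => //.
  - by move=> y; rewrite S1E !in_setU -!orbA; congr (_ || _); rewrite orbCA.
  - by rewrite subUset; apply/andP; split; rewrite subUset; apply/andP; split; apply: subcr.
  - move=> y _ yu; apply: nearU.
    by move: yu; rewrite !inE -!orbA => /or4P[]->; rewrite ?orbT.
  - move=> y _ yu; apply: outU; apply: contra yu.
    by rewrite !inE -!orbA => /or4P[]->; rewrite ?orbT.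
  - move=> Y /setUP[/CS//|/DS[y y3 ->]]; exists y => //; exact: tS y3.
rewrite /PP' /sum_blocks newE PE; apply/setP=> B; apply/setUP/imsetP.
  by case=> [/imsetP[x _ ->]|/set2P[]->]; [exists x|exists p1|exists p3].
case=> x _ ->; have [nx|nx] := boolP (near x); [right|left]; last first.
  by apply/imsetP; exists x; rewrite ?inE.
by move: nx; rewrite -SE => /orP[]/block_eq <-; rewrite !inE eqxx ?orbT.
Qed.
End Blocks.

(** * Removing the arcs at the ends of an edge *)

(* The arcs that replace the two arrows of [x]: in [A \ e] for [k = 0], in [A / e]
   for [k = 1] and in the Penrose-contraction for [k = 2], as in [marc] and [kof]. *)
Definition links (T : Type) (k : nat) (x : edge T) : seq (T * T) :=
  match k with
  | 0 => [:: (x.1.1, x.1.2); (x.2.1, x.2.2)]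
  | 1 => [:: (x.1.1, x.2.2); (x.1.2, x.2.1)]
  | _ => [:: (x.1.1, x.2.1); (x.1.2, x.2.2)]
  end.

Definition arcs (T : Type) (a : T -> T) (x : edge T) :=
  forall i, a (nth_arrow x i).1 = (nth_arrow x i).2.

Definition swap_edge (T : Type) (x : edge T) : edge T := (x.2, x.1).

Section Links.
Variable T : eqType.
Implicit Types (x : edge T) (a g : T -> T).

Lemma links_ends k x z : z \in ends x ->
  exists2 pq, pq \in links k x & z = pq.1 \/ z = pq.2.
Proof.
case: x => [[p1 p2] [q1 q2]]; rewrite /ends !inE /=.
case: k => [|[|k]]; case/or4P=> /eqP->.
- by exists (p1, p2); [rewrite inE eqxx | left].
- by exists (p1, p2); [rewrite inE eqxx | right].
- by exists (q1, q2); [rewrite !inE eqxx orbT | left].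
- by exists (q1, q2); [rewrite !inE eqxx orbT | right].
- by exists (p1, q2); [rewrite inE eqxx | left].
- by exists (p2, q1); [rewrite !inE eqxx orbT | left].
- by exists (p2, q1); [rewrite !inE eqxx orbT | right].
- by exists (p1, q2); [rewrite inE eqxx | right].
- by exists (p1, q1); [rewrite inE eqxx | left].
- by exists (p2, q2); [rewrite !inE eqxx orbT | left].
- by exists (p1, q1); [rewrite inE eqxx | right].
- by exists (p2, q2); [rewrite !inE eqxx orbT | right].
Qed.

Lemma mem_links_ends k x pq : pq \in links k x ->
  pq.1 \in ends x /\ pq.2 \in ends x.
Proof.
case: x => [[p1 p2] [q1 q2]]; rewrite /ends.
by case: k => [|[|k]]; rewrite !inE /= => /orP[]/eqP->; rewrite /= ?eqxx ?orbT.
Qed.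

Lemma marc_links k x a pq : uniq (ends x) -> arcs a x -> involutive a ->
  pq \in links k x -> marc k x a pq.1 = pq.2 /\ marc k x a pq.2 = pq.1.
Proof.
case: x => [[p1 p2] [q1 q2]]; rewrite /ends /= !inE !negb_or.
move=> /and4P[/and3P[n1 n2 n3] /andP[n4 n5] n6 _] ha aK.
have /= a1 := ha false; have /= a2 := ha true.
have a1' : a p2 = p1 by rewrite -a1 aK.
have a2' : a q2 = q1 by rewrite -a2 aK.
have nE := (negbTE n1, negbTE n2, negbTE n3, negbTE n4, negbTE n5, negbTE n6).
have ns (S : eqType) (s t : S) : s != t -> (t == s) = false by rewrite eq_sym => /negbTE.
have nE' := (ns _ _ _ n1, ns _ _ _ n2, ns _ _ _ n3, ns _ _ _ n4, ns _ _ _ n5, ns _ _ _ n6).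
case: k => [|[|k]]; rewrite !inE /= => /orP[]/eqP-> //=.
all: by rewrite /relink ?eqxx ?nE ?nE' ?eqxx.
Qed.

Lemma arcs_ends a x z : arcs a x -> involutive a -> z \in ends x -> a z \in ends x.
Proof.
move=> ha aK; have /= a1 := ha false; have /= a2 := ha true.
rewrite /ends !inE => /or4P[]/eqP->.
- by rewrite a1 eqxx orbT.
- by rewrite -a1 aK eqxx.
- by rewrite a2 eqxx !orbT.
- by rewrite -a2 aK eqxx !orbT.
Qed.

Lemma mem_swap x : ends (swap_edge x) =i ends x.
Proof. by move=> z; rewrite /ends !inE /= !orbA; do 4!case: (z == _). Qed.

Lemma uniq_swap x : uniq (ends (swap_edge x)) = uniq (ends x).
Proof.
case: x => [[p1 p2] [q1 q2]].
exact: (uniq_catC [:: q1; q2] [:: p1; p2]).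
Qed.

Lemma arcs_swap a x : arcs a x -> arcs a (swap_edge x).
Proof. by move=> ha i; have := ha (~~ i); case: i. Qed.

Lemma marc_swap_edge k x a : uniq (ends x) -> marc k (swap_edge x) a = marc k x a.
Proof.
move=> ux; apply: functional_extensionality => z.
have [zx|zx] := boolP (z \in ends x); last by rewrite !marc_out ?mem_swap.
move: ux zx; case: x => [[p1 p2] [q1 q2]]; rewrite /ends /= !inE !negb_or.
move=> /and4P[/and3P[n1 n2 n3] /andP[n4 n5] n6 _].
have nE := (negbTE n1, negbTE n2, negbTE n3, negbTE n4, negbTE n5, negbTE n6).
have ns (S : eqType) (s t : S) : s != t -> (t == s) = false by rewrite eq_sym => /negbTE.
have nE' := (ns _ _ _ n1, ns _ _ _ n2, ns _ _ _ n3, ns _ _ _ n4, ns _ _ _ n5, ns _ _ _ n6).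
by case: k => [|[|k]] //= /or4P[]/eqP->; rewrite /relink ?(eqxx, nE, nE').
Qed.

End Links.

Section RelLinks.
Variable T : finType.
Implicit Types (x : edge T) (a g : T -> T).

Definition vr g a : rel T := fun z y => (y == g z) || (y == a z).

(** The test is made at the start [z] only, so symmetry requires that a step of [r] other than along
    [g] never enters [ends x] from outside. *)
Definition off g x (r : rel T) : rel T :=
  fun z y => (y == g z) || (z \notin ends x) && r z y.

Lemma inv_sym g : involutive g -> symmetric (fun z y => y == g z).
Proof. by move=> gK z y; apply/eqP/eqP=> ->; rewrite gK. Qed.

Lemma vr_sym g a : involutive g -> involutive a -> symmetric (vr g a).
Proof.
by move=> gK aK z y; rewrite /vr (inv_sym gK) (inv_sym aK).
Qed.

Lemma off_sym g x r : involutive g -> symmetric r ->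
  (forall z y, z \notin ends x -> r z y -> y != g z -> y \notin ends x) ->
  symmetric (off g x r).
Proof.
move=> gK sr out; have gs := inv_sym gK.
suff sub z y : off g x r z y -> off g x r y z by move=> z y; apply/idP/idP; apply: sub.
rewrite /off; have [->|ny] /= := eqVneq y (g z); first by rewrite gK eqxx.
by case/andP=> zx zy; rewrite sr zy (out z) ?orbT.
Qed.

Lemma voff_sym g a x : involutive g -> involutive a -> arcs a x ->
  symmetric (off g x (vr g a)).
Proof.
move=> gK aK ha; apply: off_sym (vr_sym gK aK) _ => // z y zx.
rewrite /vr => /orP[->//|/eqP-> _]; apply: contra zx => /(arcs_ends ha aK).
by rewrite aK.
Qed.

(** The strands do not depend on [k]: deletion, contraction and Penrose-contraction close up the
    same strands in three ways, and [k = 0] also describes the original circles. *)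
Lemma vr_links k g a x : uniq (ends x) -> arcs a x ->
    involutive g -> involutive a -> (forall z, a z != z) ->
  connect (vr g (marc k x a)) =2 Rjoins (connect (off g x (vr g a))) (links k x).
Proof.
move=> ux ha gK aK an; have [mK _] := marc_wf k ux ha aK an.
have cs0 := sym_connect_sym (voff_sym gK aK ha).
apply: connect_Rjoins => //.
- exact: sym_connect_sym (vr_sym gK mK).
- move=> z y /orP[/eqP->|/andP[zx /orP[/eqP->|/eqP->]]].
  + by apply: connect1; rewrite /vr eqxx.
  + by apply: connect1; rewrite /vr eqxx.
  + by apply: connect1; rewrite /vr marc_out // eqxx orbT.
- move=> pq /(marc_links ux ha aK)[<- _].
  by apply: connect1; rewrite /vr eqxx orbT.
move=> z y /orP[/eqP->|/eqP->].
  by apply/sub_Rjoins/connect1; rewrite /off eqxx.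
have [zx|zx] := boolP (z \in ends x); last first.
  by apply/sub_Rjoins/connect1; rewrite marc_out // /off zx /vr eqxx !orbT.
have eJ := Rjoins_equiv (links k x) (connect_equiv cs0); have [_ sJ _] := eJ.
have [[p q] pql zpq] := links_ends k zx.
have [/= e1 e2] := marc_links ux ha aK pql.
have pqJ : Rjoins (connect (off g x (vr g a))) (links k x) p q.
  by apply: Rjoins_mem pql; apply: connect_equiv.
by case: zpq => /= ->; rewrite ?e1 ?e2 // sJ.
Qed.

End RelLinks.

Lemma bcurves_swap (T : eqType) (x : edge T) : bcurves (swap_edge x) =i bcurves x.
Proof.
case: x => [[p1 p2] [q1 q2]] z; rewrite !inE /=.
by do 4!case: (z == _).
Qed.

(** A coupling amounts to an order on the two arrows of an edge; [x] is the edge [x0] with its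
    arrows read in one of the two orders. *)
Definition coupled (T : Type) (x0 x : edge T) := x = x0 \/ x = swap_edge x0.

Section Brel.
Variables (L : choiceType) (A : arrow_pres L) (wA : arrow_pres_wf A).
Variables (e : L) (x0 x : edge (pt A)).
Hypothesis ex0 : (edges A).[? e]%fmap = Some x0.
Hypothesis cx : coupled x0 x.

Lemma coupled_mem : ends x =i ends x0.
Proof. by case: cx => -> //; apply: mem_swap. Qed.

Lemma coupled_uniq : uniq (ends x).
Proof. by case: cx => ->; rewrite ?uniq_swap (wf_uniq wA ex0). Qed.

Lemma coupled_arcs : arcs (@seg L A) x.
Proof.
have ax0 : arcs (@seg L A) x0 by move=> i; exact: wf_arc ex0.
by case: cx => -> //; apply: arcs_swap.
Qed.

Lemma coupled_brel z y : z \in ends x ->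
  brel z y = (y == gap z) || ((z, y) \in bcurves x).
Proof.
rewrite coupled_mem => /(brel_edge wA _ ex0) ->.
by case: cx => -> //; rewrite bcurves_swap.
Qed.

Lemma brel_sym : symmetric (@brel L A).
Proof.
suff sub z' y' : @brel L A z' y' -> @brel L A y' z' by move=> z y; apply/idP/idP; apply: sub.
have [fz|[l [t [lt zt]]]] := @freeVedge L A z'.
  rewrite brel_free // => /orP[/eqP->|/eqP->].
    by rewrite /brel (gapK wA) eqxx.
  rewrite brel_free ?(segK wA) ?eqxx ?orbT // => l t lt.
  apply/negP=> /(ends_arc wA lt); rewrite (segK wA); exact/negP/(fz l).
rewrite (brel_edge wA _ lt) // => /orP[/eqP->|]; first by rewrite /brel (gapK wA) eqxx.
rewrite bcurves_sym => h; rewrite (brel_edge wA _ lt) ?h ?orbT //.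
exact: bcurves_ends h.
Qed.

Lemma brel_out z y : z \notin ends x -> brel z y -> y != gap z -> y \notin ends x.
Proof.
move=> zx; rewrite brel_sym => yz ny; apply: contra zx => yx; move: yz.
rewrite (coupled_brel _ yx) => /orP[/eqP zy|].
  by rewrite zy (gapK wA) eqxx in ny.
by rewrite bcurves_sym; apply: bcurves_ends.
Qed.

Lemma boff_sym : symmetric (off (@gap L A) x (@brel L A)).
Proof. exact: off_sym (gapK wA) brel_sym brel_out. Qed.

Lemma bcurves_links (T : eqType) (t : edge T) (z y : T) : ((z, y) \in bcurves t) =
  ((z, y) \in links 1 t) || ((y, z) \in links 1 t).
Proof.
case: t => [[p1 p2] [q1 q2]]; rewrite !inE !xpair_eqE /=.
by do 8![case: (_ == _) => //=].
Qed.

(** The curves added at an edge join exactly the points that its contraction identifies, hence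
    [links 1]. *)
Lemma brel_links :
  connect (@brel L A) =2 Rjoins (connect (off (@gap L A) x (@brel L A))) (links 1 x).
Proof.
have cs0 := sym_connect_sym boff_sym.
apply: connect_Rjoins => //.
- exact: brel_csym.
- move=> z y /orP[/eqP->|/andP[_ zy]]; apply: connect1 => //.
  by rewrite /brel eqxx.
- move=> [p q] pql; have [/= px _] := mem_links_ends pql.
  by apply: connect1; rewrite (coupled_brel _ px) bcurves_links pql orbT.
move=> z y zy; have [zx|zx] := boolP (z \in ends x); last first.
  by apply/sub_Rjoins/connect1; rewrite /off zx zy orbT.
have eC := connect_equiv cs0; have [_ sJ _] := Rjoins_equiv (links 1 x) eC.
move: zy; rewrite (coupled_brel _ zx) => /orP[/eqP->|].
  by apply/sub_Rjoins/connect1; rewrite /off eqxx.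
by rewrite bcurves_links => /orP[] h; [|rewrite sJ]; apply: Rjoins_mem h.
Qed.

End Brel.

(** * Points, arcs and edges of a 2-sum *)

Section MapEdges.
Variable L : choiceType.

Lemma fnd_map_edges (T T' : Type) (h : T -> T') (m : {fmap L -> edge T}) l :
  (map_edges h m).[? l]%fmap = omap (map_edge h) m.[? l]%fmap.
Proof.
rewrite /map_edges; case: fndP => [kf|nk]; last first.
  by rewrite not_fnd.
by rewrite ffunE /= (in_fnd (kf : l \in domf m)).
Qed.

Lemma mem_map_edge (T T' : eqType) (h : T -> T') (x : edge T) z : injective h ->
  (h z \in ends (map_edge h x)) = (z \in ends x).
Proof. by move=> hi; rewrite /ends /map_edge !inE /= !(inj_eq hi). Qed.

Lemma ends_map_edge (T T' : Type) (h : T -> T') (x : edge T) :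
  ends (map_edge h x) = map h (ends x).
Proof. by []. Qed.

Lemma bcurves_map (T T' : eqType) (h : T -> T') (x : edge T) z y : injective h ->
  ((h z, h y) \in bcurves (map_edge h x)) = ((z, y) \in bcurves x).
Proof.
by move=> hi; case: x => [[? ?] [? ?]]; rewrite /map_edge !inE !xpair_eqE /= !(inj_eq hi).
Qed.

End MapEdges.

Section SumPres.
Variables (L : choiceType) (f e : L) (P H : arrow_pres L).
Variables (x : edge (pt P)) (y : edge (pt H)).

Definition sseg (T T' : Type) (a : T -> T) (a' : T' -> T') (z : T + T') : T + T' :=
  match z with inl t => inl (a t) | inr t => inr (a' t) end.

Definition cross (T T' : Type) (i : bool) (x : edge T) (y : edge T') : edge (T + T') :=
  ((inl (nth_arrow x i).1, inl (nth_arrow x i).2),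
   (inr (nth_arrow y i).1, inr (nth_arrow y i).2)).

(* Identifying [p_i] with [q_i] is the relinking of a Penrose-contraction of each
   pair consisting of an arrow of [x] and an arrow of [y]. *)
Definition gseg (T T' : eqType) (x : edge T) (y : edge T') a a' : T + T' -> T + T' :=
  marc 2 (cross true x y) (marc 2 (cross false x y) (sseg a a')).

Definition spres : arrow_pres L :=
  @ArrowPres L (pt P + pt H)%type (sseg (@gap L P) (@gap L H))
    (gseg x y (@seg L P) (@seg L H))
    (catf (map_edges inl (edges P).[~ f]%fmap) (map_edges inr (edges H).[~ e]%fmap)).

End SumPres.

(** * The arrow presentation of a 2-sum *)

Lemma coupled_perm (T : Type) (y0 : edge T) (phi : {perm bool}) :
  coupled y0 (nth_arrow y0 (phi false), nth_arrow y0 (phi true)).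
Proof.
have : phi false != phi true by rewrite (inj_eq perm_inj).
by case: y0 => a b; case: (phi false); case: (phi true) => //= _; [right|left].
Qed.

Section SumPres.
Variables (L : choiceType) (f e : L) (P H : arrow_pres L).
Variables (x0 x : edge (pt P)) (y0 y : edge (pt H)).
Hypotheses (wP : arrow_pres_wf P) (wH : arrow_pres_wf H).
Hypotheses (fx0 : (edges P).[? f]%fmap = Some x0) (cx : coupled x0 x).
Hypotheses (ey0 : (edges H).[? e]%fmap = Some y0) (cy : coupled y0 y).
Hypothesis dPH : [disjoint E(P) & E(H)]%fset.

Let S := spres f e x y.
Let ux : uniq (ends x) := coupled_uniq wP fx0 cx.
Let uy : uniq (ends y) := coupled_uniq wH ey0 cy.
Let ax : arcs (@seg L P) x := coupled_arcs wP fx0 cx.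
Let ay : arcs (@seg L H) y := coupled_arcs wH ey0 cy.
Let a0 : pt S -> pt S := sseg (@seg L P) (@seg L H).
Let X1 := cross false x y.
Let X2 := cross true x y.

Let inl_inj : injective (@inl (pt P) (pt H)). Proof. by move=> ? ? []. Qed.
Let inr_inj : injective (@inr (pt P) (pt H)). Proof. by move=> ? ? []. Qed.

Lemma cross_mem i (z : pt S) : (z \in ends (cross i x y)) =
  match z with
  | inl t => t \in [:: (nth_arrow x i).1; (nth_arrow x i).2]
  | inr t => t \in [:: (nth_arrow y i).1; (nth_arrow y i).2]
  end.
Proof.
rewrite /ends; case: z => t; rewrite !inE /=.
  by rewrite -![inl _ == inl _]/(_ == _) /= ?orbF.
by rewrite -![inr _ == inr _]/(_ == _) /= ?orbF.
Qed.

Lemma cross_memE (z : pt S) : (z \in ends X1) || (z \in ends X2) =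
  match z with inl t => t \in ends x | inr t => t \in ends y end.
Proof. by rewrite !cross_mem; case: z => t; rewrite !inE /= !orbA. Qed.

Lemma cross_disj (z : pt S) : z \in ends X1 -> z \notin ends X2.
Proof.
have dis (T : eqType) (t : edge T) (u : T) : uniq (ends t) ->
    u \in [:: t.1.1; t.1.2] -> u \notin [:: t.2.1; t.2.2].
  rewrite (@cat_uniq _ [:: t.1.1; t.1.2]) => /and3P[_ /hasPn h _] ut.
  by apply/negP=> /h; rewrite ut.
by rewrite !cross_mem; case: z => t; apply: dis.
Qed.

Lemma cross_uniq i : uniq (ends (cross i x y)).
Proof.
move: ux uy; rewrite /ends /= !inE !negb_or.
move=> /and4P[/and3P[n1 n2 n3] /andP[n4 n5] n6 _] /and4P[/and3P[m1 m2 m3] /andP[m4 m5] m6 _].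
by case: i => /=; rewrite !(inj_eq inl_inj, inj_eq inr_inj) ?n1 ?n6 ?m1 ?m6.
Qed.

Lemma a0K : involutive a0.
Proof. by case=> t; rewrite /a0 /sseg (segK wP, segK wH). Qed.

Lemma a0_neq (z : pt S) : a0 z != z.
Proof. by case: z => t; rewrite /a0 /sseg ?(inj_eq inl_inj) ?(inj_eq inr_inj) ?seg_neq. Qed.

Lemma a0_arcs i : arcs a0 (cross i x y).
Proof. by case=> /=; rewrite ?ax ?ay. Qed.

Let a1 := marc 2 X1 a0.

Lemma a1_wf : involutive a1 /\ (forall z, a1 z != z).
Proof. exact: marc_wf (cross_uniq _) (a0_arcs _) a0K a0_neq. Qed.

Lemma a1_arcs : arcs a1 X2.
Proof.
move=> i; rewrite -a0_arcs; apply: marc_out.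
have : (nth_arrow X2 i).1 \in ends X2 by case: (i); rewrite /ends !inE eqxx ?orbT.
by apply: contraL; apply: cross_disj.
Qed.

Lemma gseg_wf : involutive (@seg L S) /\ (forall z, @seg L S z != z).
Proof. by have [aK an] := a1_wf; apply: marc_wf (cross_uniq _) a1_arcs aK an. Qed.

Definition slinks : seq (pt S * pt S) := links 2 X1 ++ links 2 X2.

Lemma gseg_out (z : pt S) :
  z \notin ends X1 -> z \notin ends X2 -> @seg L S z = a0 z.
Proof. by move=> z1 z2; apply: etrans (marc_out _ _ z2) (marc_out _ _ z1). Qed.

Lemma gseg_links pq : pq \in slinks ->
  @seg L S pq.1 = pq.2 /\ @seg L S pq.2 = pq.1.
Proof.
have [aK _] := a1_wf; rewrite mem_cat => /orP[] pql; last first.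
  exact: marc_links (cross_uniq _) a1_arcs aK pql.
have [z1 z2] := mem_links_ends pql.
have [m1 m2] := marc_links (cross_uniq _) (a0_arcs _) a0K pql.
by split; [rewrite -[RHS]m1 | rewrite -[RHS]m2]; apply: marc_out; apply: cross_disj.
Qed.

Lemma slinks_ends (z : pt S) : z \in ends X1 \/ z \in ends X2 ->
  exists2 pq, pq \in slinks & z = pq.1 \/ z = pq.2.
Proof.
case=> /(links_ends 2)[pq pql zpq]; exists pq => //; rewrite mem_cat pql ?orbT //.
Qed.

Lemma fnd_spres l z : (edges S).[? l]%fmap = Some z ->
  (exists t, [/\ l != f, (edges P).[? l]%fmap = Some t & z = map_edge inl t]) \/
  (exists t, [/\ l != e, (edges H).[? l]%fmap = Some t & z = map_edge inr t]).
Proof.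
rewrite fnd_cat; case: ifP => _; rewrite fnd_map_edges fnd_rem1.
  case: eqVneq => //= le; case lt: (edges H).[? l]%fmap => [t|] // [<-].
  by right; exists t.
case: eqVneq => //= le; case lt: (edges P).[? l]%fmap => [t|] // [<-].
by left; exists t.
Qed.

Lemma fnd_spresl l t : l != f -> (edges P).[? l]%fmap = Some t ->
  (edges S).[? l]%fmap = Some (map_edge inl t).
Proof.
move=> lf lt; have lP : l \in E(P) by rewrite -fndSome lt.
rewrite fnd_cat ifF ?fnd_map_edges ?fnd_rem1 ?lf ?lt //.
apply/negbTE; change (l \notin domf (edges H).[~ e]%fmap).
by rewrite mem_remf1 (negbTE (fdisjointP dPH l lP)) andbF.
Qed.

Lemma fnd_spresr l t : l != e -> (edges H).[? l]%fmap = Some t ->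
  (edges S).[? l]%fmap = Some (map_edge inr t).
Proof.
move=> le lt; have lH : l \in E(H) by rewrite -fndSome lt.
rewrite fnd_cat ifT ?fnd_map_edges ?fnd_rem1 ?le ?lt //.
by change (l \in domf (edges H).[~ e]%fmap); rewrite mem_remf1 le lH.
Qed.

Lemma spres_edges : E(S) = ((E(P) `\ f) `|` (E(H) `\ e))%fset.
Proof.
apply/fsetP=> l; rewrite mem_catf; change ((l \in domf (edges P).[~ f]%fmap) ||
  (l \in domf (edges H).[~ e]%fmap) = (l \in ((E(P) `\ f) `|` (E(H) `\ e))%fset)).
by rewrite !mem_remf1 !inE.
Qed.

Lemma edge_out l t : l != f -> (edges P).[? l]%fmap = Some t ->
  forall z, z \in ends t -> z \notin ends x.
Proof.
move=> lf lt z zt; rewrite (coupled_mem cx); apply: contra lf => zx.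
by rewrite (wf_disj wP lt fx0 zt zx).
Qed.

Lemma edge_outr l t : l != e -> (edges H).[? l]%fmap = Some t ->
  forall z, z \in ends t -> z \notin ends y.
Proof.
move=> lf lt z zt; rewrite (coupled_mem cy); apply: contra lf => zx.
by rewrite (wf_disj wH lt ey0 zt zx).
Qed.

Lemma sseg_out (z : pt S) :
    match z with inl t => t \notin ends x | inr t => t \notin ends y end ->
  @seg L S z = a0 z.
Proof.
have := cross_memE z; case: z => t tE /negbTE tx; rewrite tx in tE;
  by move/negbT: tE; rewrite negb_or => /andP[]; apply: gseg_out.
Qed.

Lemma spres_wf : arrow_pres_wf S.
Proof.
have [aK an] := gseg_wf; split=> //.
- by case=> t; rewrite /= /sseg ?(gapK wP) ?(gapK wH).
- by case=> t; rewrite /= ?(inj_eq inl_inj) ?(inj_eq inr_inj) ?gap_neq.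
- move=> l i; have : (edges S).[? val l]%fmap = Some (edges S l) by rewrite Some_fnd.
  have nt (T : eqType) (t : edge T) : (nth_arrow t i).1 \in ends t.
    by case: (i); rewrite /ends !inE eqxx ?orbT.
  case/fnd_spres => -[t [le lt ->]].
    have -> : (nth_arrow (map_edge inl t) i).1 = inl (nth_arrow t i).1 :> pt S by case: (i).
    rewrite sseg_out; last exact: edge_out lt _ (nt _ _).
    by rewrite /a0 /= (wf_arc wP i lt); case: (i).
  have -> : (nth_arrow (map_edge inr t) i).1 = inr (nth_arrow t i).1 :> pt S by case: (i).
  rewrite sseg_out; last exact: edge_outr lt _ (nt _ _).
  by rewrite /a0 /= (wf_arc wH i lt); case: (i).
- move=> l; have : (edges S).[? val l]%fmap = Some (edges S l) by rewrite Some_fnd.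
  case/fnd_spres => -[t [le lt ->]]; rewrite ends_map_edge map_inj_uniq //.
    exact: wf_uniq lt.
  exact: wf_uniq lt.
move=> l l' z.
have : (edges S).[? val l']%fmap = Some (edges S l') by rewrite Some_fnd.
have : (edges S).[? val l]%fmap = Some (edges S l) by rewrite Some_fnd.
case/fnd_spres => -[t [le lt ->]]; case/fnd_spres => -[t' [le' lt' ->]];
  rewrite !ends_map_edge => /mapP[u ut ->] /mapP[v vt //] [uv]; apply: val_inj;
  rewrite -uv in vt.
- exact: (wf_disj wP) lt lt' ut vt.
- exact: (wf_disj wH) lt lt' ut vt.
Qed.

Lemma vrel_spres : connect (@vrel L S) =2
  Rjoins (connect (rsum (off (@gap L P) x (@vrel L P)) (off (@gap L H) y (@vrel L H))))
    slinks.
Proof.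
have wS := spres_wf.
have sP : symmetric (off (@gap L P) x (@vrel L P)) := voff_sym (gapK wP) (segK wP) ax.
have sH : symmetric (off (@gap L H) y (@vrel L H)) := voff_sym (gapK wH) (segK wH) ay.
have cs0 : connect_sym (rsum (off (@gap L P) x (@vrel L P)) (off (@gap L H) y (@vrel L H))).
  by apply: sym_connect_sym => -[z|z] [t|t] /=.
apply: connect_Rjoins => //.
- exact: vrel_csym.
- move=> [z|z] [t|t] //= h; apply: connect1; move: h; rewrite /off /vrel.
    case/orP=> [/eqP->|/andP[zx /orP[/eqP->|/eqP->]]]; try by rewrite /= eqxx.
    by rewrite (@sseg_out (inl z)) // eqxx orbT.
  case/orP=> [/eqP->|/andP[zx /orP[/eqP->|/eqP->]]]; try by rewrite /= eqxx.
  by rewrite (@sseg_out (inr z)) // eqxx orbT.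
- move=> pq /gseg_links[<- _]; apply: connect1.
  by rewrite /vrel eqxx orbT.
have eJ := Rjoins_equiv slinks (connect_equiv cs0); have [_ sJ _] := eJ.
move=> z t /orP[/eqP->|/eqP->].
  by apply/sub_Rjoins/connect1; case: z => z; rewrite /= /off eqxx.
have [|zx] := boolP ((z \in ends X1) || (z \in ends X2)); last first.
  apply/sub_Rjoins/connect1; move: (zx); rewrite negb_or => /andP[z1 z2].
  rewrite gseg_out //; move: zx; rewrite cross_memE.
  by case: (z) => z' /= z'x; rewrite /off z'x /vrel eqxx !orbT.
move=> /orP/slinks_ends[[p q] pql zpq].
have [e1 e2] : @seg L S p = q /\ @seg L S q = p := gseg_links pql.
have {}zpq : z = p \/ z = q := zpq.
have pqJ := Rjoins_mem (connect_equiv cs0) pql.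
by case: zpq => ->; rewrite ?e1 ?e2 // sJ.
Qed.

(** A point away from the glued ends lies on an arrow of the sum exactly when it lies on one in its
    summand, so both cases of [brel] carry over. *)
Lemma brel_spres_out (z : pt S) :
    match z with inl t => t \notin ends x | inr t => t \notin ends y end ->
  @brel L S z =1 rsum (@brel L P) (@brel L H) z.
Proof.
have wS := spres_wf.
case: z => z zx u.
  have [fz|[l [t [lt zt]]]] := @freeVedge L P z.
    have fz' : @free_pt L S (inl z).
      move=> l t /fnd_spres[] [t' [_ lt' ->]]; last by rewrite ends_map_edge; apply/mapP=> -[].
      by rewrite mem_map_edge //; apply: fz lt'.
    rewrite brel_free // sseg_out //.
    by case: u => u; rewrite /= ?brel_free // ?(inj_eq inl_inj).
  have lf : l != f.
    apply: contraNneq zx => lf; move: lt; rewrite lf fx0 => -[e0].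
    by rewrite (coupled_mem cx) e0.
  rewrite (brel_edge wS _ (fnd_spresl lf lt)) ?mem_map_edge //.
  case: u => u /=; first by rewrite (brel_edge wP _ lt zt) bcurves_map // (inj_eq inl_inj).
  by case: (t) => [[? ?] [? ?]]; rewrite !inE !xpair_eqE /= ?andbF.
have [fz|[l [t [lt zt]]]] := @freeVedge L H z.
  have fz' : @free_pt L S (inr z).
    move=> l t /fnd_spres[] [t' [_ lt' ->]]; first by rewrite ends_map_edge; apply/mapP=> -[].
    by rewrite mem_map_edge //; apply: fz lt'.
  rewrite brel_free // sseg_out //.
  by case: u => u; rewrite /= ?brel_free // ?(inj_eq inr_inj).
have lf : l != e.
  apply: contraNneq zx => lf; move: lt; rewrite lf ey0 => -[e0].
  by rewrite (coupled_mem cy) e0.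
rewrite (brel_edge wS _ (fnd_spresr lf lt)) ?mem_map_edge //.
case: u => u /=; last by rewrite (brel_edge wH _ lt zt) bcurves_map // (inj_eq inr_inj).
by case: (t) => [[? ?] [? ?]]; rewrite !inE !xpair_eqE /= ?andbF.
Qed.

(** The edges [f] and [e] are gone, so their ends lie on no arrow and [brel] follows [seg] there,
    that is, the identifications. Vertices and boundary components thus share the list [slinks];
    only the strands differ. *)
Lemma brel_spres : connect (@brel L S) =2
  Rjoins (connect (rsum (off (@gap L P) x (@brel L P)) (off (@gap L H) y (@brel L H))))
    slinks.
Proof.
have wS := spres_wf.
have sP := boff_sym wP fx0 cx; have sH := boff_sym wH ey0 cy.
have cs0 : connect_sym (rsum (off (@gap L P) x (@brel L P)) (off (@gap L H) y (@brel L H))).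
  by apply: sym_connect_sym => -[z|z] [t|t] /=.
have fr (z : pt S) : (z \in ends X1) || (z \in ends X2) -> free_pt z.
  rewrite cross_memE => zx l t /fnd_spres[] [t' [ll lt' ->]]; rewrite ends_map_edge; apply/mapP=> -[u ut zE].
    by move: zx; rewrite zE; apply/negP; apply: edge_out lt' _ ut.
  by move: zx; rewrite zE; apply/negP; apply: edge_outr lt' _ ut.
apply: connect_Rjoins => //.
- exact: brel_csym.
- move=> [z|z] [t|t] //= /orP[/eqP->|/andP[zx zt]]; apply: connect1;
    by [rewrite /brel /= eqxx | rewrite brel_spres_out].
- move=> pq pql; have [<- _] := gseg_links pql; apply: connect1.
  rewrite brel_free ?eqxx ?orbT //; apply: fr.
  by move: pql; rewrite mem_cat => /orP[]/mem_links_ends[-> _]; rewrite ?orbT.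
have eJ := Rjoins_equiv slinks (connect_equiv cs0); have [_ sJ _] := eJ.
move=> z t zt.
have [zx|zx] := boolP ((z \in ends X1) || (z \in ends X2)); last first.
  apply/sub_Rjoins/connect1; rewrite cross_memE in zx.
  rewrite brel_spres_out in zt; last by case: z zx.
  by case: z t zx zt => z [t|t] //= z' t'; rewrite /off z' t' orbT.
move: zt; rewrite brel_free; last exact: fr.
move=> /orP[/eqP->|/eqP->].
  by apply/sub_Rjoins/connect1; case: (z) => u; rewrite /= /off eqxx.
move: zx => /orP/slinks_ends[[p q] pql zpq].
have [e1 e2] : @seg L S p = q /\ @seg L S q = p := gseg_links pql.
have {}zpq : z = p \/ z = q := zpq.
have pqJ := Rjoins_mem (connect_equiv cs0) pql.
by case: zpq => ->; rewrite ?e1 ?e2 // sJ.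
Qed.

End SumPres.

(** * The packaged 2-sum *)

Lemma Rjoins_eqi (T : finType) (R : rel T) s s' : equivb R -> s =i s' ->
  Rjoins R s =2 Rjoins R s'.
Proof.
move=> eR ss'.
suff sub t t' : t =i t' -> subrel (Rjoins R t) (Rjoins R t').
  by move=> x y; apply/idP/idP; apply: sub => // z; rewrite ss'.
move=> tt'; apply: Rjoins_min; [exact: Rjoins_equiv|exact: sub_Rjoins|].
by move=> [p q]; rewrite tt' => /Rjoins_mem; apply.
Qed.

Definition map_pair (T T' : Type) (h : T -> T') (pq : T * T) := (h pq.1, h pq.2).

Section RsumJoin.
Variables T T' : finType.
Implicit Types (R : rel T).

Lemma rsum_Rjoinl R (R' : rel T') p q :
  rsum (Rjoin R p q) R' =2 Rjoin (rsum R R') (inl p) (inl q).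
Proof. by case=> x [y|y]; rewrite /Rjoin /= ?andbF ?orbF. Qed.

Lemma rsum_Rjoinr R (R' : rel T') p q :
  rsum R (Rjoin R' p q) =2 Rjoin (rsum R R') (inr p) (inr q).
Proof. by case=> x [y|y]; rewrite /Rjoin /= ?andbF ?orbF. Qed.

Lemma rsum_Rjoins R (R' : rel T') s s' : rsum (Rjoins R s) (Rjoins R' s') =2
  Rjoins (rsum R R') (map (map_pair inl) s ++ map (map_pair inr) s').
Proof.
elim: s R => [|pq s IH] R /=.
  elim: s' R' => [|pq s' IH] R' //= x y; rewrite IH.
  by apply: Rjoins_eq => ? ?; rewrite rsum_Rjoinr.
by move=> x y; rewrite IH; apply: Rjoins_eq => ? ?; rewrite rsum_Rjoinl.
Qed.

Lemma rsum_Roptl b R (R' : rel T') p q :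
  rsum (Ropt b R p q) R' =2 Ropt b (rsum R R') (inl p) (inl q).
Proof. by case: b => //; apply: rsum_Rjoinl. Qed.

Lemma rsum_Roptr b R (R' : rel T') p q :
  rsum R (Ropt b R' p q) =2 Ropt b (rsum R R') (inr p) (inr q).
Proof. by case: b => //; apply: rsum_Rjoinr. Qed.

Let il : injective (@inl T T'). Proof. by move=> ? ? []. Qed.
Let ir : injective (@inr T T'). Proof. by move=> ? ? []. Qed.

Lemma cls_rsuml (r : rel T) (r' : rel T') x :
  cls (rsum r r') (inl x) = lift_set inl (cls r x).
Proof.
apply/setP=> -[y|y]; rewrite inE connect_rsum /= ?(mem_imset _ _ il) ?inE //.
by apply/esym/imsetP=> -[].
Qed.

Lemma cls_rsumr (r : rel T) (r' : rel T') x :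
  cls (rsum r r') (inr x) = lift_set inr (cls r' x).
Proof.
apply/setP=> -[y|y]; rewrite inE connect_rsum /= ?(mem_imset _ _ ir) ?inE //.
by apply/esym/imsetP=> -[].
Qed.

Lemma rsum_csym (r : rel T) (r' : rel T') : connect_sym r -> connect_sym r' ->
  connect_sym (rsum r r').
Proof. by move=> cs cs' [x|x] [y|y]; rewrite !connect_rsum /=. Qed.

Lemma union_blocks (r : rel T) (r' : rel T') V V' :
    connect_sym r -> connect_sym r' ->
    partition V (circ r) -> partition V' (circ r') ->
  let VV := [set lift_set (lift_set inl) B | B in V]
            :|: [set lift_set (lift_set inr) B | B in V'] in
  partition VV (circ (rsum r r')) /\
  Rof (rsum r r') VV =2 rsum (Rof r V) (Rof r' V').
Proof.
move=> cs cs' pV pV' VV.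
have bl x : block (rsum r r') (rsum (Rof r V) (Rof r' V')) (inl x) =
    lift_set (lift_set inl) (block r (Rof r V) x).
  apply/setP=> X; apply/imsetP/imsetP => [[[y|y] // xy ->]|[_ /imsetP[y xy ->] ->]].
    by exists (cls r y); [apply: imset_f | rewrite cls_rsuml].
  by exists (inl y) => //; rewrite cls_rsuml.
have br x : block (rsum r r') (rsum (Rof r V) (Rof r' V')) (inr x) =
    lift_set (lift_set inr) (block r' (Rof r' V') x).
  apply/setP=> X; apply/imsetP/imsetP => [[[y|y] // xy ->]|[_ /imsetP[y xy ->] ->]].
    by exists (cls r' y); [apply: imset_f | rewrite cls_rsumr].
  by exists (inr y) => //; rewrite cls_rsumr.
apply: blockP.
- exact: rsum_csym.
- by apply: rsum_equiv; apply: Rof_equiv.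
- move=> x y; rewrite connect_rsum; case: x y => x [y|y] //=; exact: Rof_connect.
rewrite /VV {1}(partition_block pV) {1}(partition_block pV').
apply/setP=> B; apply/setUP/imsetP.
  case=> /imsetP[_ /imsetP[x _ ->] ->].
    by exists (inl x); rewrite ?bl.
  by exists (inr x); rewrite ?br.
case=> [[x|x] _ ->]; rewrite ?bl ?br; [left|right]; do 2!apply: imset_f => //.
Qed.

End RsumJoin.

Arguments RV {L} P _ _.
Arguments RB {L} P _ _.

Section Sum2.
Variables (L : choiceType) (f e : L) (P H : packaged L) (phi : {perm bool}).
Variables (x : edge (pt P)) (y0 : edge (pt H)).
Hypotheses (wP : packaged_wf P) (wH : packaged_wf H).
Hypotheses (fx : (edges P).[? f]%fmap = Some x) (ey0 : (edges H).[? e]%fmap = Some y0).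
Hypothesis dPH : [disjoint E(P) & E(H)]%fset.

Let y : edge (pt H) := (nth_arrow y0 (phi false), nth_arrow y0 (phi true)).

(** [V] and [B] stay abstract because a partition is determined by its relation on points. One join
    for each pair of vertices is enough, as both ends of an arrow lie on one vertex; for boundary
    components [p1] and [p2] represent [a] and [b]. *)
Definition is_sum2 (Q : packaged L) := exists V B,
  [/\ Q = @Packaged L (spres f e x y) V B,
      packaged_wf (@Packaged L (spres f e x y) V B),
      Rof (@vrel L (spres f e x y)) V =2
        Rjoins (rsum (RV P) (RV H)) [:: (inl x.1.1, inr y.1.1); (inl x.2.1, inr y.2.1)] &
      Rof (@brel L (spres f e x y)) B =2
        Rjoins (rsum (RB P) (RB H)) [:: (inl x.1.1, inr y.1.1); (inl x.1.2, inr y.1.2)]].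

Lemma sum2P : is_sum2 (sum2 P H f e phi).
Proof.
have cx : coupled x x by left.
have cy : coupled y0 y := coupled_perm y0 phi.
have [wA wV wB] := wP; have [wA' wV' wB'] := wH.
have wS := spres_wf wA wA' fx cx ey0 cy.
set S := spres f e x y in wS.
pose VV := [set lift_set (lift_set (@inl (pt P) (pt H))) B | B in vpart P]
            :|: [set lift_set (lift_set (@inr (pt P) (pt H))) B | B in vpart H].
pose BB := [set lift_set (lift_set (@inl (pt P) (pt H))) B | B in bpart P]
            :|: [set lift_set (lift_set (@inr (pt P) (pt H))) B | B in bpart H].
pose rv := rsum (@vrel L P) (@vrel L H); pose rb := rsum (@brel L P) (@brel L H).
pose V := sum_blocks VV (cls rv (inl x.1.1)) (cls rv (inl x.2.1))
    (cls rv (inr y.1.1)) (cls rv (inr y.2.1))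
    [set cls (@vrel L S) (inl x.1.1); cls (@vrel L S) (inl x.1.2)]
    [set cls (@vrel L S) (inl x.2.1); cls (@vrel L S) (inl x.2.2)].
pose B := sum_blocks BB (cls rb (inl x.1.1)) (cls rb (inl x.1.2))
    (cls rb (inr y.1.1)) (cls rb (inr y.1.2))
    [set cls (@brel L S) (inl x.1.1); cls (@brel L S) (inl x.2.2)]
    [set cls (@brel L S) (inl x.1.2); cls (@brel L S) (inl x.2.1)].
have sE : sum2 P H f e phi = @Packaged L S V B.
  rewrite /V /B /rv /rb !cls_rsuml !cls_rsumr /S /y /sum2 /asum2 fx ey0.
  case: (x) => [[p1 p2] [p3 p4]].
  by case: (nth_arrow y0 (phi false)) (nth_arrow y0 (phi true)) => q1 q2 [q3 q4].
have csP := vrel_csym wA; have csH := vrel_csym wA'.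
have csbP := brel_csym wA; have csbH := brel_csym wA'.
have [pVV RVV] := union_blocks csP csH wV wV'.
have [pBB RBB] := union_blocks csbP csbH wB wB'.
have ux := coupled_uniq wA fx cx; have uy := coupled_uniq wA' ey0 cy.
have ax := coupled_arcs wA fx cx; have ay := coupled_arcs wA' ey0 cy.
have eKv : equivb (connect (rsum (off (@gap L P) x (@vrel L P)) (off (@gap L H) y (@vrel L H)))).
  apply/connect_equiv/rsum_csym; apply: sym_connect_sym.
    exact: voff_sym (gapK wA) (segK wA) ax.
  exact: voff_sym (gapK wA') (segK wA') ay.
have eKb : equivb (connect (rsum (off (@gap L P) x (@brel L P)) (off (@gap L H) y (@brel L H)))).
  apply/connect_equiv/rsum_csym; apply: sym_connect_sym.
    exact (boff_sym wA fx cx).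
  exact (boff_sym wA' ey0 cy).
have [pV rV] : partition V (circ (@vrel L S)) /\ Rof (@vrel L S) V =2
    Rjoins (Rof rv VV) [:: (inl x.1.1, inr y.1.1); (inl x.2.1, inr y.2.1)].
  apply: (sum_blocksP (q2 := inr y.1.2) (q4 := inr y.2.2)
    (rsum_csym csP csH) (vrel_csym wS) eKv) => //.
  - move=> s t; rewrite connect_rsum.
    rewrite (rsum_eq (vr_links 0 ux ax (gapK wA) (segK wA) (seg_neq wA))
      (vr_links 0 uy ay (gapK wA') (segK wA') (seg_neq wA'))) rsum_Rjoins.
    by apply: Rjoins_eq => ? ?; rewrite connect_rsum.
  - exact: vrel_spres wA wA' fx cx ey0 cy.
have [pB rB] : partition B (circ (@brel L S)) /\ Rof (@brel L S) B =2
    Rjoins (Rof rb BB) [:: (inl x.1.1, inr y.1.1); (inl x.1.2, inr y.1.2)].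
  (* Along the boundary [p1] is paired with [p4] and [p2] with [p3], so the ends enter in the order
     [p1], [p4], [p2], [p3]; the list of identifications is permuted accordingly below. *)
  apply: (sum_blocksP (q2 := inr y.2.2) (q4 := inr y.2.1)
    (rsum_csym csbP csbH) (brel_csym wS) eKb) => //.
  - move=> s t; rewrite connect_rsum.
    rewrite (rsum_eq (brel_links wA fx cx) (brel_links wA' ey0 cy)) rsum_Rjoins.
    by apply: Rjoins_eq => ? ?; rewrite connect_rsum.
  - move=> s t; rewrite (brel_spres wA wA' fx cx ey0 cy dPH).
    apply: Rjoins_eqi => // pq; rewrite !inE.
    do 4!case: (pq == _) => //.
exists V, B; split=> //.
- by move=> s t; rewrite rV; apply: Rjoins_eq.
- by move=> s t; rewrite rB; apply: Rjoins_eq.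
Qed.

End Sum2.

(** * 2-sums commute with minors *)

Lemma Rjoins_Ropt (T : finType) b (R : rel T) p q s : equivb R ->
  Rjoins (Ropt b R p q) s =2 Ropt b (Rjoins R s) p q.
Proof.
elim: s R => //= pq s IH R eR x y; rewrite -IH; last exact: Rjoin_equiv.
apply: Rjoins_eq => ? ?; exact: (@Ropt_comm _ false b R p q pq.1 pq.2).
Qed.

Section SumSeg.
Variables (T T' : eqType).

Lemma sseg_marcl k z (a : T -> T) (a' : T' -> T') :
  sseg (marc k z a) a' = marc k (map_edge inl z) (sseg a a').
Proof.
apply: functional_extensionality => u.
have il : injective (@inl T T') by move=> ? ? [].
case: z => [[p1 p2] [q1 q2]]; case: k => [|[|k]] //=; rewrite /relink /map_edge /=.
  by case: u => u //; rewrite /= !(inj_eq il); do 4!case: eqP => // _.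
by case: u => u //; rewrite /= !(inj_eq il); do 4!case: eqP => // _.
Qed.

Lemma sseg_marcr k z (a : T -> T) (a' : T' -> T') :
  sseg a (marc k z a') = marc k (map_edge inr z) (sseg a a').
Proof.
apply: functional_extensionality => u.
have ir : injective (@inr T T') by move=> ? ? [].
case: z => [[p1 p2] [q1 q2]]; case: k => [|[|k]] //=; rewrite /relink /map_edge /=.
  by case: u => u //; rewrite /= !(inj_eq ir); do 4!case: eqP => // _.
by case: u => u //; rewrite /= !(inj_eq ir); do 4!case: eqP => // _.
Qed.

(** Relinkings at disjoint sets of points commute. *)
Lemma gseg_marcl k z (x : edge T) (y : edge T') (a : T -> T) (a' : T' -> T') :
    {in ends z, forall t, t \notin ends x} ->
  gseg x y (marc k z a) a' = marc k (map_edge inl z) (gseg x y a a').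
Proof.
move=> zx; rewrite /gseg sseg_marcl.
have dis i : {in ends (cross i x y), forall t, t \notin ends (map_edge inl z)}.
  move=> t tc; rewrite ends_map_edge; apply/mapP=> -[u uz tu].
  have := zx _ uz; apply/negP; rewrite negbK.
  have ij : injective (@inl T T') by move=> ? ? [].
  by move: tc; rewrite tu /ends !inE /= !(inj_eq ij); case: (i); rewrite /= ?orbF => /orP[] ->;
    rewrite ?orbT.
by rewrite (marc_swap _ _ _ (dis false)) (marc_swap _ _ _ (dis true)).
Qed.

Lemma gseg_marcr k z (x : edge T) (y : edge T') (a : T -> T) (a' : T' -> T') :
    {in ends z, forall t, t \notin ends y} ->
  gseg x y a (marc k z a') = marc k (map_edge inr z) (gseg x y a a').
Proof.
move=> zx; rewrite /gseg sseg_marcr.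
have dis i : {in ends (cross i x y), forall t, t \notin ends (map_edge inr z)}.
  move=> t tc; rewrite ends_map_edge; apply/mapP=> -[u uz tu].
  have := zx _ uz; apply/negP; rewrite negbK.
  have ij : injective (@inr T T') by move=> ? ? [].
  by move: tc; rewrite tu /ends !inE /= !(inj_eq ij); case: (i); rewrite /= ?orbF => /orP[] ->;
    rewrite ?orbT.
by rewrite (marc_swap _ _ _ (dis false)) (marc_swap _ _ _ (dis true)).
Qed.

End SumSeg.

Section EdgesRem.
Variables (L : choiceType) (T T' : Type) (h : T -> T').

Lemma map_edges_rem (m : {fmap L -> edge T}) g :
  map_edges h m.[~ g]%fmap = (map_edges h m).[~ g]%fmap.
Proof.
by apply/fmapP=> l; rewrite fnd_map_edges !fnd_rem1 fnd_map_edges; case: (l != g).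
Qed.

Lemma rem_comm (m : {fmap L -> edge T}) g g' :
  (m.[~ g].[~ g'] = m.[~ g'].[~ g])%fmap.
Proof. by apply/fmapP=> l; rewrite !fnd_rem1; case: (l != g); case: (l != g'). Qed.

Lemma catf_remr (m m' : {fmap L -> edge T}) g : g \notin domf m ->
  catf m m'.[~ g]%fmap = (catf m m').[~ g]%fmap.
Proof.
move=> gm; apply/fmapP=> l; rewrite fnd_rem1 !fnd_cat fnd_rem1 mem_remf1.
have [->|_] //= := eqVneq l g; by rewrite not_fnd.
Qed.

End EdgesRem.

Section Commute.
Variables (L : choiceType) (f e : L) (P H : packaged L) (phi : {perm bool}).
Hypotheses (wP : packaged_wf P) (wH : packaged_wf H).
Hypotheses (fP : f \in E(P)) (eH : e \in E(H)).
Hypothesis dPH : [disjoint E(P) & E(H)]%fset.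

Lemma sum2_wf : packaged_wf (sum2 P H f e phi).
Proof. by have [V [B [-> //]]] := sum2P phi wP wH (in_fnd fP) (in_fnd eH) dPH. Qed.

Lemma sum2_edges : E(sum2 P H f e phi) = ((E(P) `\ f) `|` (E(H) `\ e))%fset.
Proof.
have [V [B [-> _ _ _]]] := sum2P phi wP wH (in_fnd fP) (in_fnd eH) dPH.
exact: spres_edges.
Qed.

(** Minors keep the points and a 2-sum takes their disjoint union, so both sides live on one point
    set and the equality is literal. The partitions agree because joins commute, with [Ropt]
    covering the minors that join nothing. *)
Lemma sum2_minorl g i : g \in E(P) -> g != f ->
  sum2 (minor g P i) H f e phi = minor g (sum2 P H f e phi) i.
Proof.
move=> gP gf; have fx := in_fnd fP; have gz := in_fnd gP; have ey := in_fnd eH.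
move: ((edges P).[fP])%fmap ((edges P).[gP])%fmap ((edges H).[eH])%fmap fx gz ey.
move=> x z y0 fx gz ey.
have wA := pres_wf wP.
have [V1 [B1 [-> w1 v1 b1]]] := minorP i wP gz.
have [V2 [B2 [-> w2 v2 b2]]] := sum2P phi wP wH fx ey dPH.
have fx1 : (edges (@newp L (kof i) g P z)).[? f]%fmap = Some x.
  by rewrite /= fnd_rem1 eq_sym gf.
have gz2 := fnd_spresl e x (nth_arrow y0 (phi false), nth_arrow y0 (phi true)) dPH gf gz.
have d1 : [disjoint E(@newp L (kof i) g P z) & E(H)]%fset.
  apply/fdisjointP=> l; rewrite mem_remf1 => /andP[_]; exact: (fdisjointP dPH).
have [V3 [B3 [-> w3 v3 b3]]] := sum2P phi w1 wH fx1 ey d1.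
have [V4 [B4 [-> w4 v4 b4]]] := minorP i w2 gz2.
have eVs : equivb (rsum (RV P) (RV H)) by apply: rsum_equiv; exact: RV_equiv.
have eBs : equivb (rsum (RB P) (RB H)) by apply: rsum_equiv; exact: RB_equiv.
apply: packaged_ext w3 w4 _ _.
- apply: gseg_marcl => t tz; apply/negP=> tx.
  by move: gf; rewrite (wf_disj wA gz fx tz tx) eqxx.
- rewrite rem_comm (map_edges_rem _ _ g) catf_rem1l ifN //.
  change (g \notin domf (edges H).[~ e]%fmap); rewrite mem_remf1.
  by rewrite (negbTE (fdisjointP dPH g gP)) andbF.
- move=> s t; rewrite /RV v3 v4 (Ropt_eq _ _ _ v2) -(Rjoins_Ropt _ _ _ _ eVs).
  by apply: Rjoins_eq => ? ?; rewrite -rsum_Roptl; apply: rsum_eq.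
- move=> s t; rewrite /RB b3 b4 (Ropt_eq _ _ _ b2) -(Rjoins_Ropt _ _ _ _ eBs).
  by apply: Rjoins_eq => ? ?; rewrite -rsum_Roptl; apply: rsum_eq.
Qed.

Lemma sum2_minorr g i : g \in E(H) -> g != e ->
  sum2 P (minor g H i) f e phi = minor g (sum2 P H f e phi) i.
Proof.
move=> gH ge; have fx := in_fnd fP; have gz := in_fnd gH; have ey := in_fnd eH.
move: ((edges P).[fP])%fmap ((edges H).[gH])%fmap ((edges H).[eH])%fmap fx gz ey.
move=> x z y0 fx gz ey.
have wA := pres_wf wH.
have [V1 [B1 [-> w1 v1 b1]]] := minorP i wH gz.
have [V2 [B2 [-> w2 v2 b2]]] := sum2P phi wP wH fx ey dPH.
have ey1 : (edges (@newp L (kof i) g H z)).[? e]%fmap = Some y0.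
  by rewrite /= fnd_rem1 eq_sym ge.
have gz2 := fnd_spresr f x (nth_arrow y0 (phi false), nth_arrow y0 (phi true)) ge gz.
have d1 : [disjoint E(P) & E(@newp L (kof i) g H z)]%fset.
  apply/fdisjointP=> l lP; rewrite mem_remf1 negb_and (fdisjointP dPH l lP).
  exact: orbT.
have [V3 [B3 [-> w3 v3 b3]]] := sum2P phi wP w1 fx ey1 d1.
have [V4 [B4 [-> w4 v4 b4]]] := minorP i w2 gz2.
have eVs : equivb (rsum (RV P) (RV H)) by apply: rsum_equiv; exact: RV_equiv.
have eBs : equivb (rsum (RB P) (RB H)) by apply: rsum_equiv; exact: RB_equiv.
apply: packaged_ext w3 w4 _ _.
- apply: gseg_marcr => t tz; rewrite (coupled_mem (coupled_perm y0 phi)).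
  apply/negP=> tx.
  by move: ge; rewrite (wf_disj wA gz ey tz tx) eqxx.
- rewrite rem_comm (map_edges_rem _ _ g) catf_remr //.
  change (g \notin domf (edges P).[~ f]%fmap); rewrite mem_remf1 negb_and.
  by rewrite orbC; apply/orP; left; apply: contraL gH; apply: (fdisjointP dPH).
- move=> s t; rewrite /RV v3 v4 (Ropt_eq _ _ _ v2) -(Rjoins_Ropt _ _ _ _ eVs).
  by apply: Rjoins_eq => ? ?; rewrite -rsum_Roptr; apply: rsum_eq.
- move=> s t; rewrite /RB b3 b4 (Ropt_eq _ _ _ b2) -(Rjoins_Ropt _ _ _ _ eBs).
  by apply: Rjoins_eq => ? ?; rewrite -rsum_Roptr; apply: rsum_eq.
Qed.

End Commute.

(** * Pairing of the four ends of an edge *)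

Section Pairing.
Variables (T : finType) (g s : T -> T).
Hypotheses (gK : involutive g) (sK : involutive s) (gn : forall z, g z != z).

Let h z := s (g z).
Let h_inj : injective h.
Proof. exact: inj_comp (inv_inj sK) (inv_inj gK). Qed.

Let iter_s n z : iter n h (s (iter n h z)) = s z.
Proof.
elim: n z => // n IH z; rewrite iterSr [iter n.+1 h z]iterS.
have -> : h (s (h (iter n h z))) = s (iter n h z) by rewrite /h sK gK.
exact: IH.
Qed.

Let iter_g n z : iter n.+1 h (g (iter n h z)) = s z.
Proof. by rewrite iterSr /h gK iter_s. Qed.

Let fconn_s z : s z = z -> fconnect h z =1 connect (vr g s) z.
Proof.
move=> szz y; apply/idP/idP.
  move=> /iter_findex <-; elim: (findex _ _ _) => // n IH.
  apply: connect_trans IH _; rewrite iterS; set u := iter n h z.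
  apply: (@connect_trans _ _ (g u)); apply: connect1; first by rewrite /vr eqxx.
  by rewrite /vr /h eqxx orbT.
case/connectP=> c pc ->; elim/last_ind: c pc => // c t IH.
rewrite rcons_path last_rcons => /andP[/IH zc]; rewrite -(iter_findex zc).
set n := findex _ _ _; rewrite (fconnect_sym h_inj).
case/orP=> /eqP->.
  by have := fconnect_iter h n.+1 (g (iter n h z)); rewrite iter_g szz.
by have := fconnect_iter h n (s (iter n h z)); rewrite iter_s szz.
Qed.

(* The alternating walk from a fixed point [z] of [s] is a cycle of [h = s o g];
   conjugation by [s] inverts [h], so this cycle meets the fixed points of [s]
   exactly at [z] and at its antipode. *)
Lemma alternating_path z : s z = z -> exists z',
  [/\ s z' = z', z' != z, connect (vr g s) z z' &
      forall y, s y = y -> connect (vr g s) z y -> y = z \/ y = z'].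
Proof.
move=> sz; have conn := fconn_s sz.
have ih_inj n : injective (iter n h) by elim: n => // n IH u v /= /h_inj /IH.
have m0 := order_gt0 h z; have hm := iter_order h_inj z.
set m := order h z in m0 hm.
have iter0 i : i < m.*2 -> iter i h z = z -> i = 0 \/ i = m.
  move=> im hi; have [lt|ge] := ltnP i m.
    by left; rewrite -(findex_iter lt) hi findex0.
  have lt : i - m < m by lia.
  right; have : iter (i - m) h z = z.
    by rewrite -{1}hm -iterD subnK.
  by move=> hi'; have := findex_iter lt; rewrite hi' findex0 => /eqP; lia.
(* If [s] fixes the [i]-th iterate, [iter_s] shows that [h] iterated [i.*2] times returns to [z], so
   [i.*2] is 0 or [m]. *)
have fixE i : i < m -> s (iter i h z) = iter i h z -> i = 0 \/ i.*2 = m.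
  move=> im si; have := iter_s i z; rewrite si sz -iterD addnn => /iter0.
  case; [lia|lia|by right].
(* For odd [m], [iter_g] at [m./2] would make the middle iterate a fixed point of [g]. *)
have m_even : ~~ odd m.
  apply/negP=> om; have := iter_g m./2 z; rewrite sz -{2}hm.
  have m2 : m = (m./2.+1 + m./2)%N by have := odd_double_half m; rewrite om; lia.
  rewrite [in RHS]m2 iterD => /ih_inj e.
  by have := gn (iter m./2 h z); rewrite e eqxx.
have mE : m = (m./2 + m./2)%N by rewrite addnn even_halfK.
exists (iter m./2 h z); split.
- apply: (ih_inj m./2); rewrite iter_s sz -iterD -mE; exact/esym.
- apply/eqP=> e; have /findex_iter : m./2 < order h z by rewrite -/m; lia.
  by rewrite e findex0; lia.
- by rewrite -conn fconnect_iter.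
move=> y sy; rewrite -conn => zy; have im := findex_max zy.
have := fixE _ im; rewrite iter_findex // sy => /(_ erefl)[e|e].
  by left; have := iter_findex zy; rewrite e.
by right; rewrite -e doubleK iter_findex.
Qed.

End Pairing.

(** The three ways to pair four points, numbered as in [links]. The negative relations are recorded
    too, since a join counts only when it merges two classes. *)
Definition paired (T : finType) k (K : rel T) (x : edge T) :=
  (K x.1.1 x.1.2, K x.2.1 x.2.2, K x.1.1 x.2.2, K x.1.2 x.2.1,
   K x.1.1 x.2.1, K x.1.2 x.2.2) =
  (k == 0, k == 0, k == 1, k == 1, k == 2, k == 2)%N.

Lemma off_paired (T : finType) (g a : T -> T) x :
    involutive g -> (forall z, g z != z) -> involutive a -> (forall z, a z != z) ->
    uniq (ends x) -> arcs a x ->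
  exists2 k, k < 3 & paired k (connect (off g x (vr g a))) x.
Proof.
(* Removing the arcs at the ends of [x] is modelled by making these ends the fixed points of the
   involution [s]; [alternating_path] then gives each end exactly one partner. *)
move=> gK gn aK an ux ax; pose s z := if z \in ends x then z else a z.
have sE z : (s z == z) = (z \in ends x).
  by rewrite /s; case: ifP; rewrite ?eqxx ?(negbTE (an z)).
have ends_a z : (a z \in ends x) = (z \in ends x).
  apply/idP/idP => [h|]; last exact: arcs_ends ax aK.
  by rewrite -[z]aK; apply: (arcs_ends ax aK).
have sK : involutive s.
  move=> z; rewrite /s; have [zx|/negbTE zx] := boolP (z \in ends x); first by rewrite zx.
  by rewrite ends_a zx aK.
set r := off g x (vr g a).
have cs := sym_connect_sym (voff_sym gK aK ax : symmetric r).
have eK := connect_equiv cs; have [rK yK tK] := eK; set K := connect r in eK rK yK tK *.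
have KE : connect (vr g s) =2 K.
  move=> z y; apply/idP/idP; apply: connect_min => //.
  - move=> {}z {}y /orP[/eqP->|/eqP->].
      by apply: connect1; rewrite /r /off eqxx.
    rewrite /s; case: ifP => zx //; apply: connect1.
    by rewrite /r /off zx /vr eqxx !orbT.
  - exact: connect_equiv (sym_connect_sym (vr_sym gK sK)).
  - move=> {}z {}y /orP[/eqP->|/andP[zx /orP[/eqP->|/eqP->]]]; apply: connect1.
    + by rewrite /vr eqxx.
    + by rewrite /vr eqxx.
    + by rewrite /vr /s (negbTE zx) eqxx orbT.
have alt z : z \in ends x -> exists z', [/\ z' \in ends x, z' != z, K z z' &
    forall y, y \in ends x -> K z y -> y = z \/ y = z'].
  rewrite -sE => /eqP/(alternating_path gK sK gn)[z' [/eqP]].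
  rewrite sE KE => z'x ne zz' un; exists z'; split=> // y.
  by rewrite -sE => /eqP sy; rewrite -KE; apply: un.
move: ux alt; rewrite /paired /ends; case: (x) => [[p1 p2] [q1 q2]] /=.
rewrite !inE !negb_or => /and4P[/and3P[n1 n2 n3] /andP[n4 n5] n6 _] alt.
have nE := (negbTE n1, negbTE n2, negbTE n3, negbTE n4, negbTE n5, negbTE n6).
have ns (S : eqType) (u v : S) : u != v -> (v == u) = false by rewrite eq_sym => /negbTE.
have nE' := (ns _ _ _ n1, ns _ _ _ n2, ns _ _ _ n3, ns _ _ _ n4, ns _ _ _ n5, ns _ _ _ n6).
have [|z1 [+ + h1 u1]] := alt p1; first by rewrite inE eqxx.
have [|z2 [+ + h2 u2]] := alt p2; first by rewrite !inE eqxx orbT.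
have [|z3 [+ + h3 u3]] := alt q1; first by rewrite !inE eqxx !orbT.
have nK y z t : y \in [:: p1; p2; q1; q2] ->
    (forall y, y \in [:: p1; p2; q1; q2] -> K z y -> y = z \/ y = t) ->
    y != z -> y != t -> K z y = false.
  by move=> yx un yz yt; apply/negP=> /(un _ yx)[] e; rewrite e eqxx in yz yt.
have i1 : p1 \in [:: p1; p2; q1; q2] by rewrite !inE eqxx.
have i2 : p2 \in [:: p1; p2; q1; q2] by rewrite !inE eqxx orbT.
have i3 : q1 \in [:: p1; p2; q1; q2] by rewrite !inE eqxx !orbT.
have i4 : q2 \in [:: p1; p2; q1; q2] by rewrite !inE eqxx !orbT.
have F b c d : K b c -> K b d = false -> K c d = false.
  by move=> bc bd; apply/negP=> cd; rewrite (tK _ _ _ bc cd) in bd.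
have sF b c : K b c = false -> K c b = false by rewrite yK.
(* The partner of [p1] determines the pairing: the two remaining ends can only be partners of each
   other. *)
rewrite !inE => z3E z3n z2E z2n /or4P[] /eqP z1E; rewrite {}z1E ?eqxx // in h1 u1 * => _.
- exists 0 => //; have f3 := nK _ _ _ i3 u1; have f4 := nK _ _ _ i4 u1.
  rewrite !(nE, nE') /= in f3 f4.
  have f23 := F _ _ _ h1 (f3 isT isT); have f24 := F _ _ _ h1 (f4 isT isT).
  rewrite h1 f23 f24 f3 // f4 //.
  have -> // : K q1 q2.
  case/or4P: z3E h3 z3n => /eqP-> h3; rewrite ?eqxx //.
    by rewrite yK f3 in h3.
  by rewrite yK f23 in h3.
- exists 2 => //; have f2 := nK _ _ _ i2 u1; have f4 := nK _ _ _ i4 u1.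
  rewrite !(nE, nE') /= in f2 f4.
  have f32 := F _ _ _ h1 (f2 isT isT); have f34 := F _ _ _ h1 (f4 isT isT).
  rewrite h1 [K p2 q1]yK f32 f34 f2 // f4 //.
  have -> // : K p2 q2.
  case/or4P: z2E h2 z2n => /eqP-> h2; rewrite ?eqxx //.
    by rewrite yK f2 in h2.
  by rewrite yK f32 in h2.
exists 1 => //; have f2 := nK _ _ _ i2 u1; have f3 := nK _ _ _ i3 u1.
rewrite !(nE, nE') /= in f2 f3.
have f42 := F _ _ _ h1 (f2 isT isT); have f43 := F _ _ _ h1 (f3 isT isT).
rewrite h1 [K q1 q2]yK f43 [K p2 q2]yK f42 f2 // f3 //.
have -> // : K p2 q1.
case/or4P: z2E h2 z2n => /eqP-> h2; rewrite ?eqxx //.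
  by rewrite yK f2 in h2.
by rewrite yK f42 in h2.
Qed.

(** * Counting classes after successive joins *)

Section Defect.
Variable T : finType.
Implicit Types (R : rel T).

Fixpoint defect R (s : seq (T * T)) : nat :=
  if s is pq :: s' then ~~ R pq.1 pq.2 + defect (Rjoin R pq.1 pq.2) s' else 0.

Lemma ncls_Rjoins R s : equivb R -> ncls R = (ncls (Rjoins R s) + defect R s)%N.
Proof.
elim: s R => [|pq s IH] R eR /=; first by rewrite addn0.
rewrite (ncls_Rjoin pq.1 pq.2 eR) (IH _ (Rjoin_equiv _ _ eR)); lia.
Qed.

Lemma paired_vals R k (x : edge T) : equivb R -> paired k R x ->
  let p1 := x.1.1 in let p2 := x.1.2 in let p3 := x.2.1 in let p4 := x.2.2 in
  [/\ (R p1 p1, R p2 p2, R p3 p3, R p4 p4) = (true, true, true, true),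
      (R p1 p2, R p2 p1, R p3 p4, R p4 p3) = (k == 0, k == 0, k == 0, k == 0)%N,
      (R p1 p4, R p4 p1, R p2 p3, R p3 p2) = (k == 1, k == 1, k == 1, k == 1)%N &
      (R p1 p3, R p3 p1, R p2 p4, R p4 p2) = (k == 2, k == 2, k == 2, k == 2)%N].
Proof.
move=> [rR sR _] [h1 h2 h3 h4 h5 h6] /=.
by rewrite !rR [R x.1.2 x.1.1]sR [R x.2.2 x.2.1]sR [R x.2.2 x.1.1]sR [R x.2.1 x.1.2]sR
  [R x.2.1 x.1.1]sR [R x.2.2 x.1.2]sR h1 h2 h3 h4 h5 h6.
Qed.

(** [c] counts the classes that miss the four ends. The other two are the strands between the ends:
    closed up by their own pairing they form two circles, by a different one a single circle. *)
Lemma paired_ncls K k (x : edge T) : equivb K -> k < 3 -> paired k K x ->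
  exists2 c, ncls K = (c + 2)%N &
    forall l, l < 3 -> ncls (Rjoins K (links l x)) = (c + 1 + (k == l))%N.
Proof.
move=> eK k3 /(paired_vals eK)[[a1 a2 a3 a4] [b1 b2 b3 b4] [c1 c2 c3 c4] [d1 d2 d3 d4]].
have dE l : l < 3 -> defect K (links l x) = ~~ (k == l).
  case: l => [|[|[|//]]] _ /=; rewrite /Rjoin !(a1, a2, a3, a4, b1, b2, b3, b4,
    c1, c2, c3, c4, d1, d2, d3, d4); by case: k k3 {b1 b2 b3 b4 c1 c2 c3 c4 d1 d2 d3 d4} => [|[|[|]]].
move=> {a1 a2 a3 a4 b1 b2 b3 b4 c1 c2 c3 c4 d1 d2 d3 d4}.
(* For [l] other than [k] one join is effective, so [ncls K] is at least 2 and the subtraction below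
   is exact. *)
have [l l3 lk] : exists2 l, l < 3 & k != l by case: (k) => [|k']; [exists 1|exists 0].
have := ncls_Rjoins (links l x) eK; rewrite (dE _ l3) lk => nK.
have := ncls_gt0 (Rjoins K (links l x)) x.1.1 => n0.
exists (ncls K - 2); first lia.
by move=> l' l3'; have := ncls_Rjoins (links l' x) eK; rewrite dE //; lia.
Qed.

End Defect.

(** Four strands, two on each side, close up to two circles if the pairings agree and to one
    otherwise, so 2 or 3 of the four joins are effective. *)
Lemma paired_sum (T T' : finType) (K : rel T) (K' : rel T') k k' x y :
    equivb K -> equivb K' -> k < 3 -> k' < 3 -> paired k K x -> paired k' K' y ->
  (ncls K + ncls K' = ncls (Rjoins (rsum K K')
     [:: (inl x.1.1, inr y.1.1); (inl x.1.2, inr y.1.2);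
         (inl x.2.1, inr y.2.1); (inl x.2.2, inr y.2.2)]) + 3 - (k == k'))%N.
Proof.
move=> eK eK' k3 k3' /(paired_vals eK)[[a1 a2 a3 a4] [b1 b2 b3 b4] [c1 c2 c3 c4] [d1 d2 d3 d4]].
move=> /(paired_vals eK')[[a1' a2' a3' a4'] [b1' b2' b3' b4'] [c1' c2' c3' c4'] [d1' d2' d3' d4']].
set s := [:: _; _; _; _].
have [rK _ _] := eK; have [rK' _ _] := eK'.
rewrite -(ncls_rsum rK rK') (ncls_Rjoins s (rsum_equiv eK eK')).
suff -> : defect (rsum K K') s = 3 - (k == k').
  by case: (k == k') => {a1 a2 a3 a4 b1 b2 b3 b4 c1 c2 c3 c4 d1 d2 d3 d4
    a1' a2' a3' a4' b1' b2' b3' b4' c1' c2' c3' c4' d1' d2' d3' d4'}; lia.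
rewrite /s /= /Rjoin /= ?(a1, a2, a3, a4, b1, b2, b3, b4,
    c1, c2, c3, c4, d1, d2, d3, d4, a1', a2', a3', a4', b1', b2', b3', b4',
    c1', c2', c3', c4', d1', d2', d3', d4').
move: k3 k3' => {a1 a2 a3 a4 b1 b2 b3 b4 c1 c2 c3 c4 d1 d2 d3 d4}.
move=> {a1' a2' a3' a4' b1' b2' b3' b4' c1' c2' c3' c4' d1' d2' d3' d4'}.
by case: k k' => [|[|[|?]]] [|[|[|?]]].
Qed.

Lemma card_partition_circ (T : finType) (r : rel T) PP : partition PP (circ r) ->
  #|PP| = ncls (Rof r PP).
Proof.
move=> pP; rewrite {1}(partition_block pP) /ncls.
pose F (X : {set T}) := [set cls r y | y in X].
have -> : [set block r (Rof r PP) x | x : T] =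
    F @: [set [set y | Rof r PP x y] | x : T].
  rewrite -imset_comp; apply: eq_imset => x /=; apply/setP=> X.
  by apply/imsetP/imsetP => -[y xy ->]; exists y => //; move: xy; rewrite inE.
apply: card_in_imset => _ _ /imsetP[x _ ->] /imsetP[y _ ->] /setP e.
have FE x' z : (cls r z \in F [set y | Rof r PP x' y]) = Rof r PP x' z.
  apply/imsetP/idP => [[t + e']|h]; last by exists z; rewrite ?inE.
  by rewrite inE /Rof e'.
by apply/setP=> z; rewrite !inE -!FE e.
Qed.

(** * Counting in 2-sums and minors *)

Section Counts.
Variable L : choiceType.
Implicit Types (P H : packaged L).

Definition voff (A : arrow_pres L) (x : edge (pt A)) : rel (pt A) :=
  off (@gap L A) x (@vrel L A).

Lemma card_vertices (A : arrow_pres L) : #|vertices A| = ncls (connect (@vrel L A)).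
Proof. by []. Qed.

Lemma minor_counts P e x0 x i : packaged_wf P ->
    (edges P).[? e]%fmap = Some x0 -> coupled x0 x ->
  [/\ #|vertices (minor e P i)| = ncls (Rjoins (connect (voff x)) (links (kof i) x)),
      #|vpart (minor e P i)| = ncls (Ropt (val i == 0)%N (RV P) x.1.1 x.2.1) &
      #|bpart (minor e P i)| = ncls (Ropt (val i == 1)%N (RB P) x.1.1 x.1.2)].
Proof.
move=> wP ex cx; have [wA _ _] := wP.
have [V [B [-> [_ wV wB] rV rB]]] := minorP i wP ex.
have ux0 := wf_uniq wA ex.
have [rRV sRV tRV] := RV_equiv wP; have [rRB sRB tRB] := RB_equiv wP.
split.
- rewrite card_vertices; apply: ncls_eq => z t.
  rewrite -(vr_links (kof i) (coupled_uniq wA ex cx) (coupled_arcs wA ex cx)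
    (gapK wA) (segK wA) (seg_neq wA)).
  suff -> : marc (kof i) x (@seg L P) = marc (kof i) x0 (@seg L P) by [].
  by case: cx => -> //; apply: marc_swap_edge.
- rewrite (card_partition_circ wV); apply: ncls_eq => z t; rewrite rV.
  case: cx => -> //; rewrite /Ropt; case: ifP => // _.
  by rewrite /Rjoin /= [RV P x0.2.1 z || _]orbC [RV P x0.2.1 t || _]orbC.
rewrite (card_partition_circ wB); apply: ncls_eq => z t; rewrite rB.
case: cx => -> //; rewrite /Ropt; case: ifP => // _.
have wB0 := bpart_wf wP; have csB := brel_csym wA.
(* Reading the arrows in the other order replaces [p1], [p2] by [q1], [q2]. As [p1] shares a
   boundary component with [q2], and [p2] with [q1], this merely exchanges [a] and [b]. *)
have e12 u : RB P x0.1.1 u = RB P x0.2.2 u /\ RB P x0.1.2 u = RB P x0.2.1 u.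
  have lk p q : (p, q) \in links 1 x0 -> RB P p q.
    move=> pq; apply: (Rof_connect csB wB0).
    by rewrite (brel_links wA ex (or_introl erefl)); apply: Rjoins_mem pq;
      apply/connect_equiv/sym_connect_sym/(boff_sym wA ex (or_introl erefl)).
  have sw p q : RB P p q -> RB P p u = RB P q u.
    by move=> pq; apply/idP/idP; apply: tRB; rewrite // sRB.
  by split; apply/sw/lk; rewrite !inE eqxx ?orbT.
rewrite /Rjoin /= !(proj1 (e12 _)) !(proj2 (e12 _)).
by rewrite [RB P x0.2.2 z || _]orbC [RB P x0.2.2 t || _]orbC.
Qed.

Lemma sum2_counts P H f e (phi : {perm bool}) x y0 : packaged_wf P -> packaged_wf H ->
    (edges P).[? f]%fmap = Some x -> (edges H).[? e]%fmap = Some y0 ->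
    [disjoint E(P) & E(H)]%fset ->
  let y := (nth_arrow y0 (phi false), nth_arrow y0 (phi true)) in
  [/\ #|vertices (sum2 P H f e phi)| =
        ncls (Rjoins (rsum (connect (voff x)) (connect (voff y)))
          [:: (inl x.1.1, inr y.1.1); (inl x.1.2, inr y.1.2);
              (inl x.2.1, inr y.2.1); (inl x.2.2, inr y.2.2)]),
      #|vpart (sum2 P H f e phi)| = ncls (Rjoins (rsum (RV P) (RV H))
          [:: (inl x.1.1, inr y.1.1); (inl x.2.1, inr y.2.1)]) &
      #|bpart (sum2 P H f e phi)| = ncls (Rjoins (rsum (RB P) (RB H))
          [:: (inl x.1.1, inr y.1.1); (inl x.1.2, inr y.1.2)])].
Proof.
move=> wP wH fx ey d y; have [V [B [-> [_ wV wB] rV rB]]] := sum2P phi wP wH fx ey d.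
split.
- rewrite card_vertices; apply: ncls_eq => z t.
  rewrite (vrel_spres (pres_wf wP) (pres_wf wH) fx (or_introl erefl) ey (coupled_perm y0 phi)).
  by apply: Rjoins_eq => ? ?; rewrite connect_rsum.
- by rewrite (card_partition_circ wV); apply: ncls_eq.
- by rewrite (card_partition_circ wB); apply: ncls_eq.
Qed.

Lemma ncls_Ropt (T : finType) b (R : rel T) p q : equivb R ->
  ncls R = (ncls (Ropt b R p q) + (~~ b && ~~ R p q))%N.
Proof. by move=> eR; case: b; rewrite /= ?addn0 //; apply: ncls_Rjoin. Qed.

(** Seen from [R], gluing adds a relation between [p] and [q] exactly when [R'] relates [p'] and
    [q']. The classes of [R'] through neither [p'] nor [q'] are untouched; [c] is their number. *)
Lemma ncls_glue2 (T T' : finType) (R : rel T) (R' : rel T') p q p' q' :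
    equivb R -> equivb R' ->
  exists2 c, ncls R' = (c + 1 + ~~ R' p' q')%N &
    ncls (Rjoins (rsum R R') [:: (inl p, inr p'); (inl q, inr q')]) =
      (c + ncls (Ropt (~~ R' p' q') R p q))%N.
Proof.
move=> eR eR'; have [rR _ _] := eR; have [rR' _ _] := eR'.
have := ncls_Rjoins [:: (inl p, inr p'); (inl q, inr q')] (rsum_equiv eR eR').
rewrite (ncls_rsum rR rR') /= /Rjoin /= !orbF.
have := ncls_Rjoin p' q' eR'; have := ncls_gt0 (Rjoin R' p' q') p' => n0 n1.
have := ncls_Ropt (~~ R' p' q') p q eR; rewrite negbK => n2 n3.
exists (ncls R' - 1 - ~~ R' p' q'); first lia.
by move: n3 n2; case: (R' p' q') n1 => /= n1; rewrite ?andbT ?andbF; lia.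
Qed.

Section OneEdge.
Variables (H : packaged L) (e : L) (y0 y : edge (pt H)).
Hypotheses (wH : packaged_wf H) (ey : (edges H).[? e]%fmap = Some y0).
Hypotheses (cy : coupled y0 y) (He : E(H) = [fset e]%fset).

(** The strands lie inside blocks of both partitions. Pairing 0 puts [p1] and [p2] on one strand, so
    the two boundary blocks coincide and only the vertex blocks are free: types 0 and 3. Pairing 1
    joins [p1] to [p4], which lies on the vertex of [p3], so only the boundary blocks are free:
    types 1 and 4. Pairing 2 forces both coincidences. *)
Lemma coupling_type : exists i : 'I_5,
  [/\ paired (kof i) (connect (voff y)) y, kof i < 3,
      (val i == 0)%N = ~~ RV H y.1.1 y.2.1 &
      (val i == 1)%N = ~~ RB H y.1.1 y.1.2].
Proof.
have [wA wV wB] := wH; have csV := vrel_csym wA; have csB := brel_csym wA.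
have uy := coupled_uniq wA ey cy; have ay := coupled_arcs wA ey cy.
have [k k3 pk] := off_paired (gapK wA) (gap_neq wA) (segK wA) (seg_neq wA) uy ay.
have [rRV sRV tRV] := RV_equiv wH; have [rRB sRB tRB] := RB_equiv wH.
have subV : subrel (connect (voff y)) (RV H).
  apply: connect_min; first exact: RV_equiv.
  move=> z t zt; apply: (Rof_connect csV wV); apply: connect1; move: zt.
  by rewrite /voff /off /vrel => /orP[->|/andP[_]].
(* Since [e] is the only edge, [brel] follows [seg] away from its ends, so vertices and boundary
   components have the same strands. *)
have free z : z \notin ends y -> free_pt z.
  move=> zy l t lt; apply: contra zy => zt; rewrite (coupled_mem cy).
  have : l \in E(H) by rewrite -fndSome lt.
  by rewrite He inE => /eqP le; move: lt; rewrite le ey => -[->].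
have subB : subrel (connect (voff y)) (RB H).
  apply: connect_min; first exact: RB_equiv.
  move=> z t zt; apply: (Rof_connect csB wB); apply: connect1; move: zt.
  rewrite /voff /off => /orP[/eqP->|/andP[/free fz]]; first by rewrite /brel eqxx.
  by rewrite brel_free.
have v34 : RV H y.2.1 y.2.2.
  apply: (Rof_connect csV wV); apply: connect1; have /= := ay true.
  by rewrite /vrel => ->; rewrite eqxx orbT.
have b23 : RB H y.2.1 y.1.2.
  apply: (Rof_connect csB wB); rewrite csB.
  rewrite (brel_links wA ey cy); apply: Rjoins_mem; last by rewrite !inE eqxx orbT.
  exact/connect_equiv/sym_connect_sym/(boff_sym wA ey cy).
have [h1 h2 h3 h4 h5 h6] := pk.
move: k k3 pk h1 h2 h3 h4 h5 h6 => [|[|[|//]]] _ pk h1 h2 h3 h4 h5 h6.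
- have b12 : RB H y.1.1 y.1.2 by apply: subB; rewrite h1.
  case v13: (RV H y.1.1 y.2.1); [exists (@Ordinal 5 3 isT)|exists (@Ordinal 5 0 isT)];
    by rewrite ?v13 ?b12.
- have v13 : RV H y.1.1 y.2.1.
    by apply: (tRV y.2.2); [apply: subV; rewrite h3 | rewrite sRV].
  case b12: (RB H y.1.1 y.1.2); [exists (@Ordinal 5 4 isT)|exists (@Ordinal 5 1 isT)];
    by rewrite ?v13 ?b12.
have v13 : RV H y.1.1 y.2.1 by apply: subV; rewrite h5.
have b12 : RB H y.1.1 y.1.2 by apply: (tRB y.2.1) b23; apply: subB; rewrite h5.
by exists (@Ordinal 5 2 isT); rewrite ?v13 ?b12.
Qed.

End OneEdge.

(** [i] is the type of [H], and [cv], [cb], [cg] are the exponents of its monomial: the numbers of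
    circles and blocks that [e] does not meet. All four are fixed before the minor [j] and before
    [P] and [f]. *)
Lemma one_edge_counts H e phi : packaged_wf H -> e \in E(H) -> E(H) = [fset e]%fset ->
  exists (i : 'I_5) cv cb cg,
    (forall j, [/\ #|vertices (minor e H j)| = (cv + 1 + (kof i == kof j))%N,
       #|vpart (minor e H j)| = (cb + 1 + ((val i == 0) && (val j == 0)))%N &
       #|bpart (minor e H j)| = (cg + 1 + ((val i == 1) && (val j == 1)))%N]) /\
    (forall P f, packaged_wf P -> f \in E(P) -> [disjoint E(P) & E(H)]%fset ->
      [/\ #|vertices (sum2 P H f e phi)| = (cv + #|vertices (minor f P i)|)%N,
       #|vpart (sum2 P H f e phi)| = (cb + #|vpart (minor f P i)|)%N &
       #|bpart (sum2 P H f e phi)| = (cg + #|bpart (minor f P i)|)%N]).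
Proof.
move=> wH eH He; have ey := in_fnd eH; move: ((edges H).[eH])%fmap ey => y0 ey.
have cy := coupled_perm y0 phi; set y := (_, _) in cy.
have wA := pres_wf wH.
have uy := coupled_uniq wA ey cy; have ay := coupled_arcs wA ey cy.
have [i [pk k3 iV iB]] := coupling_type wH ey cy He.
have eK : equivb (connect (voff y)).
  exact/connect_equiv/sym_connect_sym/(voff_sym (gapK wA) (segK wA) ay).
have k3' j : kof j < 3 by case: j => [[|[|[|[|[|]]]]]].
have [cv nK nKl] := paired_ncls eK k3 pk.
have eV := RV_equiv wH; have eB := RB_equiv wH.
(* Gluing [H] to itself serves only to split the number of blocks of [H]. The constants obtained for
   [P] below satisfy the same equation and hence are equal to these. *)
have [cb nV _] := ncls_glue2 y.1.1 y.2.1 y.1.1 y.2.1 eV eV.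
have [cg nB _] := ncls_glue2 y.1.1 y.1.2 y.1.1 y.1.2 eB eB.
exists i, cv, cb, cg; split=> [j|P f wP fP d].
  have [-> -> ->] := minor_counts j wH ey cy; rewrite nKl //.
  have := ncls_Ropt (val j == 0)%N y.1.1 y.2.1 eV.
  have := ncls_Ropt (val j == 1)%N y.1.1 y.1.2 eB.
  rewrite -iV -iB {iV iB pk} in nV nB *.
  rewrite nV nB; case: (val i == 0)%N (val j == 0)%N => [] [];
  case: (val i == 1)%N (val j == 1)%N => [] [] /=; split=> //; lia.
have fx := in_fnd fP; move: ((edges P).[fP])%fmap fx => x fx.
have cx : coupled x x by left.
have [-> -> ->] := sum2_counts phi wP wH fx ey d.
have [-> -> ->] := minor_counts i wP fx cx.
have wA' := pres_wf wP.
have ux := coupled_uniq wA' fx cx; have ax := coupled_arcs wA' fx cx.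
have eKP : equivb (connect (voff x)).
  exact/connect_equiv/sym_connect_sym/(voff_sym (gapK wA') (segK wA') ax).
have [l l3 pl] := off_paired (gapK wA') (gap_neq wA') (segK wA') (seg_neq wA') ux ax.
have [cp nP nPl] := paired_ncls eKP l3 pl.
split.
- have := paired_sum eKP eK l3 k3 pl pk; rewrite nPl // nP nK {nK nKl nP nPl nV nB}.
  by move: (ncls _) => N; case: (l == kof i); lia.
- have [c nV' ->] := ncls_glue2 x.1.1 x.2.1 y.1.1 y.2.1 (RV_equiv wP) eV.
  rewrite iV; congr (_ + _)%N; apply/eqP.
  by rewrite -(eqn_add2r (1 + ~~ RV H y.1.1 y.2.1)) !addnA -nV' -nV.
have [c nB' ->] := ncls_glue2 x.1.1 x.1.2 y.1.1 y.1.2 (RB_equiv wP) eB.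
rewrite iB; congr (_ + _)%N; apply/eqP.
by rewrite -(eqn_add2r (1 + ~~ RB H y.1.1 y.1.2)) !addnA -nB' -nB.
Qed.

End Counts.

(** * The weights of a coupled edge *)

Import GRing.Theory.
Local Open Scope ring_scope.

Section TwoSumQ.
Variables (L : choiceType) (R : comNzRingType) (alpha beta gamma : R).
Implicit Types (P H : packaged L) (w : L -> 'cV[R]_5).
Notation QQ w := (Q w alpha beta gamma).
Notation M := (coupling_mx alpha beta gamma).

(** Row [j] is the minor taken and column [i] the type of [H]. The exponent of [alpha] is the number
    of circles formed by the strands; that of [beta] is 2 only if the two vertex blocks are distinct
    in [H] and the minor keeps them apart, and likewise for [gamma] and boundary blocks. *)
Lemma coupling_mxE (j i : 'I_5) : M j i =
  alpha ^+ (1 + (kof i == kof j)) * beta ^+ (1 + ((val i == 0) && (val j == 0)))%N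
  * gamma ^+ (1 + ((val i == 1) && (val j == 1)))%N.
Proof.
rewrite !mxE; case: i j => [[|[|[|[|[|//]]]]] i5] [[|[|[|[|[|//]]]]] j5];
  rewrite /= ?addn0 ?addn1 ?expr2 ?expr1; ring.
Qed.

Lemma Q_edgelessE w P : E(P) = fset0 ->
  QQ w P = alpha ^+ #|vertices P| * beta ^+ #|vpart P| * gamma ^+ #|bpart P|.
Proof. exact: Q_base. Qed.

Lemma Q_eq_weights w w' P : packaged_wf P -> {in E(P), w =1 w'} -> QQ w P = QQ w' P.
Proof.
move eN : #|` E(P)|%fset => n; elim: n P eN => [|n IH] P eN wP ww.
  by have E0 := cardfs0_eq eN; rewrite !Q_base.
have /fset0Pn[e eP] : E(P) != fset0 by rewrite -cardfs_gt0 eN.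
rewrite !(Q_edge _ _ _ _ wP eP) ww //; apply: eq_bigr => i _; congr (_ * _).
apply: IH; first by move: (cardfsD1 e E(P)); rewrite minor_edges // eP eN => -[].
  exact: minor_wf.
by move=> l; rewrite minor_edges // inE => /andP[_]; apply: ww.
Qed.

Lemma disjoint_minorl P H g i : packaged_wf P -> g \in E(P) ->
  [disjoint E(P) & E(H)]%fset -> [disjoint E(minor g P i) & E(H)]%fset.
Proof.
move=> wP gP d; apply/fdisjointP=> l; rewrite minor_edges // inE => /andP[_].
exact: (fdisjointP d).
Qed.

Lemma sum2_one_edge w H e (phi : {perm bool}) :
    packaged_wf H -> e \in E(H) -> E(H) = [fset e]%fset ->
  exists z : 'cV[R]_5, M *m z = Q_minors w alpha beta gamma e H /\
    forall P f, packaged_wf P -> f \in E(P) -> [disjoint E(P) & E(H)]%fset ->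
      QQ w (sum2 P H f e phi) = \sum_i z i 0 * QQ w (minor f P i).
Proof.
move=> wH eH He.
have [i [cv [cb [cg [cH cP]]]]] := one_edge_counts phi wH eH He.
pose c := alpha ^+ cv * beta ^+ cb * gamma ^+ cg.
pose z : 'cV[R]_5 := \col_j (if j == i then c else 0).
have sumz (F : 'I_5 -> R) : \sum_j F j * z j 0 = F i * c.
  rewrite (bigD1 i) //= big1 ?mxE ?eqxx ?addr0 // => j /negbTE ji.
  by rewrite mxE ji mulr0.
exists z; split.
  apply/colP=> j; rewrite mxE sumz coupling_mxE mxE Q_edgelessE; last first.
    by rewrite minor_edges // He fsetDv.
  have [-> -> ->] := cH j.
  by rewrite -!addnA !(exprD _ cv, exprD _ cb, exprD _ cg) /c; ring.
move=> P f; move eN : #|` E(P)|%fset => n; elim: n P eN => [|n IH] P eN wP fP d.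
  by move: fP; rewrite (cardfs0_eq eN).
have [/eqP Pf|] := boolP (E(P) `\ f == fset0)%fset.
  under eq_bigr do rewrite mulrC.
  rewrite sumz !Q_edgelessE ?minor_edges //; last first.
    by rewrite sum2_edges // Pf He fsetDv fsetU0.
  have [-> -> ->] := cP P f wP fP d.
  by rewrite !exprD /c; do 6![move: (_ ^+ _) => ?]; ring.
case/fset0Pn=> g; rewrite !inE => /andP[gf gP].
have gS : g \in E(sum2 P H f e phi) by rewrite sum2_edges // !inE gf gP.
rewrite (Q_edge _ _ _ _ (sum2_wf _ wP wH fP eH d) gS).
under [RHS]eq_bigr => j _ do rewrite (Q_edge _ _ _ _ (minor_wf j wP fP) (e := g))
  ?minor_edges ?inE ?gf // mulr_sumr.
rewrite exchange_big /=; apply: eq_bigr => j _.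
rewrite -sum2_minorl // IH.
- rewrite mulr_sumr; apply: eq_bigr => l _.
  by rewrite (minor_swap _ _ wP) // mulrCA.
- by move: (cardfsD1 g E(P)); rewrite minor_edges // gP eN => -[].
- exact: minor_wf.
- by rewrite minor_edges // !inE eq_sym gf.
- exact: disjoint_minorl.
Qed.

Lemma sum2_coeff w H e (phi : {perm bool}) : packaged_wf H -> e \in E(H) ->
  exists z : 'cV[R]_5, M *m z = Q_minors w alpha beta gamma e H /\
    forall P f, packaged_wf P -> f \in E(P) -> [disjoint E(P) & E(H)]%fset ->
      QQ w (sum2 P H f e phi) = \sum_i z i 0 * QQ w (minor f P i).
Proof.
move eN : #|` E(H)|%fset => n; elim: n H eN => [|n IH] H eN wH eH.
  by move: eH; rewrite (cardfs0_eq eN).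
have [/eqP He|] := boolP (E(H) `\ e == fset0)%fset.
  by apply: sum2_one_edge; rewrite // -(fsetD1K eH) He fsetU0.
case/fset0Pn=> g; rewrite !inE => /andP[ge gH].
(* Each minor of [H] at [g] has its own vector, valid for all [P] and [f]; weighting these vectors
   by [w g] yields the vector of [H]. *)
have /fin_all_exists[z zP] j : exists z : 'cV[R]_5,
    M *m z = Q_minors w alpha beta gamma e (minor g H j) /\
    forall P f, packaged_wf P -> f \in E(P) ->
      [disjoint E(P) & E(minor g H j)]%fset ->
      QQ w (sum2 P (minor g H j) f e phi) = \sum_i z i 0 * QQ w (minor f P i).
  apply: IH; first by move: (cardfsD1 g E(H)); rewrite minor_edges // gH eN => -[].
    exact: minor_wf.
  by rewrite minor_edges // !inE eq_sym ge.
exists (\sum_j w g j 0 *: z j); split.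
  rewrite mulmx_sumr; apply/colP=> i; rewrite summxE mxE.
  rewrite (Q_edge _ _ _ _ (minor_wf i wH eH) (e := g)) ?minor_edges ?inE ?ge //.
  apply: eq_bigr => j _; rewrite -scalemxAr mxE; case: (zP j) => -> _.
  by rewrite mxE (minor_swap _ _ wH) // eq_sym.
move=> P f wP fP d.
have gS : g \in E(sum2 P H f e phi) by rewrite sum2_edges // !inE ge gH orbT.
rewrite (Q_edge _ _ _ _ (sum2_wf _ wP wH fP eH d) gS).
under [RHS]eq_bigr => i _ do rewrite summxE mulr_suml.
rewrite exchange_big /=; apply: eq_bigr => j _.
rewrite -sum2_minorr //; have [_ ->] := zP j; rewrite //; last first.
  apply/fdisjointP=> l lP; rewrite minor_edges // inE negb_and.
  by rewrite (fdisjointP d l lP) orbT.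
by rewrite mulr_sumr; apply: eq_bigr => i _; rewrite mxE mulrA.
Qed.

Lemma Q_sum2 w P H f e (phi : {perm bool}) (z : 'cV[R]_5) :
    packaged_wf P -> packaged_wf H -> f \in E(P) -> e \in E(H) ->
    [disjoint E(P) & E(H)]%fset ->
    unique (fun z => M *m z = Q_minors w alpha beta gamma e H) z ->
  QQ w (sum2 P H f e phi) = \sum_i z i 0 * QQ w (minor f P i).
Proof.
move=> wP wH fP eH d [_ uz]; have [z' [Mz' ->//]] := sum2_coeff w phi wH eH.
by rewrite (uz z').
Qed.

End TwoSumQ.

(** * Iterated 2-sums *)

Section Iterate.
Variables (L : choiceType) (R : comNzRingType) (alpha beta gamma : R).
Variables (k : nat) (H : 'I_k -> packaged L) (f e : 'I_k -> L).
Variables (coupling : 'I_k -> {perm bool}) (w : L -> 'cV[R]_5).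
Variable phi : 'I_k -> 'cV[R]_5.
Implicit Types (s : seq 'I_k) (P : packaged L).

(** The weights for a final part [s] of the iteration; for the list of all indices they are
    [sum_weights]. *)
Definition weights_on s : L -> 'cV[R]_5 :=
  fun l => if [pick i | (i \in s) && (f i == l)] is Some i then phi i else w l.

Hypotheses (wH : forall i, packaged_wf (H i)) (f_inj : injective f).
Hypothesis dH : forall i j, i != j -> [disjoint E(H i) & E(H j)]%fset.
Hypothesis eH : forall i, e i \in E(H i).
Hypothesis phiP : forall i, unique
  (fun z => coupling_mx alpha beta gamma *m z
            = Q_minors w alpha beta gamma (e i) (H i)) (phi i).

Lemma weights_on_in s i : i \in s -> weights_on s (f i) = phi i.
Proof.
move=> si; rewrite /weights_on; case: pickP => [j /andP[_ /eqP/f_inj->]//|].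
by move/(_ i); rewrite si eqxx.
Qed.

Lemma weights_on_out s l : {in s, forall i, f i != l} -> weights_on s l = w l.
Proof.
by move=> sl; rewrite /weights_on; case: pickP => // i /andP[/sl/negbTE->].
Qed.

Lemma weights_on_cons s i l : f i != l -> weights_on (i :: s) l = weights_on s l.
Proof.
move=> il; rewrite /weights_on (eq_pick (Q := fun j => (j \in s) && (f j == l))) //.
by move=> j /=; rewrite inE; case: eqVneq => // ->; rewrite (negbTE il) !andbF.
Qed.

(** The later 2-sums are absorbed first: the induction hypothesis is applied to the sum of [P] with
    [H i], and only then is [H i] replaced by the weight [phi i], with [weights_on s] as weights
    elsewhere. *)
Lemma Q_foldl_sum2 s P : uniq s -> packaged_wf P ->
    {in s, forall i, f i \in E(P)} ->
    {in s, forall i, [disjoint E(P) & E(H i)]%fset} ->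
  Q w alpha beta gamma
    (foldl (fun S i => sum2 S (H i) (f i) (e i) (coupling i)) P s)
  = Q (weights_on s) alpha beta gamma P.
Proof.
elim: s P => [|i s IH] P /=.
  by move=> _ wP _ _; apply: Q_eq_weights => // l _; rewrite weights_on_out.
move=> /andP[si us] wP fP d.
have fi : f i \in E(P) by apply: fP; rewrite inE eqxx.
have di : [disjoint E(P) & E(H i)]%fset by apply: d; rewrite inE eqxx.
have neq j : j \in s -> i != j by move=> sj; apply: contraNneq si => ->.
pose S := sum2 P (H i) (f i) (e i) (coupling i).
have wS : packaged_wf S by apply: sum2_wf.
have fS : {in s, forall j, f j \in E(S)}.
  move=> j sj; rewrite sum2_edges // !inE fP ?inE ?sj ?orbT // andbT.
  by rewrite (inj_eq f_inj) eq_sym neq.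
have dS : {in s, forall j, [disjoint E(S) & E(H j)]%fset}.
  move=> j sj; rewrite sum2_edges //; apply/fdisjointP=> l.
  rewrite !inE => /orP[/andP[_ lP]|/andP[_ lH]].
    by apply: (fdisjointP (d j _)) => //; rewrite inE sj orbT.
  exact: (fdisjointP (dH (neq j sj))).
rewrite IH //.
rewrite (Q_edge _ _ _ _ wP fi) weights_on_in ?inE ?eqxx //.
rewrite (Q_sum2 (coupling i) wP (wH i) fi (eH i) di (z := phi i)).
  apply: eq_bigr => l _; congr (_ * _); apply: Q_eq_weights; first exact: minor_wf.
  by move=> l'; rewrite minor_edges // !inE eq_sym => /andP[/weights_on_cons->].
(* The system arises with the weights [weights_on s] but is assumed for [w]. They agree on [H i],
   since each [f j] is an edge of [P] and so not of [H i]. *)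
have -> : Q_minors (weights_on s) alpha beta gamma (e i) (H i) =
    Q_minors w alpha beta gamma (e i) (H i); last exact: phiP.
apply/colP=> l; rewrite !mxE; apply: Q_eq_weights; first exact: minor_wf.
move=> l'; rewrite minor_edges // inE => /andP[_ lH]; apply: weights_on_out => j sj.
apply: contraTneq lH => <-; apply: (fdisjointP di); apply: fP.
by rewrite inE sj orbT.
Qed.

End Iterate.

Local Open Scope fset_scope.
Local Open Scope ring_scope.

Theorem theorem3p7 (L : choiceType) (R : comNzRingType) (alpha beta gamma : R)
    (k : nat) (P : packaged L) (H : 'I_k -> packaged L)
    (f e : 'I_k -> L) (coupling : 'I_k -> {perm bool})
    (w : L -> 'cV[R]_5) (phi : 'I_k -> 'cV[R]_5) :
  packaged_wf P ->
  (forall i, packaged_wf (H i)) ->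
  (forall i, [disjoint E(P) & E(H i)]%fset) ->
  (forall i j, i != j -> [disjoint E(H i) & E(H j)]%fset) ->
  injective f ->
  (forall i, f i \in E(P)) ->
  (forall i, e i \in E(H i)) ->
  (forall i, unique
     (fun z => coupling_mx alpha beta gamma *m z
               = Q_minors w alpha beta gamma (e i) (H i))
     (phi i)) ->
  Q w alpha beta gamma (iter_sum2 P H f e coupling)
  = Q (sum_weights f phi w) alpha beta gamma P.
Proof.
move=> wP wH dP dH f_inj fP eH phiP; rewrite /iter_sum2.
rewrite (Q_foldl_sum2 _ wH f_inj dH eH phiP) ?enum_uniq //.
apply: Q_eq_weights => // l _; rewrite /weights_on /sum_weights.
by rewrite (eq_pick (Q := fun i => f i == l)) // => i; rewrite mem_enum.
Qed.
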